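(* Let $\mathbf T=(T_1,\ldots,T_m)$ be a tuple of invertible real $2\times2$ matrices with $\|T_i\|<1$ for $1\le i\le m$. Let $W\in G(2,1)$, and let $\mu$ be an ergodic $\sigma$-invariant measure on $\Sigma$. Let $\Lambda_1\ge\Lambda_2$ be the Lyapunov exponents (counting multiplicity) of the cocycle $x\mapsto T_{x_1}^*$ with respect to $\mu$. Set $\mathcal A=\{i\colon1\le i\le m\text{ and }\mu([i])>0\}$. Then the following statements hold. (1) $\overline S(\mu,\mathbf T,W)<\min\{1,\dim_{\rm LY}(\mu,\mathbf T)\}$ if and only if all the following conditions are fulfilled: (a) $T_i^*W=W$ for all $i\in\mathcal A$; (b) for $i\in\mathcal A$, let $a_i$ be the eigenvalue of $T_i^*$ corresponding to $W$, and set $b_i=\det(T_i)/a_i$; then $$\Lambda_2=\sum_{i\in\mathcal A}\mu([i])\log|a_i|<\Lambda_1=\sum_{i\in\mathcal A}\mu([i])\log|b_i|;$$ (c) $h_\mu(\sigma)>0$ and $h_\mu(\sigma)+\Lambda_2<0$. (2) $\overline S(\mu,\mathbf T,W)\ne\underline S(\mu,\mathbf T,W)$ if and only if all the following conditions are fulfilled: (a) $\Lambda_1>\Lambda_2$; (b) letting $\mathbb R^2=E_1(x)\oplus E_2(x)$, $x\in\Sigma'$, be the corresponding Oseledets splittings for the cocycle $x\mapsto T_{x_1}^*$ and $\mu$, one has $$0<\mu(\{x\in\Sigma'\colon E_2(x)=W\})<1;$$ (c) $h_\mu(\sigma)>0$ and $h_\mu(\sigma)+\Lambda_2<0$.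
   Context: $\|\cdot\|$ is the Euclidean norm and the induced operator norm; $A^*$ is the transpose. $\Sigma=\{1,\ldots,m\}^{\mathbb N}$ with left shift $\sigma$; measures are Borel probability measures; $h_\mu(\sigma)$ is the measure-theoretic entropy. $x|n=x_1\cdots x_n$; $[I]$ is the cylinder set of a word $I$; $T_I=T_{i_1}\cdots T_{i_n}$ for $I=i_1\cdots i_n$, $T_I^*=(T_I)^*$. $G(2,1)$ is the set of one-dimensional linear subspaces of $\mathbb R^2$; $P_W$ is the orthogonal projection onto $W$. The eigenvalue of $T_i^*$ corresponding to $W$ is the $a_i$ with $T_i^*w=a_iw$ for $w\in W$. Lyapunov exponents: $\Lambda_i=\lim_{n\to\infty}\frac1n\int\log\alpha_i(T_{x|n})\,d\mu(x)$, $i=1,2$, where $\alpha_1(A)\ge\alpha_2(A)$ are the singular values of $A$. Oseledets splitting: when $\Lambda_1>\Lambda_2$, there are a measurable $\Sigma'\subset\Sigma$ with $\sigma(\Sigma')\subset\Sigma'$, $\mu(\Sigma')=1$, and measurable maps $x\mapsto E_1(x),E_2(x)\in G(2,1)$ on $\Sigma'$ with $\mathbb R^2=E_1(x)\oplus E_2(x)$, $T_{x_1}^*E_i(x)=E_i(\sigma x)$ and $\lim_n\frac1n\log\|T_{x|n}^*v\|=\Lambda_i$ for $v\in E_i(x)\setminus\{0\}$. Singular value function ($d=2$): $\varphi^s(A)=\alpha_1(A)^s$ for $0\le s<1$, $\varphi^s(A)=\alpha_1(A)\alpha_2(A)^{s-1}$ for $1\le s<2$ (convention $0^0=1$), $\varphi^s(A)=|\det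 A|^{s/2}$ for $s\ge2$. $\dim_{\rm LY}(\mu,\mathbf T)$ is the unique $s\ge0$ with $h_\mu(\sigma)+\lim_{n\to\infty}\frac1n\int\log\varphi^s(T_{x|n})\,d\mu(x)=0$. $S_n(\mu,\mathbf T,W,x)=\sup\{s\in[0,1]\colon\varphi^s(P_WT_{x|n})\ge\mu([x|n])\}$ and $S(\mu,\mathbf T,W,x)=\lim_{n\to\infty}S_n(\mu,\mathbf T,W,x)$, which exists for $\mu$-a.e. $x$; $\underline S(\mu,\mathbf T,W)$ and $\overline S(\mu,\mathbf T,W)$ are the $\mu$-essential infimum and supremum of $x\mapsto S(\mu,\mathbf T,W,x)$. *)

(* Defs.v *)
From HB Require Import structures.
From mathcomp Require Import all_boot all_order all_algebra.
From mathcomp Require Import all_classical all_reals all_analysis.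
From mathcomp Require Import ess_sup_inf.

Set Implicit Arguments.
Unset Strict Implicit.
Unset Printing Implicit Defensive.

Import Order.TTheory GRing.Theory Num.Theory.
Import numFieldNormedType.Exports.

Local Open Scope classical_set_scope.
Local Open Scope ring_scope.

(** ** Linear algebra in the plane *)

(* The library norm on matrices is the sup norm, hence these two. *)
Definition enorm (R : realType) (v : 'cV[R]_2) : R :=
  Num.sqrt (\sum_i v i 0 ^+ 2).

Definition opnorm (R : realType) (A : 'M[R]_2) : R :=
  sup [set enorm (A *m v) | v in [set v : 'cV[R]_2 | enorm v <= 1]].

(* The singular values are the square roots of the eigenvalues of [A^T *m A].
   There are two of them counted with multiplicity, so the larger and the
   smaller one are the maximum and the minimum of the set of all of them. *)
Definition sing_vals (R : realType) (A : 'M[R]_2) : set R :=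
  [set Num.sqrt l | l in [set l : R | eigenvalue (A^T *m A) l]].

Definition alpha1 (R : realType) (A : 'M[R]_2) : R := sup (sing_vals A).

Definition alpha2 (R : realType) (A : 'M[R]_2) : R := inf (sing_vals A).

(* Meant for [0 <= s]; [powR] satisfies [0 `^ 0 = 1]. *)
Definition svf (R : realType) (s : R) (A : 'M[R]_2) : R :=
  if s < 1 then alpha1 A `^ s
  else if s < 2 then alpha1 A * alpha2 A `^ (s - 1)
  else `|\det A| `^ (s / 2).

(* Orthogonal projection onto [W], for [\dim W = 1]: [w w^T / |w|^2] for any
   nonzero [w] in [W]. *)
Definition line_proj (R : realType) (W : {vspace 'cV[R]_2}) : 'M[R]_2 :=
  let w := vpick W in (enorm w ^+ 2)^-1 *: (w *m w^T).

Definition mximg (R : realType) (A : 'M[R]_2) (W : {vspace 'cV[R]_2}) :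
  {vspace 'cV[R]_2} := (linfun (mulmx A : 'cV[R]_2 -> 'cV[R]_2) @: W)%VS.

(** ** The full shift *)

HB.instance Definition _ (m : nat) := isPointed.Build 'I_m.+1 ord0.

(* Letters are [0, ..., m] (a nonempty alphabet) and positions start at [0],
   so that [x i] is the letter usually written [x_{i+1}]. *)
Notation seq_space m :=
  (prod_topology (fun _ : nat => discrete_topology 'I_m.+1)).

(* The same space with its Borel sigma-algebra. *)
Notation Shift m := (g_sigma_algebraType (@open (seq_space m))).

Definition left_shift (m : nat) (x : Shift m) : Shift m := fun n => x n.+1.

Definition cylinder (m : nat) (x : Shift m) (n : nat) : set (Shift m) :=
  [set y | forall i, (i < n)%N -> y i = x i].

Definition cylinder1 (m : nat) (i : 'I_m.+1) : set (Shift m) :=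
  [set y | y 0%N = i].

(** ** Measure-preserving maps and entropy *)

Definition invariant_measure (R : realType) (d : measure_display)
    (X : measurableType d) (f : X -> X) (mu : probability X R) : Prop :=
  forall A : set X, measurable A -> mu (f @^-1` A) = mu A.

Definition ergodic_measure (R : realType) (d : measure_display)
    (X : measurableType d) (f : X -> X) (mu : probability X R) : Prop :=
  invariant_measure f mu /\
  forall A : set X, measurable A -> f @^-1` A = A ->
    mu A = 0%E \/ mu A = 1%E.

(* A finite measurable partition into [k] (possibly empty) pieces, given by
   its labelling map. *)
Definition finite_partition (d : measure_display) (X : measurableType d)
    (k : nat) (xi : X -> 'I_k) : Prop :=
  forall j, measurable (xi @^-1` [set j]).

(* Entropy of the join of [xi, f^-1 xi, ..., f^-(n-1) xi]; its pieces are
   indexed by the words [w] of length [n]. Here [0 * ln 0 = 0]. *)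
Definition join_entropy (R : realType) (d : measure_display)
    (X : measurableType d) (f : X -> X) (mu : probability X R)
    (k : nat) (xi : X -> 'I_k) (n : nat) : R :=
  - \sum_(w : {ffun 'I_n -> 'I_k})
      let p := fine (mu [set x | forall i : 'I_n, xi (iter i f x) = w i]) in
      p * ln p.

Definition partition_entropy (R : realType) (d : measure_display)
    (X : measurableType d) (f : X -> X) (mu : probability X R)
    (k : nat) (xi : X -> 'I_k) : R :=
  lim ((fun n : nat => n%:R^-1 * join_entropy f mu xi n) @ \oo).

Definition entropy (R : realType) (d : measure_display)
    (X : measurableType d) (f : X -> X) (mu : probability X R) : \bar R :=
  ereal_sup [set h | exists (k : nat) (xi : X -> 'I_k),
    finite_partition xi /\ h = (partition_entropy f mu xi)%:E].

(** ** Matrix cocycles over the shift *)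

Definition mxword (R : realType) (m : nat) (T : 'I_m.+1 -> 'M[R]_2)
    (x : Shift m) (n : nat) : 'M[R]_2 := \prod_(i < n) T (x i).

Definition growth (R : realType) (m : nat) (mu : probability (Shift m) R)
    (T : 'I_m.+1 -> 'M[R]_2) (g : 'M[R]_2 -> R) : R :=
  lim ((fun n : nat =>
    n%:R^-1 * (\int[mu]_x ln (g (mxword T x n)))) @ \oo).

Definition Lyap1 (R : realType) (m : nat) (mu : probability (Shift m) R)
    (T : 'I_m.+1 -> 'M[R]_2) : R := growth mu T (@alpha1 R).

Definition Lyap2 (R : realType) (m : nat) (mu : probability (Shift m) R)
    (T : 'I_m.+1 -> 'M[R]_2) : R := growth mu T (@alpha2 R).

Definition dim_LY (R : realType) (m : nat) (mu : probability (Shift m) R)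
    (T : 'I_m.+1 -> 'M[R]_2) : R :=
  xget 0 [set s : R | 0 <= s /\
    (entropy (@left_shift m) mu + (growth mu T (svf s))%:E = 0)%E].

Definition S_n (R : realType) (m : nat) (mu : probability (Shift m) R)
    (T : 'I_m.+1 -> 'M[R]_2) (W : {vspace 'cV[R]_2}) (n : nat)
    (x : Shift m) : R :=
  sup [set s : R | 0 <= s <= 1 /\
    (mu (cylinder x n) <= (svf s (line_proj W *m mxword T x n))%:E)%E].

Definition S_lim (R : realType) (m : nat) (mu : probability (Shift m) R)
    (T : 'I_m.+1 -> 'M[R]_2) (W : {vspace 'cV[R]_2}) (x : Shift m) : R :=
  lim ((fun n : nat => S_n mu T W n x) @ \oo).

Definition S_low (R : realType) (m : nat) (mu : probability (Shift m) R)
    (T : 'I_m.+1 -> 'M[R]_2) (W : {vspace 'cV[R]_2}) : \bar R :=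
  ess_inf mu (fun x => (S_lim mu T W x)%:E).

Definition S_up (R : realType) (m : nat) (mu : probability (Shift m) R)
    (T : 'I_m.+1 -> 'M[R]_2) (W : {vspace 'cV[R]_2}) : \bar R :=
  ess_sup mu (fun x => (S_lim mu T W x)%:E).

(* [x |-> E x] is a measurable family of lines on [D]. The space of lines has
   the metric [opnorm (line_proj V - line_proj W)], so Borel measurability is
   that of the entries of the projection. *)
Definition measurable_lines (R : realType) (m : nat) (D : set (Shift m))
    (E : Shift m -> {vspace 'cV[R]_2}) : Prop :=
  (forall x, D x -> \dim (E x) = 1%N) /\
  (forall i j : 'I_2, measurable_fun D (fun x => line_proj (E x) i j)).

Definition growth_on (R : realType) (m : nat) (T : 'I_m.+1 -> 'M[R]_2)
    (x : Shift m) (V : {vspace 'cV[R]_2}) (l : R) : Prop :=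
  forall v : 'cV[R]_2, v \in V -> v != 0 ->
    (fun n : nat => n%:R^-1 * ln (enorm ((mxword T x n)^T *m v))) @ \oo --> l.

(* Oseledets splitting of the cocycle [x |-> (T (x 0))^T]. Over the one-sided
   shift, which is not invertible, only the slow direction [E2] is determined
   by [x], and an equivariant measurable choice of the fast direction [E1] may
   fail to exist; equivariance is therefore required of [E2] only. Splittings
   which are also equivariant in [E1] are covered a fortiori. *)
Definition oseledets_splitting (R : realType) (m : nat)
    (mu : probability (Shift m) R) (T : 'I_m.+1 -> 'M[R]_2)
    (D : set (Shift m)) (E1 E2 : Shift m -> {vspace 'cV[R]_2}) : Prop :=
  [/\ measurable D, (@left_shift m) @` D `<=` D & mu D = 1%E] /\
  [/\ measurable_lines D E1,
      measurable_lines D E2 &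
      forall x, D x ->
        [/\ (E1 x + E2 x = fullv)%VS,
            directv (E1 x + E2 x),
            mximg (T (x 0%N))^T (E2 x) = E2 (left_shift x),
            growth_on T x (E1 x) (Lyap1 mu T) &
            growth_on T x (E2 x) (Lyap2 mu T)]].

(* Main.v *)
Require Import Defs.
From mathcomp Require Import all_boot all_order all_algebra.
From mathcomp Require Import all_classical all_reals all_analysis.
From mathcomp Require Import ess_sup_inf measurable_realfun zify ring lra.

Set Implicit Arguments.
Unset Strict Implicit.
Unset Printing Implicit Defensive.

Import Order.TTheory GRing.Theory Num.Theory.
Import numFieldNormedType.Exports.

Local Open Scope classical_set_scope.
Local Open Scope ring_scope.

(** Let [w] span [W], let [L1] and [L2] be the Lyapunov exponents and [h] the
    entropy. The matrix [P_W T_(x|n)] has rank one, so that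
    [svf s (P_W T_(x|n)) = (|T_(x|n)^T w| / |w|) ^ s] for [s] in [[0, 1]]
    ([svf_line_proj]), and [S_n] is the minimum of [1] and of the quotient of
    [- ln mu [x|n]] by [- ln (|T_(x|n)^T w| / |w|)] ([S_nE]). Divided by [n], the
    numerator tends to [h] almost everywhere ([shannon_mcmillan_breiman],
    [kolmogorov_sinai]) and the denominator to [- L1] or to [- L2]
    ([ae_vec_growth]). Hence [S_lim] is almost everywhere [dim_at h L1] or
    [dim_at h L2], where [dim_at h l = min (1, h / - l)], according to the rate at
    which [w] grows ([ae_dichotomy]). The growth of [svf s] is [s * L1] for
    [s < 1], so [min (1, dim_LY)] is [dim_at h L1] ([min_dim_LY]). Finally
    [dim_at h L2 < dim_at h L1] means exactly that [L2 < L1], [0 < h] and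
    [h + L2 < 0] ([dim_at_lt]), so that only the set of the [x] along which [w]
    is slow, i.e. grows at the rate [L2], remains to be understood.

    For part (1) it has to be of full measure. If it is and [L2 < L1], then for a
    letter [i] of positive measure and a typical [x] starting with [i], both [w]
    and [(T i)^T w] are slow along the shift of [x]. If they were independent, all
    vectors would be slow there, and the norms of the matrices could not grow at
    the rate [L1] ([slow_parallel], [line_invariant]). So [w] is an eigenvector of
    each such [(T i)^T]; its rate is then the mean of [ln |a i|] by Birkhoff's
    theorem ([eigen_growth]), and [L1] follows from the fact that [L1 + L2] is the
    mean of [ln |det T|] ([Lyap_sum]). For part (2), [slow_parallel] shows that
    [w] is slow along [x] exactly when [E2 x = W], up to a null set, so [S_lim]
    takes its two values on [E2 x = W] and on the complement
    ([ae_S_lim_splitting]).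

    The theorems of Kingman and of Shannon-McMillan-Breiman come from one argument
    ([ergodic_limit]), of which Birkhoff's theorem is a simpler instance
    ([birkhoff_lower]). Let [L] be the supremum of the [c] for which
    [G n >= c * n] eventually, almost everywhere. By a zero-one law ([liminf_0_1])
    a typical point has, for each [c > L], some [l] with [G l <= c * l]. Cutting
    the orbit greedily into such blocks bounds [G n] from above by about [c * n]
    ([greedy_bound]) when [G] is subadditive. The information [- ln mu [x|n]] is
    not subadditive, but it is bounded by the length of a code, up to an
    arbitrarily small linear error, and this length is subadditive along blocks that are
    good words ([info_upper]). That the letters generate the whole
    entropy follows from a comparison of an arbitrary partition with a noisy copy of a
    partition into words ([join_entropy_le]).

    The growth dichotomy for a fixed vector comes from the following: the
    ratio of [|T_(x|n)^T w|] to the norm of the matrix changes at step [n] by at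
    most a constant times [|det| / norm^2], which decays exponentially when
    [L2 < L1]. So the ratio has a limit; if this limit is zero then the ratio
    itself decays at the rate [L2 - L1] ([growth_dichotomy]). *)

(** * Almost sure statements and integrals *)

Lemma bounded_integrable d (X : measurableType d) (R : realType)
    (mu : probability X R) (g : X -> R) (C : R) :
  measurable_fun setT g -> (forall x, `|g x| <= C) ->
  mu.-integrable setT (EFin \o g).
Proof.
move=> mg bg; apply: measurable_bounded_integrable => //.
  exact: le_lt_trans (probability_le1 mu measurableT) (ltry _).
by exists C; split; [exact: num_real|move=> M CM x _; exact: le_trans (bg x) (ltW CM)].
Qed.

Lemma Rintegral_cst1 d (X : measurableType d) (R : realType)
    (mu : probability X R) (c : R) : \int[mu]_x c = c.
Proof.
rewrite Rintegral_cst// [X in fine X](_ : _ = 1%E) ?mulr1//.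
exact: probability_setT.
Qed.

Lemma Rintegral_indic d (X : measurableType d) (R : realType)
    (mu : probability X R) (A : set X) : measurable A ->
  \int[mu]_x \1_A x = fine (mu A).
Proof. by move=> mA; rewrite /Rintegral integral_indic// setIT. Qed.

Lemma ae_pr1 d (X : measurableType d) (R : realType)
    (mu : probability X R) (A : set X) : measurable A ->
  (\forall x \ae mu, A x) <-> mu A = 1%E.
Proof.
move=> mA; rewrite /almost_everywhere/=.
split=> [H|H].
  have := probability_setC mu (measurableC mA); rewrite setCK => ->.
  by rewrite (measure_negligible (measurableC mA) H) sube0.
apply/negligibleP; first exact: measurableC.
by have := probability_setC mu mA; rewrite H subee.
Qed.

Lemma ae_not_pr0 d (X : measurableType d) (R : realType)
    (mu : probability X R) (A : set X) : measurable A ->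
  mu A = 0%E -> \forall x \ae mu, ~ A x.
Proof.
move=> mA A0; exists A; split=> // x /=; exact: contrapT.
Qed.

Lemma ae_ex d (X : measurableType d) (R : realType)
    (mu : probability X R) (P : X -> Prop) :
  (\forall x \ae mu, P x) -> exists x, P x.
Proof.
move=> aeP; have mu0 : (0%R < mu [set: X])%E by rewrite probability_setT.
have := ae_properfilter_algebraOfSetsType mu0 => F.
exact: (@filter_ex _ _ F _ aeP).
Qed.

(** * Greedy cutting of orbits *)
Section combinatorics.
Variable R : realType.

(** The segment from [0] to [n] is cut greedily: a good position opens a block of
    length at most [M], on which the average cost is [c]; the other positions
    cost [C] each. A good position whose block does not fit is among the last
    [M], which is why [M] is added to the number of bad positions. *)
Lemma greedy_bound (n M : nat) (c C K : R) (b : nat -> R) (good : pred nat) :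
  c <= C -> b n <= K ->
  (forall i, (i < n)%N -> b i <= C + b i.+1) ->
  (forall i, (i < n)%N -> good i ->
     exists2 l, (0 < l <= M)%N &
       ((i + l <= n)%N -> b i <= c * l%:R + b (i + l)%N)) ->
  b 0%N <= c * n%:R + (C - c) * ((\sum_(i < n) ~~ good i) + M)%:R + K.
Proof.
move=> cC bK bC bg.
pose bad i := (\sum_(i <= j < n) ~~ good j)%N.
have bad_mono i j : (i <= j)%N -> (bad j <= bad i)%N.
  move=> ij; rewrite /bad; have [jn|nj] := leqP j n.
    by rewrite (big_cat_nat ij jn) /= leq_addl.
  by rewrite big_geq// ltnW.
(* Only [min (M, k)] positions can be lost at the end of a segment of length
   [k]; this sharper count is what the induction preserves. *)
suff H k i : (i + k = n)%N ->
    b i <= c * k%:R + (C - c) * (bad i + minn M k)%:R + K.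
  apply: le_trans (H n 0%N _) _ => //.
  rewrite lerD2r lerD2l ler_wpM2l ?subr_ge0// ler_nat /bad big_mkord.
  by rewrite leq_add2l geq_minl.
elim/ltn_ind: k i => -[_ i|k IH i ikn].
  rewrite addn0 => ->; rewrite mulr0 add0r -lerBlDr.
  apply: (@le_trans _ _ 0); first by rewrite subr_le0.
  by rewrite mulr_ge0 ?subr_ge0.
have i_n : (i < n)%N by rewrite -ikn addnS ltnS leq_addr.
have fill : (k < M)%N || ~~ good i ->
    b i <= c * k.+1%:R + (C - c) * (bad i + minn M k.+1)%:R + K.
  move=> Hc; have := IH k (ltnSn _) i.+1.
  rewrite addSnnS => /(_ ikn) H.
  apply: le_trans (bC _ i_n) _; apply: le_trans (lerD (lexx C) H) _.
  have : (bad i.+1 + minn M k < bad i + minn M k.+1)%N.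
    case: (ltnP k M) Hc => [kM _|Mk /= gi].
      rewrite (minn_idPr kM) addnS ltnS leq_add2r.
      exact: bad_mono.
    rewrite (minn_idPl (leqW Mk)) ltn_add2r /bad.
    by rewrite [X in (_ < X)%N]big_ltn// gi add1n.
  rewrite -(ler_nat R) => /(ler_wpM2l (_ : 0 <= C - c)).
  rewrite subr_ge0 => /(_ cC).
  rewrite -!natr1.
  lra.
case: (boolP (good i)) => [gi|]; last by move=> gi; apply: fill; rewrite gi orbT.
have [kM|Mk] := ltnP k M; first by apply: fill; rewrite kM.
have [l /andP[l0 lM] Hl] := bg i i_n gi.
have lk : (l <= k.+1)%N by rewrite (leq_trans lM)// ltnW.
have iln : (i + l <= n)%N by rewrite -ikn leq_add2l.
apply: le_trans (Hl iln) _.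
have := IH (k.+1 - l)%N _ (i + l)%N; rewrite ltn_subrL l0/= => /(_ isT).
rewrite -addnA subnKC// => /(_ ikn) H.
apply: le_trans (lerD (lexx _) H) _.
have : (bad (i + l) + minn M (k.+1 - l) <= bad i + minn M k.+1)%N.
  by rewrite leq_add ?bad_mono ?leq_addr// leq_min geq_minl (leq_trans (geq_minr _ _))// leq_subr.
rewrite -(ler_nat R) => /(ler_wpM2l (_ : 0 <= C - c)).
rewrite subr_ge0 => /(_ cC).
rewrite natrB//.
lra.
Qed.

End combinatorics.

Lemma near_linear_ge (R : realType) (a e : R) : 0 < e ->
  \forall n \near \oo, a <= e * n%:R.
Proof.
move=> e0; have := nbhs_infty_ger (a / e); apply: filterS => n.
by rewrite ler_pdivrMr// mulrC.
Qed.

Lemma measurable_le_cst d (X : measurableType d) (R : realType) (g : X -> R) (a : R) :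
  measurable_fun setT g -> measurable [set x | g x <= a].
Proof.
move=> mg; rewrite -[X in measurable X]setTI.
by apply: measurable_fun_le => //; exact: measurable_cst.
Qed.

Lemma indic_norm_le1 (T : Type) (R : realType) (A : set T) (x : T) :
  `|\1_A x : R| <= 1.
Proof. by rewrite indicE; case: (_ \in _); rewrite ?normr0 ?normr1. Qed.

(** * Ergodic theorems *)
Section ergodic.
Context d (X : measurableType d) (R : realType).
Variables (mu : probability X R) (f : X -> X).
Hypothesis mf : measurable_fun setT f.

Definition ergodic_sum (g : X -> R) (n : nat) (x : X) : R :=
  \sum_(i < n) g (iter i f x).

Lemma measurable_iter n : measurable_fun setT (iter n f).
Proof. by elim: n => [|n IH] /=; [exact: measurable_id|exact: measurableT_comp]. Qed.

Lemma measurable_preimage_iter n A : measurable A -> measurable (iter n f @^-1` A).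
Proof. by move=> mA; rewrite -[X in measurable X]setTI; exact: measurable_iter. Qed.

Lemma measurable_ergodic_sum g n : measurable_fun setT g ->
  measurable_fun setT (ergodic_sum g n).
Proof.
move=> mg; apply: measurable_sum => i.
by apply: measurableT_comp => //; exact: measurable_iter.
Qed.

Lemma ergodic_sum_bound (g : X -> R) (C : R) n x : (forall x, `|g x| <= C) ->
  `|ergodic_sum g n x| <= C * n%:R.
Proof.
move=> gC; apply: le_trans (ler_norm_sum _ _ _) _.
by apply: le_trans (ler_sum _ (fun i _ => gC _)) _; rewrite sumr_const card_ord mulr_natr.
Qed.

Lemma ergodic_sumS (g : X -> R) n x :
  ergodic_sum g n.+1 x = g x + ergodic_sum g n (f x).
Proof.
rewrite /ergodic_sum big_ord_recl/=; congr (_ + _).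
by apply: eq_bigr => i _; rewrite -iterS iterSr.
Qed.

Lemma ergodic_sumD (g : X -> R) l n x :
  ergodic_sum g (l + n) x = ergodic_sum g l x + ergodic_sum g n (iter l f x).
Proof.
elim: l x => [|l IH] x; first by rewrite /ergodic_sum big_ord0 add0r.
by rewrite addSn !ergodic_sumS IH addrA iterSr.
Qed.

Section invariant.
Hypothesis inv : invariant_measure f mu.

Lemma Rintegral_invariant (g : X -> R) (C : R) : measurable_fun setT g ->
  (forall x, `|g x| <= C) -> \int[mu]_x g (f x) = \int[mu]_x g x.
Proof.
move=> mg bg; rewrite /Rintegral; congr fine.
transitivity (\int[pushforward mu f]_x (g x)%:E)%E.
  have gf : mu.-integrable (f @^-1` setT) ((EFin \o g) \o f).
    rewrite preimage_setT; apply: (@bounded_integrable _ _ _ _ (g \o f) C) => [|x /=]//.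
    exact: measurableT_comp.
  rewrite (integral_pushforward mf _ gf)//.
  exact/measurable_EFinP.
apply: eq_measure_integral => A mA _; exact: inv.
Qed.

Lemma Rintegral_iter (g : X -> R) (C : R) n : measurable_fun setT g ->
  (forall x, `|g x| <= C) -> \int[mu]_x g (iter n f x) = \int[mu]_x g x.
Proof.
move=> mg bg; elim: n => //= n IH; rewrite -IH.
under eq_Rintegral do rewrite -iterS iterSr.
apply: (@Rintegral_invariant (fun x => g (iter n f x)) C) => //.
by apply: measurableT_comp => //; exact: measurable_iter.
Qed.

Lemma Rintegral_ergodic_sum (g : X -> R) (C : R) n : measurable_fun setT g ->
  (forall x, `|g x| <= C) ->
  \int[mu]_x ergodic_sum g n x = n%:R * \int[mu]_x g x.
Proof.
move=> mg bg; elim: n => [|n IH].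
  rewrite mul0r -[RHS](@Rintegral_cst1 _ _ _ mu); apply: eq_Rintegral => x _.
  by rewrite /ergodic_sum big_ord0.
rewrite -natr1 mulrDl mul1r -IH -[in X in _ + X](Rintegral_iter n mg bg).
rewrite -RintegralD//.
- by apply: eq_Rintegral => x _; rewrite /ergodic_sum big_ord_recr.
- by apply: (bounded_integrable mu (measurable_ergodic_sum n mg)) => x; exact: ergodic_sum_bound.
- apply: (@bounded_integrable _ _ _ _ (fun x => g (iter n f x)) C) => //.
  by apply: measurableT_comp => //; exact: measurable_iter.
Qed.

Lemma preimage_iter_measure n A : measurable A -> mu (iter n f @^-1` A) = mu A.
Proof.
move=> mA; elim: n => //= n IH; rewrite -IH.
rewrite (_ : _ @^-1` A = f @^-1` (iter n f @^-1` A)); last first.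
  by apply/seteqP; split=> x /=; rewrite -iterS iterSr.
by apply: inv; exact: measurable_preimage_iter.
Qed.

End invariant.

Hypothesis erg : ergodic_measure f mu.
Let inv : invariant_measure f mu := erg.1.

(** The preimages of [B] increase to a strictly invariant set, and they all have
    the measure of [B]. *)
Lemma forward_invariant_0_1 (B : set X) : measurable B -> B `<=` f @^-1` B ->
  mu B = 0%E \/ mu B = 1%E.
Proof.
move=> mB sB.
pose U := \bigcup_n (iter n f @^-1` B).
have mU : measurable U by apply: bigcup_measurable => n _; exact: measurable_preimage_iter.
have nd : {homo (fun n => iter n f @^-1` B) : n m / (n <= m)%N >-> (n <= m)%O}.
  move=> n m nm; apply/subsetPset => x /=; rewrite -(subnK nm) iterD.
  by elim: (m - n)%N => //= k IH /IH; exact: sB.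
have UB : mu U = mu B.
  have := @nondecreasing_cvg_mu _ _ _ mu _ (fun n => measurable_preimage_iter n mB) mU nd.
  move/cvg_lim => <-//; apply: lim_near_cst => //.
  by apply: nearW => n /=; exact: preimage_iter_measure.
have fU : f @^-1` U = U.
  apply/seteqP; split=> x [n _ Hn]; first by exists n.+1 => //=; rewrite -iterS iterSr.
  by exists n => //=; rewrite -iterSr; exact: sB.
by rewrite -UB; exact: erg.2.
Qed.

Lemma backward_invariant_0_1 (B : set X) : measurable B -> f @^-1` B `<=` B ->
  mu B = 0%E \/ mu B = 1%E.
Proof.
move=> mB sB.
have [||H|H] := @forward_invariant_0_1 (~` B).
- exact: measurableC.
- by move=> x /= nBx /sB.
- have := probability_setC mu (measurableC mB).
  by rewrite setCK H sube0 => ->; right.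
- have := probability_setC mu (measurableC mB).
  by rewrite setCK H subee// => ->; left.
Qed.

(** The event that [G n <= c * n + K] infinitely often, for some [K], is forward
    or backward invariant on the nose although [G] is only monotone along orbits
    up to the bounded error [C]; so it has measure [0] or [1]. The slack [K] is
    then absorbed by passing from [c] to any larger [c']. *)
Lemma liminf_0_1 (G : nat -> X -> R) (C c : R) :
  (forall n, measurable_fun setT (G n)) ->
  (forall n x, G n (f x) <= G n.+1 x + C) \/
    (forall n x, G n.+1 x <= G n (f x) + C) ->
  (\forall x \ae mu, \forall n \near \oo, c * n%:R <= G n x) \/
  (forall c', c < c' ->
    \forall x \ae mu, exists2 l, (0 < l)%N & G l x <= c' * l%:R).
Proof.
move=> mG shift.
pose B := \bigcup_(K : nat) \bigcap_(N : nat) \bigcup_(n in [set n | (N <= n)%N])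
  [set x | G n x <= c * n%:R + K%:R].
have mB : measurable B.
  apply: bigcup_measurable => K _; apply: bigcapT_measurable => N.
  by apply: bigcup_measurable => n _; exact: measurable_le_cst.
have [K0 CK0] : exists K0 : nat, `|c| + C <= K0%:R.
  by have [N _ HN] := nbhs_infty_ger (`|c| + C); exists N; exact: (HN N (leqnn N)).
have cc : - c <= `|c| by rewrite -normrN ler_norm.
have [B0|B1] : mu B = 0%E \/ mu B = 1%E.
  case: shift => shift.
  - apply: forward_invariant_0_1 => // x [K _ HK]; exists (K + K0)%N => // N _.
    have [[|n] /= Nn Hn] := HK N.+1 I; first by rewrite ltn0 in Nn.
    exists n => //=; apply: le_trans (shift n x) _.
    have := ler_norm c; rewrite natrD; move: Hn; rewrite -natr1; lra.
  - apply: backward_invariant_0_1 => // x [K _ HK]; exists (K + K0)%N => // N _.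
    have [n /= Nn Hn] := HK N I.
    exists n.+1; first exact: leqW.
    move=> /=; apply: le_trans (shift n x) _.
    rewrite natrD; move: Hn; rewrite -natr1; lra.
- left; have := ae_not_pr0 mB B0; apply: filterS => x nBx.
  apply: contrapT => nH; apply: nBx; exists 0%N => // N _.
  apply: contrapT => nN; apply: nH; exists N => // n /= Nn.
  rewrite leNgt; apply/negP => Gn; apply: nN; exists n => //=.
  by rewrite addr0 ltW.
- right=> c' cc'; have /(ae_pr1 mu mB) := B1; apply: filterS => x [K _ HK].
  have [N _ HN] : \forall n \near \oo, K%:R <= (c' - c) * n%:R.
    by apply: near_linear_ge; rewrite subr_gt0.
  have [n /= Nn Hn] := HK N.+1 I; exists n; first exact: leq_ltn_trans Nn.
  apply: le_trans Hn _; have := HN n (ltnW Nn); lra.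
Qed.

Section blocks.
(** [Gam l] is the set of the points that open a good block of length [l], and
    [bad M] that of the points that open no good block of length at most [M]. *)
Variable Gam : nat -> set X.
Hypothesis mGam : forall l, measurable (Gam l).

Definition bad M := ~` \bigcup_(l in [set l | (0 < l <= M)%N]) Gam l.

Lemma measurable_bad M : measurable (bad M).
Proof. by apply: measurableC; apply: bigcup_measurable => l _; exact: mGam. Qed.

Lemma small_bad (e : R) : 0 < e ->
  (\forall x \ae mu, exists2 l, (0 < l)%N & Gam l x) ->
  exists M, fine (mu (bad M)) <= e.
Proof.
move=> e0 aeG.
have mb : measurable (\bigcap_M bad M) by apply: bigcapT_measurable => M; exact: measurable_bad.
have b0 : mu (\bigcap_M bad M) = 0%E.
  apply: measure_negligible => //; apply: negligibleS aeG => x /= Hx [l l0 Gl].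
  by apply: (Hx l I); exists l => //=; rewrite l0 /=.
have b00 : (mu (bad 0%N) < +oo)%E.
  exact: le_lt_trans (probability_le1 mu (measurable_bad _)) (ltry _).
have nib : nonincreasing_seq bad.
  move=> m n mn; apply/subsetPset => x /= nx [l /= /andP[l0 lm] Gl].
  by apply: nx; exists l => //=; rewrite l0 (leq_trans lm).
have : mu (bad n) @[n --> \oo] --> 0%E by rewrite -b0; exact: (@nonincreasing_cvg_mu _ _ _ mu bad b00 measurable_bad mb nib).
move=> /fine_cvgP[_ /cvgrPdist_le /(_ e e0)[M _ HM]].
exists M; have := HM M (leqnn _); rewrite /= sub0r normrN.
exact: le_trans (ler_norm _).
Qed.

Variables (F : nat -> X -> R) (c C K : R).
Hypothesis cC : c <= C.
Hypothesis F0 : forall x, F 0%N x <= K.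
Hypothesis FS : forall n x, F n.+1 x <= C + F n (f x).
Hypothesis FG : forall l n x, (0 < l)%N -> Gam l x ->
  F (l + n)%N x <= c * l%:R + F n (iter l f x).

Lemma greedy_orbit M n x :
  F n x <= c * n%:R + (C - c) * (ergodic_sum \1_(bad M) n x + M%:R) + K.
Proof.
have := @greedy_bound R n M c C K (fun i => F (n - i)%N (iter i f x))
  (fun i => iter i f x \notin bad M) cC.
rewrite subnn subn0 => /(_ (F0 _)) H.
apply: le_trans (H _ _) _.
- by move=> i i_n; rewrite -(subnSK i_n) FS.
- move=> i i_n; rewrite /bad in_setC negbK inE => -[l /= lM Gl].
  exists l => // iln; have := FG (n - (i + l))%N (proj1 (andP lM)) Gl.
  rewrite -iterD (addnC l i); have -> // : (l + (n - (i + l)) = n - i)%N by lia.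
- rewrite lerD2r lerD2l ler_wpM2l ?subr_ge0// natrD lerD2r /ergodic_sum natr_sum.
  by apply: ler_sum => i _; rewrite indicE negbK.
Qed.

Hypothesis aeG : \forall x \ae mu, exists2 l, (0 < l)%N & Gam l x.

(** In the integral of [greedy_orbit] the visits to [bad M] contribute its measure,
    by invariance alone; Birkhoff's theorem is derived from this bound. *)
Lemma block_integral_le c' : c < c' ->
  (forall n, measurable_fun setT (F n)) ->
  (forall n, exists b : R, forall x, `|F n x| <= b) ->
  \forall n \near \oo, \int[mu]_x F n x <= c' * n%:R.
Proof.
move=> cc' mF bF.
have e0 : 0 < (c' - c) / (2 * (C - c + 1)).
  by rewrite divr_gt0 ?mulr_gt0 ?subr_gt0// ltr_pwDr// subr_ge0.
have [M HM] := small_bad e0 aeG.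
have [N _ HN] : \forall n \near \oo, (C - c) * M%:R + K <= (c' - c) / 2 * n%:R.
  by apply: near_linear_ge; rewrite divr_gt0// subr_gt0.
exists N => // n /HN {}HN.
have mI : measurable_fun setT (\1_(bad M) : X -> R).
  exact/measurable_indic/measurable_bad.
have mS : measurable_fun setT (ergodic_sum \1_(bad M) n).
  exact: measurable_ergodic_sum.
have bS x : `|ergodic_sum \1_(bad M) n x| <= 1 * n%:R.
  by apply: ergodic_sum_bound; exact: indic_norm_le1.
have iS := bounded_integrable mu mS bS.
have [b Fb] := bF n.
have iS' : mu.-integrable setT (EFin \o (fun x => (C - c) * ergodic_sum \1_(bad M) n x)).
  apply: (@bounded_integrable _ _ _ _ _ ((C - c) * n%:R)).
    exact: measurable_funM.
  move=> x; rewrite normrM ger0_norm ?subr_ge0// ler_wpM2l ?subr_ge0//.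
  by rewrite -[n%:R]mul1r.
have ic (r : R) : mu.-integrable setT (EFin \o (fun=> r)).
  by apply: (@bounded_integrable _ _ _ _ _ `|r|) => //; exact: measurable_cst.
apply: (@le_trans _ _ (\int[mu]_x ((C - c) * ergodic_sum \1_(bad M) n x +
    (c * n%:R + (C - c) * M%:R + K)))).
  apply: le_Rintegral => //.
  - exact: bounded_integrable Fb.
  - exact: (integrableD measurableT iS' (ic _)).
  - by move=> x _; have := greedy_orbit M n x; rewrite mulrDr; lra.
rewrite RintegralD// Rintegral_cst1 RintegralZl//.
rewrite (Rintegral_ergodic_sum inv n mI (@indic_norm_le1 _ _ _)).
rewrite Rintegral_indic; last exact: measurable_bad.
have : (C - c) * fine (mu (bad M)) <= (c' - c) / 2.
  apply: (@le_trans _ _ ((C - c + 1) * ((c' - c) / (2 * (C - c + 1))))).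
    apply: ler_pM => //; rewrite ?subr_ge0 ?lerDl// fine_ge0//.
  have : C - c + 1 != 0 by rewrite gt_eqF// ltr_pwDr// subr_ge0.
  by move=> h; rewrite invfM (mulrA (c' - c)) mulrCA divff// mulr1.
move=> /(ler_wpM2l (ler0n _ n)).
move: HN; lra.
Qed.

End blocks.

Lemma cvg_linear_bounds (u : nat -> R) (L : R) :
  (forall k : nat, \forall n \near \oo, (L - k.+1%:R^-1) * n%:R <= u n) ->
  (forall k : nat, \forall n \near \oo, u n <= (L + k.+1%:R^-1) * n%:R) ->
  (fun n => n%:R^-1 * u n) @ \oo --> L.
Proof.
move=> lo hi; apply/cvgrPdist_le => e e0.
have [k ke] : exists k : nat, k.+1%:R^-1 <= e.
  have [k _ Hk] := nbhs_infty_ger (e^-1); exists k.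
  rewrite invf_ple ?posrE//; apply: le_trans (Hk k (leqnn _)) _.
  by rewrite ler_nat.
near=> n.
have n0 : 0 < n%:R :> R by rewrite ltr0n; near: n; exact: nbhs_infty_gt.
have lo' : (L - k.+1%:R^-1) * n%:R <= u n by near: n; exact: lo.
have hi' : u n <= (L + k.+1%:R^-1) * n%:R by near: n; exact: hi.
rewrite distrC ler_norml; apply/andP; split.
  rewrite lerBrDl mulrC ler_pdivlMr//; apply: le_trans lo'.
  by rewrite ler_wpM2r ?lerD2l ?lerN2// ltW.
rewrite lerBlDl mulrC ler_pdivrMr//; apply: le_trans hi' _.
by rewrite ler_wpM2r ?lerD2l// ltW.
Unshelve. all: by end_near. Qed.

Lemma ae_cvg_linear_bounds (G : nat -> X -> R) (L : R) :
  (forall c, c < L -> \forall x \ae mu, \forall n \near \oo, c * n%:R <= G n x) ->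
  (forall c, L < c -> \forall x \ae mu, \forall n \near \oo, G n x <= c * n%:R) ->
  \forall x \ae mu, (fun n => n%:R^-1 * G n x) @ \oo --> L.
Proof.
move=> lo hi.
have k0 (k : nat) : 0 < k.+1%:R^-1 :> R by rewrite invr_gt0.
have lo' : \forall x \ae mu, forall k : nat,
    \forall n \near \oo, (L - k.+1%:R^-1) * n%:R <= G n x.
  by apply: ae_foralln => k; apply: lo; rewrite ltrBlDr ltrDl.
have hi' : \forall x \ae mu, forall k : nat,
    \forall n \near \oo, G n x <= (L + k.+1%:R^-1) * n%:R.
  by apply: ae_foralln => k; apply: hi; rewrite ltrDl.
by apply: filterS2 lo' hi' => x; exact: cvg_linear_bounds.
Qed.

(** Otherwise [liminf_0_1] would cover the orbits by blocks on which the average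
    of [g] is less than its integral, contradicting [block_integral_le]. *)
Lemma birkhoff_lower (g : X -> R) (C c : R) : measurable_fun setT g ->
  (forall x, `|g x| <= C) -> c < \int[mu]_x g x ->
  \forall x \ae mu, \forall n \near \oo, c * n%:R <= ergodic_sum g n x.
Proof.
move=> mg bg cI.
have gC x : g x <= C by exact: le_trans (ler_norm _) (bg x).
have Cg x : - g x <= C by rewrite (le_trans (ler_norm _))// normrN.
have := @liminf_0_1 (ergodic_sum g) C c (fun n => measurable_ergodic_sum n mg).
case=> [| //|].
  by left=> n x; rewrite ergodic_sumS; have := Cg x; lra.
set I := Rintegral _ _ _ in cI *.
move=> /(_ (c + (I - c) / 3)) /(_ ltac:(lra)) H; exfalso.
have [] := @block_integral_le (fun l => [set x | ergodic_sum g l x <= (c + (I - c) / 3) * l%:R])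
  _ (ergodic_sum g) (c + (I - c) / 3) (Num.max C (c + (I - c) / 3)) 0 _ _ _ _ H (c + (I - c) / 3 * 2).
- by move=> l; apply: measurable_le_cst; exact: measurable_ergodic_sum.
- by rewrite le_max lexx orbT.
- by move=> x; rewrite /ergodic_sum big_ord0.
- by move=> n x; rewrite ergodic_sumS lerD2r le_max gC.
- by move=> l n x l0 /= Hl; rewrite ergodic_sumD lerD2r.
- lra.
- by move=> n; exact: measurable_ergodic_sum.
- by move=> n; exists (C * n%:R) => x; exact: ergodic_sum_bound.
move=> N _ /(_ N.+1 (leqnSn _)) /=.
rewrite (Rintegral_ergodic_sum inv _ mg bg) -/I mulrC ler_pM2r// => HI.
lra.
Qed.

Lemma birkhoff (g : X -> R) (C : R) : measurable_fun setT g ->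
  (forall x, `|g x| <= C) ->
  \forall x \ae mu, (fun n => n%:R^-1 * ergodic_sum g n x) @ \oo --> \int[mu]_x g x.
Proof.
move=> mg bg; apply: ae_cvg_linear_bounds => c cI.
  exact: birkhoff_lower bg cI.
have mg' : measurable_fun setT (\- g) by exact: measurable_funN.
have bg' x : `|(\- g) x| <= C by rewrite /= normrN.
have : - c < \int[mu]_x (\- g) x.
  under eq_Rintegral do rewrite /= -mulN1r.
  rewrite RintegralZl// ?mulN1r ?ltrN2//; exact: bounded_integrable bg.
move=> /(birkhoff_lower mg' bg'); apply: filterS => x; apply: filterS => n.
by rewrite /ergodic_sum sumrN mulNr lerN2.
Qed.

(** The pointwise counterpart of [block_integral_le]: Birkhoff's theorem controls
    how often an orbit visits [bad M]. *)
Lemma block_ae_le (Gam : nat -> set X) (F : nat -> X -> R) (c C K c' : R) :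
  (forall l, measurable (Gam l)) -> c <= C ->
  (forall x, F 0%N x <= K) -> (forall n x, F n.+1 x <= C + F n (f x)) ->
  (forall l n x, (0 < l)%N -> Gam l x ->
     F (l + n)%N x <= c * l%:R + F n (iter l f x)) ->
  (\forall x \ae mu, exists2 l, (0 < l)%N & Gam l x) -> c < c' ->
  \forall x \ae mu, \forall n \near \oo, F n x <= c' * n%:R.
Proof.
move=> mGam cC F0 FS FG aeG cc'.
have D0 : 0 < C - c + 1 by rewrite ltr_pwDr// subr_ge0.
pose e := (c' - c) / (4 * (C - c + 1)).
have e0 : 0 < e by rewrite divr_gt0 ?mulr_gt0 ?subr_gt0.
have De : (C - c) * (2 * e) <= (c' - c) / 2.
  apply: (@le_trans _ _ ((C - c + 1) * (2 * e))).
    by rewrite ler_wpM2r ?lerDl// mulr_ge0// ltW.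
  rewrite le_eqVlt; apply/orP; left; apply/eqP; rewrite /e.
  by field; rewrite gt_eqF.
have [M HM] := small_bad mGam e0 aeG.
have mI : measurable_fun setT (\1_(bad Gam M) : X -> R).
  exact/measurable_indic/measurable_bad.
have := birkhoff mI (@indic_norm_le1 _ _ _).
rewrite Rintegral_indic; last exact: measurable_bad.
apply: filterS => x /cvgrPdist_le/(_ e e0)[N1 _ H1].
have [N _ HN] : \forall n \near \oo, (C - c) * M%:R + K <= (c' - c) / 2 * n%:R.
  by apply: near_linear_ge; rewrite divr_gt0// subr_gt0.
exists (maxn N1 N).+1 => // n /=; rewrite gtn_max => /andP[/ltnW /H1 {}H1 Nn].
have {}HN := HN n (ltnW Nn).
have n0 : 0 < n%:R :> R by rewrite ltr0n (leq_trans _ Nn).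
have Sn : ergodic_sum \1_(bad Gam M) n x <= 2 * e * n%:R.
  have : n%:R^-1 * ergodic_sum \1_(bad Gam M) n x <= 2 * e.
    move: H1; rewrite ler_norml => /andP[+ _]; move: HM; lra.
  by rewrite mulrC ler_pdivrMr.
have := greedy_orbit cC F0 FS FG M n x.
have cC' : 0 <= C - c by rewrite subr_ge0.
move: (ler_wpM2l cC' Sn).
move: (ler_wpM2r (ltW n0) De); lra.
Qed.

(** The lower bound holds uniformly off a set of small measure, and there the
    linear bound [- C * n] limits the damage. *)
Lemma ae_integral_ge (G : nat -> X -> R) (C c c' : R) :
  (forall n, measurable_fun setT (G n)) ->
  (forall n, exists b : R, forall x, `|G n x| <= b) ->
  (forall n x, - C * n%:R <= G n x) ->
  (\forall x \ae mu, \forall n \near \oo, c * n%:R <= G n x) -> c' < c ->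
  \forall n \near \oo, c' * n%:R <= \int[mu]_x G n x.
Proof.
move=> mG bG loG aeG cc.
pose A N := \bigcap_(n in [set n | (N <= n)%N]) [set x | c * n%:R <= G n x].
have mA N : measurable (A N).
  apply: bigcap_measurableType => n _; rewrite -[X in measurable X]setTI.
  by apply: measurable_fun_le => //; exact: measurable_cst.
have C0 : 0 <= `|c| + `|C| by rewrite addr_ge0.
have e0 : 0 < (c - c') / (`|c| + `|C| + 1) by rewrite divr_gt0 ?subr_gt0// ltr_pwDr.
have aeA : \forall x \ae mu, exists2 l, (0 < l)%N & A l x.
  apply: filterS aeG => x [N _ HN]; exists N.+1 => // n /= Nn.
  by apply: HN; exact: ltnW.
have [M HM] := small_bad mA e0 aeA.
exists M => // n /= Mn.
have mI : measurable_fun setT (\1_(bad A M) : X -> R).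
  exact/measurable_indic/measurable_bad.
have n0 : 0 <= n%:R :> R by [].
pose H x := c * n%:R + - ((`|c| + `|C|) * n%:R) * (\1_(bad A M) x : R).
have iI := bounded_integrable mu mI (@indic_norm_le1 _ _ _).
have iI' : mu.-integrable setT (EFin \o (fun x => - ((`|c| + `|C|) * n%:R) * (\1_(bad A M) x : R))).
  apply: (@bounded_integrable _ _ _ _ _ ((`|c| + `|C|) * n%:R * 1)).
    exact: measurable_funM.
  by move=> x; rewrite normrM normrN (ger0_norm (mulr_ge0 C0 n0)) ler_wpM2l ?mulr_ge0// indic_norm_le1.
have ic (r : R) : mu.-integrable setT (EFin \o (fun=> r)).
  by apply: (@bounded_integrable _ _ _ _ _ `|r|) => //; exact: measurable_cst.
apply: (@le_trans _ _ (\int[mu]_x H x)); last first.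
  have [b Gb] := bG n; apply: le_Rintegral => //.
  - exact: (integrableD measurableT (ic _) iI').
  - exact: bounded_integrable Gb.
  - move=> x _; rewrite /H indicE; case: (boolP (x \in bad A M)) => [_|].
      rewrite mulr1; apply: le_trans (loG n x); rewrite -mulNr -mulrDl ler_wpM2r//.
      have := ler_norm c; have := ler_norm C; lra.
    rewrite mulr0 addr0 /bad in_setC negbK inE => -[l /= /andP[_ lM] Hl].
    by apply: Hl => /=; exact: leq_trans Mn.
rewrite /H RintegralD// Rintegral_cst1 RintegralZl// Rintegral_indic; last exact: measurable_bad.
have : (`|c| + `|C|) * fine (mu (bad A M)) <= c - c'.
  apply: (@le_trans _ _ ((`|c| + `|C| + 1) * ((c - c') / (`|c| + `|C| + 1)))).
    by apply: ler_pM => //; rewrite ?lerDl// fine_ge0.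
  by rewrite mulrC divfK// gt_eqF// ltr_pwDr.
move=> /(ler_wpM2r n0); lra.
Qed.

(** The limit is the supremum of the [c] such that [G n >= c * n] eventually
    holds almost everywhere. For larger [c] the zero-one law provides blocks with
    [G l <= c * l], and the last hypothesis turns these into upper bounds; this is
    the only place where the nature of [G] matters. *)
Lemma ergodic_limit (G : nat -> X -> R) (C c0 : R) :
  (forall n, measurable_fun setT (G n)) ->
  (forall n, exists b : R, forall x, `|G n x| <= b) ->
  (forall n x, - C * n%:R <= G n x) -> (forall x, G 1%N x <= c0) ->
  (forall n x, G n (f x) <= G n.+1 x + C) \/
    (forall n x, G n.+1 x <= G n (f x) + C) ->
  (forall c c', c < c' ->
     (\forall x \ae mu, exists2 l, (0 < l)%N & G l x <= c * l%:R) ->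
     (\forall x \ae mu, \forall n \near \oo, G n x <= c' * n%:R) /\
     (\forall n \near \oo, \int[mu]_x G n x <= c' * n%:R)) ->
  exists L : R,
    (\forall x \ae mu, (fun n => n%:R^-1 * G n x) @ \oo --> L) /\
    (fun n => n%:R^-1 * \int[mu]_x G n x) @ \oo --> L.
Proof.
move=> mG bG loG G1 shift up.
pose E := [set c : R | \forall x \ae mu, \forall n \near \oo, c * n%:R <= G n x].
have EC : E (- C) by apply: aeW => x; apply: nearW => n; exact: loG.
have ubE : ubound E (c0 + 1).
  move=> c Ec.
  have Hx : \forall x \ae mu, \forall n \near \oo, G n x <= (c0 + 1) * n%:R.
    apply: (up c0 (c0 + 1) _ _).1; first by rewrite ltrDl.
    by apply: aeW => x; exists 1%N => //; rewrite mulr1.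
  have [x [[N1 _ H1] [N2 _ H2]]] := ae_ex (filterI Ec Hx).
  have := le_trans (H1 (maxn N1 N2).+1 (leqW (leq_maxl _ _)))
                   (H2 (maxn N1 N2).+1 (leqW (leq_maxr _ _))).
  by rewrite ler_pM2r.
have supE : has_sup E by split; [exists (- C)|exists (c0 + 1)].
have loL c : c < sup E -> E c.
  rewrite -subr_gt0 => cL; have [c1 Ec1 cc1] := sup_adherent cL supE.
  apply: filterS Ec1 => x; apply: filterS => n; apply: le_trans.
  by rewrite ler_wpM2r//; move: cc1; lra.
have hiL c : sup E < c ->
     (\forall x \ae mu, \forall n \near \oo, G n x <= c * n%:R) /\
     (\forall n \near \oo, \int[mu]_x G n x <= c * n%:R).
  move=> Lc; set L := sup E in Lc *.
  apply: (up (L + (c - L) / 3 * 2)); first by lra.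
  have [EL|] := @liminf_0_1 G C (L + (c - L) / 3) mG shift; last by apply; lra.
  by have := ub_le_sup supE.2 EL; rewrite -/L; lra.
exists (sup E); split.
  by apply: ae_cvg_linear_bounds => c; [exact: loL|move=> /hiL[]].
have k0 (k : nat) : 0 < k.+1%:R^-1 :> R by rewrite invr_gt0.
apply: cvg_linear_bounds => k.
  apply: (@ae_integral_ge _ C (sup E - k.+1%:R^-1 / 2)) => //.
    by apply: loL; move: (k0 k); set e := _^-1; lra.
  by move: (k0 k); set e := k.+1%:R^-1; lra.
by have [] := hiL (sup E + k.+1%:R^-1) _; rewrite ?ltrDl.
Qed.

(** Subadditivity is what lets the blocks provided by [ergodic_limit] be put end
    to end. *)
Theorem kingman (F : nat -> X -> R) (C : R) :
  (forall n, measurable_fun setT (F n)) ->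
  (forall n x, - C * n%:R <= F n x <= C * n%:R + C) ->
  (forall l n x, F (l + n)%N x <= F l x + F n (iter l f x)) ->
  exists L : R,
    (\forall x \ae mu, (fun n => n%:R^-1 * F n x) @ \oo --> L) /\
    (fun n => n%:R^-1 * \int[mu]_x F n x) @ \oo --> L.
Proof.
move=> mF bF sF.
have hi n x : F n x <= C * n%:R + C by case/andP: (bF n x).
have lo n x : - C * n%:R <= F n x by case/andP: (bF n x).
have F1 x : F 1%N x <= C * 2 by have := hi 1%N x; lra.
have FS n x : F n.+1 x <= C * 2 + F n (f x).
  by apply: le_trans (sF 1%N n x) _; rewrite lerD2r F1.
have C0 : 0 <= C.
  have [x _] : exists x : X, True by apply: (@ae_ex _ _ _ mu); exact: aeW.
  by have := lo 0%N x; have := hi 0%N x; lra.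
have bb n : exists b : R, forall x, `|F n x| <= b.
  exists (C * n%:R + C) => x; rewrite ler_norml hi andbT.
  apply: le_trans (lo n x); move: C0; lra.
have lo2 n x : - (C * 2) * n%:R <= F n x.
  apply: le_trans (lo n x); rewrite ler_wpM2r//; move: C0; lra.
apply: (@ergodic_limit F (C * 2) (C * 2)) => //.
  by right=> n x; rewrite addrC.
move=> c c' cc' H.
have cC : c <= Num.max (C * 2) c by rewrite le_max lexx orbT.
have FS' n x : F n.+1 x <= Num.max (C * 2) c + F n (f x).
  by apply: le_trans (FS n x) _; rewrite lerD2r le_max lexx.
have FG l n x : (0 < l)%N -> F l x <= c * l%:R ->
    F (l + n)%N x <= c * l%:R + F n (iter l f x).
  by move=> l0 Hl; apply: le_trans (sF l n x) _; rewrite lerD2r.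
have F0 x : F 0%N x <= C by have := hi 0%N x; rewrite mulr0 add0r.
have mG l : measurable [set x | F l x <= c * l%:R] by exact: measurable_le_cst.
split.
  exact: (block_ae_le mG cC F0 FS' FG H cc').
exact: (block_integral_le mG cC F0 FS' FG H cc' mF bb).
Qed.

End ergodic.

(** * Words and cylinders *)
Lemma cvg_cylinder (m : nat) (x : seq_space m) (U : set (seq_space m)) :
  open U -> U x -> exists n, cylinder (x : Shift m) n `<=` U.
Proof.
move=> oU Ux.
pose F : set_system (seq_space m) := [set A | exists n, cylinder (x : Shift m) n `<=` A].
have FF : Filter F.
  split.
  - by exists 0%N.
  - move=> A B [n nA] [k kB]; exists (maxn n k) => y yx; split.
      by apply: nA => i i_n; apply: yx; rewrite (leq_trans i_n)// leq_maxl.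
    by apply: kB => i i_n; apply: yx; rewrite (leq_trans i_n)// leq_maxr.
  - by move=> A B AB [n nA]; exists n; exact: subset_trans AB.
suff : F --> x by apply; exact: open_nbhs_nbhs.
apply/cvg_sup => i A [V] [[B] oB <-] /= Bx BA.
exists i.+1 => y yx; apply: BA => /=.
by rewrite (yx i (ltnSn i)).
Qed.

Lemma open_cylinder (m : nat) (x : seq_space m) n :
  open (cylinder (x : Shift m) n : set (seq_space m)).
Proof.
elim: n => [|n IH].
  rewrite (_ : cylinder _ _ = setT); first exact: openT.
  by apply/seteqP; split.
rewrite (_ : cylinder _ _ = (cylinder (x : Shift m) n : set (seq_space m)) `&`
  (@proj _ (fun _ => discrete_topology 'I_m.+1) n) @^-1` [set x n]).
  apply: openI => //.
  apply: open_comp => [y _|]; first exact: proj_continuous.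
  exact: discrete_open.
apply/seteqP; split=> [y yx|y [yx yn] i].
  by split=> [i i_n|]; apply: yx => //; exact: leqW.
by rewrite ltnS leq_eqVlt => /predU1P[->|] //; exact: yx.
Qed.

Section shift.
Variable m : nat.
Implicit Types (x y : Shift m) (w : seq 'I_m.+1).

Definition word (n : nat) (x : Shift m) : seq 'I_m.+1 := mkseq x n.

Definition word_cyl (w : seq 'I_m.+1) : set (Shift m) :=
  [set y | word (size w) y = w].

Lemma size_word n x : size (word n x) = n. Proof. exact: size_mkseq. Qed.

Lemma word_eqP n x y : word n y = word n x <-> forall i, (i < n)%N -> y i = x i.
Proof.
split=> [H i i_n|H]; last first.
  by apply/eq_in_map => i; rewrite mem_iota add0n => /H.
by rewrite -(nth_mkseq ord0 y i_n) -/(word n y) H nth_mkseq.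
Qed.

Lemma cylinderE x n : cylinder x n = [set y | word n y = word n x].
Proof. by apply/seteqP; split=> y /word_eqP. Qed.

Lemma word_cyl_cylinder w : word_cyl w = cylinder (nth ord0 w : Shift m) (size w).
Proof. by rewrite cylinderE {2}/word mkseq_nth. Qed.

Lemma cylinder_word_cyl x n : cylinder x n = word_cyl (word n x).
Proof. by rewrite cylinderE /word_cyl size_word. Qed.

Lemma measurable_cylinder x n : measurable (cylinder x n).
Proof. by apply: sub_sigma_algebra; exact: open_cylinder. Qed.

Lemma measurable_word_cyl w : measurable (word_cyl w).
Proof. by rewrite word_cyl_cylinder; exact: measurable_cylinder. Qed.

Lemma measurable_word n (P : seq 'I_m.+1 -> Prop) : measurable [set x | P (word n x)].
Proof.
rewrite (_ : [set x | _] = \bigcup_(w in [set w : n.-tuple 'I_m.+1 | P w]) word_cyl w).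
  by apply: fin_bigcup_measurable => // w _; exact: measurable_word_cyl.
apply/seteqP; split=> x /=.
  move=> Px; have sw : size (word n x) == n by rewrite size_word.
  by exists (Tuple sw) => //=; rewrite /word_cyl /= size_word.
by move=> [w Pw]; rewrite /word_cyl /= size_tuple => ->.
Qed.

Lemma measurable_cylinder1 (i : 'I_m.+1) : measurable (cylinder1 i).
Proof. exact: (measurable_word 1 (fun w => nth ord0 w 0 = i)). Qed.
Lemma measurable_word_fun d (Y : measurableType d) n (phi : seq 'I_m.+1 -> Y) :
  measurable_fun setT (fun x => phi (word n x)).
Proof. by move=> _ B mB; rewrite setTI; exact: measurable_word (fun w => B (phi w)). Qed.

Lemma word_bound (R : realType) n (phi : seq 'I_m.+1 -> R) :
  exists b : R, forall x, `|phi (word n x)| <= b.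
Proof.
exists (\sum_(w : n.-tuple 'I_m.+1) `|phi w|) => x.
have sw : size (word n x) == n by rewrite size_word.
by rewrite (bigD1 (Tuple sw)) //= lerDl sumr_ge0.
Qed.

Lemma iter_left_shift k x j : iter k (@left_shift m) x j = x (k + j)%N.
Proof. by elim: k j => [|k IH] j //=; rewrite /left_shift /= IH addnS addSn. Qed.
Lemma wordD l n x : word (l + n) x = word l x ++ word n (iter l (@left_shift m) x).
Proof.
apply: (@eq_from_nth _ ord0); first by rewrite size_cat !size_word.
move=> i; rewrite size_word => i_ln; rewrite nth_mkseq// nth_cat size_word.
by case: ltnP => il; rewrite nth_mkseq ?iter_left_shift ?subnKC// ltn_subLR.
Qed.

Lemma wordS n x : word n.+1 x = x 0%N :: word n (left_shift x).
Proof. exact: (wordD 1 n x). Qed.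

(** There are countably many words, and an open set is the union of the cylinders
    that it contains; so the cylinders generate the Borel sets. *)
Lemma measurable_shift_ind (P : set (Shift m) -> Prop) :
  (forall x n, P (cylinder x n)) -> (forall A, P A -> P (~` A)) ->
  (forall F : nat -> set (Shift m), (forall n, P (F n)) -> P (\bigcup_n F n)) ->
  forall A, measurable A -> P A.
Proof.
move=> Pcyl PC Pcup.
have P0 : P set0.
  rewrite -setCT; apply: PC; rewrite (_ : setT = cylinder (fun=> ord0 : 'I_m.+1) 0)//.
  by apply/seteqP; split.
apply: smallest_sub.
  split=> //; first by move=> A PA; rewrite setTD; exact: PC.
move=> U oU.
pose cyl k := if unpickle k is Some w then
  (if `[< word_cyl w `<=` U >] then word_cyl w else set0) else set0.
rewrite (_ : U = \bigcup_k cyl k).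
  apply: Pcup => k; rewrite /cyl; case: unpickle => [w|] //.
  by case: asboolP => // _; rewrite word_cyl_cylinder.
apply/seteqP; split=> x.
  move=> Ux; have [n nU] := cvg_cylinder oU Ux.
  exists (pickle (word n x)) => //; rewrite /cyl pickleK.
  case: asboolP => [_|]; first by rewrite /word_cyl /= size_word.
  by case; rewrite -cylinder_word_cyl.
move=> [k _]; rewrite /cyl; case: unpickle => [w|] //.
by case: asboolP => // wU; exact: wU.
Qed.

Lemma measurable_left_shift : measurable_fun setT (@left_shift m).
Proof.
suff H A : measurable A -> measurable (@left_shift m @^-1` A).
  by move=> _ A mA; rewrite setTI; exact: H.
move: A; apply: measurable_shift_ind.
- move=> x n.
  rewrite (_ : _ @^-1` _ = [set y | behead (word n.+1 y) = word n x]).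
    exact: measurable_word (fun w => behead w = word n x).
  by rewrite cylinderE; apply: eq_set => y; rewrite wordS.
- by move=> A; rewrite preimage_setC; exact: measurableC.
- by move=> F mF; rewrite preimage_bigcup; apply: bigcupT_measurable.
Qed.

End shift.

(** * Finite labellings *)
Section labels.
Context d (X : measurableType d) (R : realType) (mu : probability X R).

Lemma pr_le (A B : set X) : measurable A -> measurable B -> A `<=` B ->
  fine (mu A) <= fine (mu B).
Proof.
move=> mA mB AB; apply: fine_le; rewrite ?fin_num_measure//.
by apply: le_measure; rewrite ?inE.
Qed.

Lemma pr_setU_le (A B : set X) : measurable A -> measurable B ->
  fine (mu (A `|` B)) <= fine (mu A) + fine (mu B).
Proof.
move=> mA mB; rewrite -fineD ?fin_num_measure//; apply: fine_le.
- by rewrite fin_num_measure//; exact: measurableU.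
- by rewrite fin_numD !fin_num_measure.
- exact: measureU2.
Qed.

Lemma pr_bigsetU_le (I : Type) (s : seq I) (D : I -> set X) :
  (forall i, measurable (D i)) ->
  fine (mu (\big[setU/set0]_(i <- s) D i)) <= \sum_(i <- s) fine (mu (D i)).
Proof.
move=> mD; elim: s => [|i s IH]; first by rewrite !big_nil measure0.
rewrite !big_cons; apply: le_trans (pr_setU_le _ _) _ => //; last by rewrite lerD2l.
exact: bigsetU_measurable.
Qed.

Lemma Rintegral_sum (I : Type) (s : seq I) (h : I -> X -> R) :
  (forall i, mu.-integrable setT (EFin \o h i)) ->
  \int[mu]_x (\sum_(i <- s) h i x) = \sum_(i <- s) \int[mu]_x h i x.
Proof.
move=> ih; have isum t : mu.-integrable setT (EFin \o (fun x => \sum_(i <- t) h i x)).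
  elim: t => [|i t IH].
    apply: (@bounded_integrable _ _ _ _ _ 0) => [|x].
      by under eq_fun do rewrite big_nil; exact: measurable_cst.
    by rewrite big_nil normr0.
  have -> : (fun x => \sum_(j <- i :: t) h j x) = (fun x => h i x + \sum_(j <- t) h j x).
    by apply/funext => x; rewrite big_cons.
  exact: (integrableD measurableT (ih i) IH).
elim: s => [|i s IH].
  rewrite big_nil -[RHS](@Rintegral_cst1 _ _ _ mu); apply: eq_Rintegral => x _.
  by rewrite big_nil.
rewrite big_cons -IH -RintegralD//; apply: eq_Rintegral => x _.
by rewrite big_cons.
Qed.

Variables (T : finType) (xi : X -> T).
Hypothesis mxi : forall t, measurable (xi @^-1` [set t]).

Lemma integral_label (phi : T -> R) :
  \int[mu]_x phi (xi x) = \sum_t phi t * fine (mu (xi @^-1` [set t])).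
Proof.
have mI t : measurable_fun setT (\1_(xi @^-1` [set t]) : X -> R) by exact: measurable_indic.
have iI t := bounded_integrable mu (mI t) (@indic_norm_le1 _ _ _).
transitivity (\int[mu]_x (\sum_t phi t * \1_(xi @^-1` [set t]) x)).
  apply: eq_Rintegral => x _; rewrite (bigD1 (xi x)) //= indicE mem_set//= mulr1.
  rewrite big1 ?addr0// => t tx; rewrite indicE memNset ?mulr0//= => tx'.
  by rewrite tx' eqxx in tx.
rewrite Rintegral_sum => [|t].
  by apply: eq_bigr => t _; rewrite RintegralZl// Rintegral_indic.
apply: (@bounded_integrable _ _ _ _ _ `|phi t|).
  exact: measurable_funM.
by move=> x; rewrite normrM ler_piMr// indic_norm_le1.
Qed.

Lemma pr_label (A : set X) : measurable A ->
  fine (mu A) = \sum_t fine (mu (A `&` xi @^-1` [set t])).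
Proof.
move=> mA; rewrite -(Rintegral_indic mu mA).
have mI t : measurable_fun setT (\1_(A `&` xi @^-1` [set t]) : X -> R).
  by apply: measurable_indic; exact: measurableI.
have iI t := bounded_integrable mu (mI t) (@indic_norm_le1 _ _ _).
transitivity (\int[mu]_x (\sum_t (\1_(A `&` xi @^-1` [set t]) x : R))).
  apply: eq_Rintegral => x _; rewrite (bigD1 (xi x)) //= !indicE in_setI.
  rewrite [X in _ && X]mem_set// andbT big1 ?addr0// => t tx.
  rewrite indicE in_setI [X in _ && X]memNset ?andbF//= => tx'.
  by rewrite tx' eqxx in tx.
rewrite Rintegral_sum//.
by apply: eq_bigr => t _; rewrite Rintegral_indic//; exact: measurableI.
Qed.

End labels.

(** * Approximation of partitions by words *)
Section approximation.
Variables (m : nat) (R : realType) (mu : probability (Shift m) R).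

Local Notation symdiff A B := ((A `\` B) `|` (B `\` A)).

Lemma measurable_symdiff (A B : set (Shift m)) :
  measurable A -> measurable B -> measurable (symdiff A B).
Proof. by move=> mA mB; apply: measurableU; exact: measurableD. Qed.

Lemma take_word k n (x : Shift m) : (k <= n)%N -> take k (word n x) = word k x.
Proof. by move=> kn; rewrite /word -map_take take_iota (minn_idPl kn). Qed.

Definition approximable (A : set (Shift m)) := forall e : R, 0 < e ->
  exists n (P : seq 'I_m.+1 -> Prop),
    fine (mu (symdiff A [set x | P (word n x)])) <= e.

Lemma approximable_setU A B : measurable A -> measurable B ->
  approximable A -> approximable B -> approximable (A `|` B).
Proof.
move=> mA mB aA aB e e0; have e20 : 0 < e / 2 by rewrite divr_gt0.
have [n [P HP]] := aA _ e20; have [k [Q HQ]] := aB _ e20.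
exists (maxn n k), (fun w => P (take n w) \/ Q (take k w)).
have mP := measurable_symdiff mA (measurable_word n P).
have mQ := measurable_symdiff mB (measurable_word k Q).
rewrite [e]splitr; apply: le_trans (lerD HP HQ); apply: le_trans (pr_setU_le mu mP mQ).
apply: pr_le.
- apply: measurable_symdiff; first exact: measurableU.
  exact: (measurable_word _ (fun w => P (take n w) \/ Q (take k w))).
- exact: measurableU.
move=> x /=; rewrite !take_word ?leq_maxl ?leq_maxr//; tauto.
Qed.

Lemma approximable_measurable A : measurable A -> approximable A.
Proof.
move=> mA; suff [] : measurable A /\ approximable A by [].
move: A mA; apply: measurable_shift_ind.
- move=> x n; split; first exact: measurable_cylinder.
  move=> e e0; exists n, (fun w => w = word n x).
  by rewrite -cylinderE !setDv setU0 measure0/= ltW.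
- move=> A [mA aA]; split; first exact: measurableC.
  move=> e /aA[n [P HP]]; exists n, (fun w => ~ P w).
  rewrite (_ : symdiff _ _ = symdiff A [set x | P (word n x)])//.
  by apply/seteqP; split=> x /=; have := EM (P (word n x)); have := EM (A x); tauto.
- move=> F HF; have mF n : measurable (F n) by have [] := HF n.
  have mU : measurable (\bigcup_n F n) by exact: bigcupT_measurable.
  split=> // e e0; have e20 : 0 < e / 2 by rewrite divr_gt0.
  pose U n := \big[setU/set0]_(i < n.+1) F i.
  have mUn n : measurable (U n) by exact: bigsetU_measurable.
  have aU n : approximable (U n).
    rewrite /U; elim: n.+1 => [|{}n IH].
      rewrite big_ord0 => e' e'0; exists 0%N, (fun=> False).
      rewrite (_ : symdiff _ _ = set0) ?measure0/= ?ltW//.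
      by apply/seteqP; split=> x /=; tauto.
    rewrite big_ord_recr /=; apply: approximable_setU => //; first exact: bigsetU_measurable.
    by have [] := HF n.
  have ndU : {homo U : n k / (n <= k)%N >-> (n <= k)%O}.
    by move=> n k nk; apply/subsetPset; exact: subset_bigsetU.
  have UE : \bigcup_n U n = \bigcup_n F n by rewrite bigcup_bigsetU_bigcup.
  have mUU : measurable (\bigcup_n U n) by rewrite UE.
  have : mu (U n) @[n --> \oo] --> (fine (mu (\bigcup_n F n)))%:E.
    rewrite fineK ?fin_num_measure// -UE.
    exact: (@nondecreasing_cvg_mu _ _ _ mu U mUn mUU ndU).
  move=> /fine_cvgP[_ /cvgrPdist_le /(_ _ e20)[N _ /(_ N (leqnn N)) HN]].
  have UF : U N `<=` \bigcup_n F n by rewrite -UE => x Ux; exists N.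
  have HD : fine (mu ((\bigcup_n F n) `\` U N)) <= e / 2.
    rewrite measureD//; last by rewrite ltey_eq fin_num_measure.
    rewrite (setIidr UF) fineB ?fin_num_measure//.
    exact: le_trans (ler_norm _) HN.
  have [n [P HP]] := aU N _ e20; exists n, P.
  have mP := measurable_symdiff (mUn N) (measurable_word n P).
  have mD := measurableD mU (mUn N).
  rewrite [e]splitr; apply: le_trans (lerD HD HP); apply: le_trans (pr_setU_le mu mD mP).
  apply: pr_le.
  + by apply: measurable_symdiff => //; exact: measurable_word.
  + exact: measurableU.
  move=> x; have := EM (U N x); have := UF x; rewrite /=; tauto.
Qed.

Lemma measurable_disagreement k (eta : Shift m -> 'I_k) (zeta : seq 'I_m.+1 -> 'I_k) N :
  finite_partition eta -> measurable [set x | eta x <> zeta (word N x)].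
Proof.
move=> meta.
rewrite (_ : [set x | _] = \bigcup_(j in [set: 'I_k])
    (eta @^-1` [set j] `&` [set x | j <> zeta (word N x)])).
  apply: fin_bigcup_measurable => // j _; apply: measurableI; first exact: meta.
  exact: (measurable_word N (fun w => j <> zeta w)).
apply/seteqP; split=> x /=; first by move=> H; exists (eta x).
by move=> [j _ [/= ->]].
Qed.
(** Each piece of the partition is approximable by a set that depends on finitely
    many letters; [zeta] picks a piece whose approximation contains the word. *)
Lemma partition_approx k (eta : Shift m -> 'I_k) (e : R) :
  finite_partition eta -> 0 < e ->
  exists N (zeta : seq 'I_m.+1 -> 'I_k),
    fine (mu [set x | eta x <> zeta (word N x)]) <= e.
Proof.
move=> meta e0.
have k0 : (0 < k)%N by case: k eta meta => // eta; case: (eta (fun=> ord0)).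
have ek : 0 < e / k%:R by rewrite divr_gt0// ltr0n.
have /choice[n] (j : 'I_k) : exists n, exists P : seq 'I_m.+1 -> Prop,
    fine (mu (symdiff (eta @^-1` [set j]) [set x | P (word n x)])) <= e / k%:R.
  by apply: (approximable_measurable _ ek); exact: meta.
move=> /choice[P HP].
pose N := \max_(j : 'I_k) n j.
have nN j : (n j <= N)%N by exact: leq_bigmax.
pose zeta (w : seq 'I_m.+1) : 'I_k :=
  odflt (Ordinal k0) [pick j | `[< P j (take (n j) w) >]].
exists N, zeta.
pose D j := symdiff (eta @^-1` [set j]) [set x | P j (word (n j) x)].
have mD j : measurable (D j).
  by apply: measurable_symdiff; [exact: meta|exact: measurable_word].
have mE := measurable_disagreement zeta N meta.
have sub : [set x | eta x <> zeta (word N x)] `<=` \big[setU/set0]_(j : 'I_k) D j.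
  move=> x /= ex; rewrite -bigcup_seq; apply: contrapT => nD; apply: ex.
  have PE j : P j (word (n j) x) <-> eta x = j.
    have : ~ D j x by move=> Dj; apply: nD; exists j => //=; rewrite mem_index_enum.
    rewrite /D /=; have := EM (P j (word (n j) x)); have := EM (eta x = j); tauto.
  rewrite /zeta; case: pickP => [j|/(_ (eta x))] /=.
    by rewrite take_word// => /asboolP/PE.
  by rewrite take_word// => /negP; case; apply/asboolP/PE.
apply: le_trans (pr_le mu mE _ sub) _; first exact: bigsetU_measurable.
apply: le_trans (pr_bigsetU_le mu _ mD) _.
apply: (@le_trans _ _ (\sum_(j < k) e / k%:R)); first by apply: ler_sum => j _; exact: HP.
by rewrite sumr_const card_ord -(mulr_natr (e / k%:R)) divfK// pnatr_eq0 -lt0n.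
Qed.

End approximation.

(** * Weights of words that are parsed into blocks *)

Lemma big_tupleS (R : realType) (A : finType) n (phi : seq A -> R) :
  \sum_(w : n.+1.-tuple A) phi w = \sum_a \sum_(w : n.-tuple A) phi (a :: w).
Proof.
rewrite pair_big /= (reindex (fun p : A * n.-tuple A => cons_tuple p.1 p.2)) //=.
exists (fun w : n.+1.-tuple A => (thead w, behead_tuple w)) => [[a w] _|w _].
  by rewrite /= theadE; congr (_, _); apply: val_inj.
by apply: val_inj; rewrite /= [in RHS](tuple_eta w).
Qed.

Lemma big_tuple0 (R : realType) (A : finType) (phi : seq A -> R) :
  \sum_(w : 0.-tuple A) phi w = phi [::].
Proof.
rewrite (bigD1 (nil_tuple A)) //= big1 ?addr0// => w.
by rewrite (tuple0 w) eqxx.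
Qed.

Section parsing.
Variables (R : realType) (A : finType) (p : seq A -> R).
Hypothesis p_ge0 : forall u, 0 <= p u.

(** [parse [::] w] is the sum, over all ways to cut [w] into nonempty blocks,
    of the product of the [p]-weights of the blocks; in general [u] is the part
    of the current block that has been read. *)
Fixpoint parse (u w : seq A) : R :=
  if w is a :: w' then parse (rcons u a) w' + p (rcons u a) * parse [::] w'
  else (u == [::])%:R.

Lemma parse_ge0 u w : 0 <= parse u w.
Proof. by elim: w u => [|a w IH] u //=; rewrite addr_ge0// mulr_ge0. Qed.

Lemma parse_block u v w : v != [::] ->
  p (u ++ v) * parse [::] w <= parse u (v ++ w).
Proof.
elim: v u => // a v IH u _ /=; have [->|v0] := eqVneq v [::].
  by rewrite cats1 lerDr parse_ge0.
rewrite -cat_rcons; apply: le_trans (IH (rcons u a) v0) _.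
by rewrite lerDl mulr_ge0// parse_ge0.
Qed.

(** If [pi u] bounds the total weight of the blocks that extend [u], then the
    weights of the words of a given length have sum at most [1], as in the
    probability that this length is a renewal time. The hypothesis on [pi] says
    that the weight available after reading [u] suffices for stopping at the next
    letter and for continuing the block. *)
Lemma parse_sum (pi : seq A -> R) n u : (forall u, 0 <= pi u) ->
  pi [::] = 1 -> (forall u, \sum_a (pi (rcons u a) + p (rcons u a)) <= pi u) ->
  \sum_(w : n.-tuple A) parse u w <= pi u.
Proof.
move=> pi0 pi1 pis; elim: n u => [|n IH] u.
  by rewrite big_tuple0 /=; case: eqP => [->|_]; rewrite ?pi1 ?pi0.
rewrite (big_tupleS n (parse u)); apply: le_trans (pis u); apply: ler_sum => a _ /=.
rewrite big_split /= -mulr_sumr lerD//.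
by rewrite ler_piMr// -pi1.
Qed.

End parsing.

(** This follows from [ln t <= t - 1], applied to [t = q / p]. *)
Lemma gibbs (R : realType) (T : finType) (p q : T -> R) :
  (forall t, 0 <= p t) -> (forall t, 0 <= q t) ->
  (forall t, 0 < p t -> 0 < q t) -> \sum_t p t = 1 -> \sum_t q t <= 1 ->
  - \sum_t p t * ln (p t) <= \sum_t p t * - ln (q t).
Proof.
move=> p0 q0 pq p1 q1; rewrite -subr_ge0 opprK -big_split /=.
apply: (@le_trans _ _ (\sum_t (p t - q t))).
  by rewrite sumrB p1 subr_ge0.
apply: ler_sum => t _; have [pt|] := ltP 0 (p t); last first.
  move=> pt; have -> : p t = 0 by apply/eqP; rewrite eq_le pt p0.
  by rewrite !mul0r !add0r oppr_le0.
have qt := pq t pt.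
have := @le_ln1Dx R (q t / p t - 1); rewrite (addrC 1) subrK ln_div ?posrE//.
rewrite ltrBrDl subrr divr_gt0// => /(_ isT) /(ler_wpM2l (ltW pt)).
rewrite mulrBr mulrBr mulr1 mulrCA divff ?mulr1 ?gt_eqF//; lra.
Qed.

Lemma borel_cantelli_geometric d (X : measurableType d) (R : realType)
    (mu : probability X R) (E : nat -> set X) (z : R) :
  (forall n, measurable (E n)) -> 0 < z < 1 ->
  (forall n, fine (mu (E n)) <= z ^+ n) ->
  \forall x \ae mu, \forall n \near \oo, ~ E n x.
Proof.
move=> mE /andP[z0 z1] Ez.
have : mu (lim_sup_set E) = 0%E.
  apply: lim_sup_set_cvg0 => //.
  apply: (@le_lt_trans _ _ (1 / (1 - z))%:E); last exact: ltry.
  apply: lime_le; first exact: is_cvg_nneseries.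
  apply: nearW => n; apply: (@le_trans _ _ (series (geometric 1 z) n)%:E).
    rewrite /series /= -sumEFin; apply: lee_sum => i _.
    by rewrite mul1r -[mu (E i)]fineK ?fin_num_measure// lee_fin.
  by rewrite lee_fin geometric_le_lim// ger0_norm// ltW.
move=> /ae_not_pr0; have mL : measurable (lim_sup_set E).
  by apply: bigcapT_measurable => n; apply: bigcup_measurable.
move=> /(_ mL); apply: filterS => x nE.
apply: contrapT => H; apply: nE => n _; apply: contrapT => nx.
apply: H; exists n => // k /= nk Ek; apply: nx; exists k => //.
Qed.

(** * Information of words *)
Section information.
Variables (m : nat) (R : realType) (mu : probability (Shift m) R).

Definition pword (w : seq 'I_m.+1) : R := fine (mu (word_cyl w)).

Lemma pword_ge0 w : 0 <= pword w.
Proof. exact: fine_ge0. Qed.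

Lemma pword_le1 w : pword w <= 1.
Proof.
rewrite -lee_fin /pword fineK ?fin_num_measure//; last exact: measurable_word_cyl.
by apply: probability_le1; exact: measurable_word_cyl.
Qed.

Lemma pword_nil : pword [::] = 1.
Proof.
rewrite /pword (_ : word_cyl _ = setT) ?probability_setT//.
by apply/seteqP; split.
Qed.

Lemma pword_rcons w : \sum_a pword (rcons w a) = pword w.
Proof.
have mxi (a : 'I_m.+1) : measurable ((fun x : Shift m => x (size w)) @^-1` [set a]).
  have -> : (fun x : Shift m => x (size w)) @^-1` [set a] =
      [set x : Shift m | nth ord0 (word (size w).+1 x) (size w) = a].
    by apply: eq_set => x; rewrite nth_mkseq.
  exact: (measurable_word _ (fun u => nth ord0 u (size w) = a)).
rewrite {2}/pword (pr_label mu mxi (measurable_word_cyl w)).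
apply: eq_bigr => a _; congr (fine (mu _)).
have E (x : Shift m) : word (size w).+1 x = rcons (word (size w) x) (x (size w)).
  exact: mkseqS.
apply/seteqP; split=> x.
  by rewrite /word_cyl /= size_rcons E => /rcons_inj[-> ->].
by move=> [wx /= xa]; rewrite /word_cyl /= size_rcons E wx xa.
Qed.

Definition tuple_word n (x : Shift m) : n.-tuple 'I_m.+1 :=
  Tuple (introT eqP (size_word n x)).

Lemma tuple_word_preimage n (w : n.-tuple 'I_m.+1) :
  tuple_word n @^-1` [set w] = word_cyl w.
Proof.
apply/seteqP; split=> x; rewrite /word_cyl /= size_tuple.
  by move=> <-.
by move=> H; apply: val_inj.
Qed.

Lemma integral_word n (phi : seq 'I_m.+1 -> R) :
  \int[mu]_x phi (word n x) = \sum_(w : n.-tuple 'I_m.+1) phi w * pword w.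
Proof.
have mxi (w : n.-tuple 'I_m.+1) : measurable (tuple_word n @^-1` [set w]).
  by rewrite tuple_word_preimage; exact: measurable_word_cyl.
rewrite (integral_label mu mxi (fun w => phi w)).
by apply: eq_bigr => w _; rewrite tuple_word_preimage.
Qed.

Lemma pr_word n (P : pred (seq 'I_m.+1)) :
  fine (mu [set x | P (word n x)]) =
  \sum_(w : n.-tuple 'I_m.+1) (P w)%:R * pword w.
Proof.
rewrite -(integral_word n (fun w => (P w)%:R)) -Rintegral_indic; last exact: (measurable_word n P).
apply: eq_Rintegral => x _; rewrite indicE; congr (nat_of_bool _)%:R.
by apply/idP/idP => [/set_mem|?]; [|apply/mem_set].
Qed.

Lemma sum_pword n : \sum_(w : n.-tuple 'I_m.+1) pword w = 1.
Proof.
rewrite -[RHS](@Rintegral_cst1 _ _ _ mu) (integral_word n (fun=> 1)).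
by apply: eq_bigr => w _; rewrite mul1r.
Qed.

Lemma ae_pword_gt0 : \forall x \ae mu, forall n, 0 < pword (word n x).
Proof.
apply: ae_foralln => n.
have mN : measurable [set x : Shift m | pword (word n x) <= 0].
  exact: (measurable_word n (fun w => pword w <= 0)).
have /(ae_not_pr0 mN) : mu [set x | pword (word n x) <= 0] = 0%E.
  rewrite -[LHS]fineK ?fin_num_measure// (pr_word n (fun w => pword w <= 0)) big1// => w _.
  have [wle|] := leP (pword w) 0; rewrite ?mul0r// mul1r.
  by apply/eqP; rewrite eq_le wle pword_ge0.
by apply: filterS => x /= /negP; rewrite -ltNge.
Qed.

(** Null words would have infinite information. They are given a finite one, large
    enough for the information to be monotone under the shift at every point and
    not only almost everywhere ([info_cons]). *)
Definition info_bound n : R :=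
  \sum_(j < n.+1) \sum_(w : j.-tuple 'I_m.+1) `|ln (pword w)|.

Definition info (w : seq 'I_m.+1) : R :=
  if pword w == 0 then info_bound (size w) else - ln (pword w).

Lemma info_bound_ge0 n : 0 <= info_bound n.
Proof. by apply: sumr_ge0 => j _; exact: sumr_ge0. Qed.

Lemma info_ge0 w : 0 <= info w.
Proof.
rewrite /info; case: ifP => _; first exact: info_bound_ge0.
by rewrite oppr_ge0; apply: ln_le0; exact: pword_le1.
Qed.

Lemma info_le_bound w : info w <= info_bound (size w).
Proof.
rewrite /info; case: ifP => // _; apply: le_trans (ler_norm _) _.
rewrite normrN /info_bound big_ord_recr /= (bigD1 (in_tuple w)) //= addrCA lerDl.
by rewrite addr_ge0// sumr_ge0// => j _; exact: sumr_ge0.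
Qed.

Lemma info_bound_mono n : info_bound n <= info_bound n.+1.
Proof. by rewrite {2}/info_bound big_ord_recr /= lerDl; exact: sumr_ge0. Qed.

Hypothesis inv : invariant_measure (@left_shift m) mu.

Lemma pword_cons a w : pword (a :: w) <= pword w.
Proof.
rewrite /pword -(inv (measurable_word_cyl w)); apply: pr_le.
- exact: measurable_word_cyl.
- rewrite -[X in measurable X]setTI; apply: measurable_left_shift => //.
  exact: measurable_word_cyl.
- by move=> x; rewrite /word_cyl /preimage /= wordS => -[].
Qed.

Lemma info_cons a w : info w <= info (a :: w).
Proof.
rewrite {2}/info; case: ifPn => [_|aw].
  by apply: le_trans (info_le_bound w) _; exact: info_bound_mono.
have aw0 : 0 < pword (a :: w) by rewrite lt_neqAle eq_sym aw pword_ge0.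
have w0 := lt_le_trans aw0 (pword_cons a w).
by rewrite /info gt_eqF// lerN2 ler_ln ?posrE// pword_cons.
Qed.

End information.

(** * A code made of good words *)
Section block_weights.
Variables (m : nat) (R : realType) (mu : probability (Shift m) R) (c dl : R).
Hypothesis dl01 : 0 < dl < 1.
Local Notation pword := (pword mu).

(** A word is good when its information is at most [c] per letter. *)
Definition good (u : seq 'I_m.+1) : bool := expR (- (c * (size u)%:R)) <= pword u.

Definition no_good (u : seq 'I_m.+1) : bool :=
  all (fun l => ~~ good (take l u)) (iota 1 (size u)).

Definition first_good (u : seq 'I_m.+1) : bool :=
  [&& u != [::], good u & no_good (take (size u).-1 u)].

(** The words that are good and have no shorter good prefix form a prefix code,
    so their measures have sum at most [1]; a share [dl] of the weight is kept for
    single letters, which allows every word to be parsed. *)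
Definition block_weight (u : seq 'I_m.+1) : R :=
  (1 - dl) * pword u * (first_good u)%:R + dl / m.+1%:R * (size u == 1%N)%:R.

(** A bound for the total weight of the blocks that extend [u]: such a block is
    either a first good word, which exists only while no prefix has been good, or
    a single letter. *)
Definition no_good_weight (u : seq 'I_m.+1) : R :=
  if u == [::] then 1 else (1 - dl) * pword u * (no_good u)%:R.

Let dl0 : 0 < dl. Proof. by case/andP: dl01. Qed.
Let dl1 : 0 < 1 - dl. Proof. by rewrite subr_gt0; case/andP: dl01. Qed.

Lemma no_good_rcons u a : no_good (rcons u a) = no_good u && ~~ good (rcons u a).
Proof.
rewrite /no_good size_rcons -[(size u).+1]addn1 iotaD all_cat /= andbT add1n.
rewrite take_oversize ?size_rcons//; congr (_ && _).
apply: eq_in_all => l; rewrite mem_iota add1n ltnS => /andP[_ lu].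
by rewrite -cats1 takel_cat.
Qed.

Lemma first_good_rcons u a : first_good (rcons u a) = good (rcons u a) && no_good u.
Proof.
rewrite /first_good size_rcons /= -cats1 takel_cat// take_size cats1.
by case: u.
Qed.

Lemma block_weight_ge0 u : 0 <= block_weight u.
Proof.
by rewrite addr_ge0// mulr_ge0// ?divr_ge0 ?mulr_ge0 ?pword_ge0// ltW.
Qed.

Lemma no_good_weight_ge0 u : 0 <= no_good_weight u.
Proof.
by rewrite /no_good_weight; case: ifP => // _; rewrite !mulr_ge0// ?pword_ge0// ltW.
Qed.

Lemma no_good_weight_split u :
  \sum_a (no_good_weight (rcons u a) + block_weight (rcons u a)) <= no_good_weight u.
Proof.
have E a : no_good_weight (rcons u a) + block_weight (rcons u a) =
    (1 - dl) * (no_good u)%:R * pword (rcons u a) + dl / m.+1%:R * (u == [::])%:R.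
  rewrite /no_good_weight /block_weight -size_eq0 size_rcons /=.
  rewrite no_good_rcons first_good_rcons eqSS size_eq0 addrA; congr (_ + _).
  by case: (no_good u); case: (good _); rewrite /= ?mulr0 ?mulr1 ?add0r ?addr0 ?mul0r.
under eq_bigr do rewrite E; rewrite big_split /= -mulr_sumr pword_rcons.
rewrite sumr_const card_ord -(mulr_natr (dl / m.+1%:R * _)) [X in _ + X]mulrAC divfK ?pnatr_eq0//.
rewrite /no_good_weight; case: eqP => [->|_]; last by rewrite mulr0 addr0 mulrAC.
by rewrite pword_nil /no_good /=; lra.
Qed.

Lemma parse_total n :
  \sum_(w : n.-tuple 'I_m.+1) parse block_weight [::] w <= 1.
Proof.
have := @parse_sum R _ block_weight block_weight_ge0 no_good_weight n [::]
  no_good_weight_ge0 _ no_good_weight_split.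
by rewrite /no_good_weight eqxx; apply.
Qed.

Lemma parse_letter a w :
  dl / m.+1%:R * parse block_weight [::] w <= parse block_weight [::] (a :: w).
Proof.
apply: le_trans (parse_block block_weight_ge0 [::] w (isT : [:: a] != [::])).
apply: (ler_wpM2r (parse_ge0 block_weight_ge0 _ _)).
by rewrite /block_weight /= mulr1 lerDr !mulr_ge0// ?pword_ge0// ltW.
Qed.

Lemma parse_first_good u w : first_good u ->
  (1 - dl) * expR (- (c * (size u)%:R)) * parse block_weight [::] w <=
  parse block_weight [::] (u ++ w).
Proof.
move=> gu; have /and3P[u0 gu' _] := gu.
apply: le_trans (parse_block block_weight_ge0 [::] w u0).
apply: (ler_wpM2r (parse_ge0 block_weight_ge0 _ _)).
rewrite /block_weight gu mulr1 -[X in X <= _]addr0 lerD//.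
  by rewrite ler_wpM2l// ltW.
by rewrite mulr_ge0// divr_ge0// ltW.
Qed.

Lemma parse_gt0 w : 0 < parse block_weight [::] w.
Proof.
elim: w => [|a w IH]; first by rewrite /= ltr01.
by apply: lt_le_trans (parse_letter a w); rewrite mulr_gt0// divr_gt0// ltr0n.
Qed.

Lemma ex_first_good (x : Shift m) l : (0 < l)%N -> good (word l x) ->
  exists2 k, (0 < k)%N & first_good (word k x).
Proof.
move=> l0 gl; have ex : exists k, (0 < k)%N && good (word k x).
  by exists l; rewrite l0.
case: (ex_minnP ex) => k /andP[k0 gk] kmin.
exists k => //; rewrite /first_good -size_eq0 size_word -lt0n k0 gk /=.
rewrite take_word ?leq_pred// /no_good size_word; apply/allP => j.
rewrite mem_iota add1n ltnS => /andP[j0 jk]; rewrite take_word//.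
apply/negP => gj; have := kmin j; rewrite j0 gj => /(_ isT).
by rewrite leqNgt -(prednK k0) ltnS jk.
Qed.

End block_weights.

(** * Entropy along words *)
Section smb.
Variables (m : nat) (R : realType) (mu : probability (Shift m) R).
Hypothesis erg : ergodic_measure (@left_shift m) mu.
Let mf := measurable_left_shift (m := m).
Let inv : invariant_measure (@left_shift m) mu := erg.1.
Local Notation pword := (pword mu).
Local Notation info := (info mu).

Definition word_entropy n : R := - \sum_(w : n.-tuple 'I_m.+1) pword w * ln (pword w).

Lemma integral_info n : \int[mu]_x info (word n x) = word_entropy n.
Proof.
rewrite integral_word /word_entropy -sumrN; apply: eq_bigr => w _.
by rewrite /info; case: eqP => [->|_]; rewrite ?mul0r ?mulr0 ?oppr0// mulrC mulrN.
Qed.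

(** If almost every point starts with a good word, then cutting greedily into good
    words gives parse weights [q] with [- ln q <= c' * n]. The weights [q] have sum
    at most [1] on words of length [n]. So the information exceeds [- ln q] by more
    than [e * n] with probability at most [expR (- e * n)], hence, by
    Borel-Cantelli, almost surely only finitely often; and its integral is at most
    that of [- ln q] by [gibbs]. *)
Lemma info_upper (c c' : R) : c < c' ->
  (\forall x \ae mu, exists2 l, (0 < l)%N & info (word l x) <= c * l%:R) ->
  (\forall x \ae mu, \forall n \near \oo, info (word n x) <= c' * n%:R) /\
  (\forall n \near \oo, \int[mu]_x info (word n x) <= c' * n%:R).
Proof.
move=> cc' aec; pose e := (c' - c) / 4.
have e0 : 0 < e by rewrite divr_gt0// subr_gt0.
pose z := expR (- e); have z0 : 0 < z by exact: expR_gt0.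
have z1 : z < 1 by rewrite expR_lt1 oppr_lt0.
pose dl := 1 - z; have dl01 : 0 < dl < 1 by rewrite subr_gt0 z1 ltrBlDr ltrDl.
pose q w := parse (block_weight mu c dl) [::] w.
have q0 w : 0 < q w by exact: parse_gt0.
pose F n x := - ln (q (word n x)).
pose Gam l := [set x : Shift m | first_good mu c (word l x)].
have mGam l : measurable (Gam l) by exact: (measurable_word l (first_good mu c)).
have aeG : \forall x \ae mu, exists2 l, (0 < l)%N & Gam l x.
  apply: filterS2 aec (ae_pword_gt0 mu) => x [l l0 cl] /(_ l) pl.
  apply: (ex_first_good l0); rewrite /good size_word -ler_ln ?posrE ?expR_gt0//.
  by move: cl; rewrite /info gt_eqF// expRK; lra.
pose C := Num.max (- ln (dl / m.+1%:R)) (c + e).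
have cC : c + e <= C by rewrite le_max lexx orbT.
have d0 : 0 < dl / m.+1%:R by rewrite divr_gt0//; case/andP: dl01.
have F0 x : F 0%N x <= 0 by rewrite /F /q /= ln1 oppr0.
have FS n x : F n.+1 x <= C + F n (left_shift x).
  rewrite /F wordS.
  apply: (@le_trans _ _ (- ln (dl / m.+1%:R) - ln (q (word n (left_shift x))))).
    rewrite -opprD lerN2 -lnM ?posrE// ler_ln ?posrE ?(mulr_gt0 d0)//.
    exact: parse_letter.
  by rewrite lerD2r le_max lexx.
have FG l n x : (0 < l)%N -> Gam l x ->
    F (l + n)%N x <= (c + e) * l%:R + F n (iter l (@left_shift m) x).
  move=> l0 Gl; rewrite /F wordD.
  have := parse_first_good dl01 (word n (iter l (@left_shift m) x)) Gl.
  rewrite subKr size_word.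
  have H0 : 0 < z * expR (- (c * l%:R)) * q (word n (iter l (@left_shift m) x)).
    by rewrite !mulr_gt0// expR_gt0.
  rewrite -ler_ln ?posrE// -/(q _) !lnM ?posrE ?mulr_gt0 ?expR_gt0// !expRK -/(q _).
  have : e <= e * l%:R by rewrite ler_pMr// ler1n.
  lra.
have ce : c + e < c + 2 * e by move: e0; lra.
have mF n : measurable_fun setT (F n) by exact: (measurable_word_fun n (fun w => - ln (q w))).
have bF n : exists b : R, forall x, `|F n x| <= b.
  exact: (word_bound n (fun w => - ln (q w))).
have n4 n : (c + 2 * e) * n%:R <= c' * n%:R.
  by rewrite ler_wpM2r//; move: e0; rewrite /e; lra.
have mE n : measurable [set x : Shift m | pword (word n x) < z ^+ n * q (word n x)].
  exact: (measurable_word n (fun w => pword w < z ^+ n * q w)).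
have [] : (0 < z < 1) /\ forall n,
    fine (mu [set x | pword (word n x) < z ^+ n * q (word n x)]) <= z ^+ n.
  rewrite z0 z1; split=> // n; rewrite (pr_word mu n (fun w => pword w < z ^+ n * q w)).
  apply: (@le_trans _ _ (\sum_(w : n.-tuple 'I_m.+1) z ^+ n * q w)).
    apply: ler_sum => w _; case: ltP => [/ltW|_]; rewrite ?mul1r// mul0r.
    by rewrite mulr_ge0// ?exprn_ge0// ltW.
  by rewrite -mulr_sumr ler_piMr ?exprn_ge0 ?(ltW z0)//; exact: parse_total.
move=> z01 /(borel_cantelli_geometric mE z01) aeE; split.
  have := block_ae_le mf erg mGam cC F0 FS FG aeG ce.
  apply: filterS3 aeE (ae_pword_gt0 mu) => x Ex px; apply: filterS2 Ex => n /= /negP.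
  rewrite -leNgt => En Fn.
  have zq : 0 < z ^+ n * q (word n x) by rewrite mulr_gt0// exprn_gt0.
  have : ln (z ^+ n * q (word n x)) <= ln (pword (word n x)) by rewrite ler_ln ?posrE.
  rewrite lnM ?posrE ?exprn_gt0// lnXn// expRK => {}En; move: En.
  rewrite /info gt_eqF//; move: Fn; rewrite /F -(mulr_natr (- e)) => Fn En.
  have := n4 n; have : 0 <= e * n%:R by rewrite mulr_ge0// ltW.
  move: Fn En; rewrite /e; lra.
have := block_integral_le mf erg mGam cC F0 FS FG aeG ce mF bF.
apply: filterS => n Fn; apply: le_trans (n4 n); apply: le_trans Fn.
rewrite integral_info (integral_word mu n (fun w => - ln (q w))) /word_entropy.
under [leRHS]eq_bigr do rewrite mulrC.
apply: (gibbs (p := fun w : n.-tuple 'I_m.+1 => pword w) (q := fun w => q w)) => //.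
- by move=> w; exact: pword_ge0.
- by move=> w; exact/ltW.
- exact: sum_pword.
- exact: parse_total.
Qed.

(** [info_upper] is the missing hypothesis of [ergodic_limit]. The information is
    monotone along orbits by [info_cons], which is all that the zero-one law
    asks for. *)
Theorem shannon_mcmillan_breiman : exists h : R,
  (\forall x \ae mu, (fun n => n%:R^-1 * info (word n x)) @ \oo --> h) /\
  (fun n => n%:R^-1 * word_entropy n) @ \oo --> h.
Proof.
have [c0 Hc0] := @word_bound m R 1 info.
have [||||||h [aeh inth]] := @ergodic_limit _ _ _ _ _ mf erg (fun n x => info (word n x)) 0 c0.
- by move=> n; exact: measurable_word_fun.
- by move=> n; exact: word_bound.
- by move=> n x; rewrite oppr0 mul0r info_ge0.
- by move=> x; exact: le_trans (ler_norm _) (Hc0 x).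
- by left=> n x; rewrite wordS addr0; exact: info_cons.
- exact: info_upper.
exists h; split=> //.
by under eq_fun do rewrite -integral_info.
Qed.

End smb.

(** * Entropy of the shift *)
Lemma le_Rintegral_ae d (X : measurableType d) (R : realType)
    (mu : probability X R) (f g : X -> R) (C D : R) :
  measurable_fun setT f -> measurable_fun setT g ->
  (forall x, `|f x| <= C) -> (forall x, `|g x| <= D) ->
  (\forall x \ae mu, f x <= g x) -> \int[mu]_x f x <= \int[mu]_x g x.
Proof.
move=> mf mg fC gD fg.
have mN : measurable [set x | f x <= g x].
  by rewrite -[X in measurable X]setTI; exact: measurable_fun_le.
have N0 : fine (mu (~` [set x | f x <= g x])) = 0.
  by rewrite (measure_negligible (measurableC mN)).
have mI : measurable_fun setT (\1_(~` [set x | f x <= g x]) : X -> R).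
  by apply: measurable_indic; exact: measurableC.
have [x0 _] := ae_ex fg.
have CD : 0 <= C + D.
  by apply: addr_ge0; [exact: le_trans (fC x0)|exact: le_trans (gD x0)].
have iI : mu.-integrable setT
    (EFin \o (fun x => (C + D) * (\1_(~` [set x | f x <= g x]) x : R))).
  apply: (@bounded_integrable _ _ _ _ _ ((C + D) * 1)); first exact: measurable_funM.
  by move=> x; rewrite normrM ger0_norm// ler_wpM2l// indic_norm_le1.
have ig := bounded_integrable mu mg gD.
apply: (@le_trans _ _ (\int[mu]_x (g x + (C + D) * (\1_(~` [set x | f x <= g x]) x : R)))).
  apply: le_Rintegral => //.
  - exact: bounded_integrable fC.
  - exact: (integrableD measurableT ig iI).
  - move=> x _; rewrite indicE in_setC.
    case: (boolP (x \in _)) => [/set_mem /= H|_]; first by rewrite mulr0 addr0.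
    rewrite mulr1; have := ler_norm (f x); have := fC x.
    by have := ler_norm (- g x); rewrite normrN; have := gD x; lra.
rewrite RintegralD// RintegralZl//; last exact: bounded_integrable (@indic_norm_le1 _ _ _).
by rewrite Rintegral_indic ?N0 ?mulr0 ?addr0//; exact: measurableC.
Qed.

Lemma measurable_label d (X : measurableType d) (R : realType) (T : finType)
    (xi : X -> T) : (forall t, measurable (xi @^-1` [set t])) ->
  forall phi : T -> R, measurable_fun setT (fun x => phi (xi x)).
Proof.
move=> mxi phi _ B mB; rewrite setTI.
rewrite (_ : _ @^-1` _ = \bigcup_(t in [set t | B (phi t)]) (xi @^-1` [set t])).
  exact: fin_bigcup_measurable.
by apply/seteqP; split=> x /=; [move=> H; exists (xi x)|move=> [t /= Bt ->]].
Qed.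

Lemma label_bound (X : Type) (R : realType) (T : finType) (xi : X -> T) (phi : T -> R) :
  exists b : R, forall x, `|phi (xi x)| <= b.
Proof.
by exists (\sum_t `|phi t|) => x; rewrite (bigD1 (xi x)) //= lerDl sumr_ge0.
Qed.

Section kolmogorov_sinai.
Variables (m : nat) (R : realType) (mu : probability (Shift m) R).
Hypothesis erg : ergodic_measure (@left_shift m) mu.
Let mf := measurable_left_shift (m := m).
Let inv : invariant_measure (@left_shift m) mu := erg.1.
Local Notation pword := (pword mu).
Local Notation info := (info mu).

Lemma join_entropy_letters n :
  join_entropy (@left_shift m) mu (fun x => x 0%N : 'I_m.+1) n = word_entropy mu n.
Proof.
rewrite /join_entropy /word_entropy; congr (- _).
rewrite (reindex (fun w : n.-tuple 'I_m.+1 => [ffun i => tnth w i])) /=; last first.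
  exists (fun w : {ffun 'I_n -> 'I_m.+1} => [tuple w i | i < n]) => [w _|w _].
    by apply: eq_from_tnth => i; rewrite tnth_mktuple ffunE.
  by apply/ffunP => i; rewrite ffunE tnth_mktuple.
apply: eq_bigr => w _; rewrite /pword.
suff -> : [set x : Shift m | forall i : 'I_n, iter i (@left_shift m) x 0%N = [ffun i => tnth w i] i]
    = word_cyl w by [].
rewrite word_cyl_cylinder; apply/seteqP; split=> x /= H i.
  rewrite size_tuple => i_n; have := H (Ordinal i_n).
  by rewrite iter_left_shift addn0 ffunE (tnth_nth ord0).
by rewrite iter_left_shift addn0 ffunE (tnth_nth ord0); apply: H; rewrite size_tuple.
Qed.

Lemma ln_prod (I : Type) (s : seq I) (F : I -> R) : (forall i, 0 < F i) ->
  ln (\prod_(i <- s) F i) = \sum_(i <- s) ln (F i).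
Proof.
move=> F0; elim: s => [|i s IH]; first by rewrite !big_nil ln1.
by rewrite !big_cons lnM ?posrE ?prodr_gt0// IH.
Qed.

(** A partition [eta] is compared with a function [zeta] of the first [N] letters
    that agrees with it off a small set. *)
Section coding.
Variables (k : nat) (eta : Shift m -> 'I_k) (N : nat) (zeta : seq 'I_m.+1 -> 'I_k).
Variable (dl : R).
Hypothesis dl01 : 0 < dl < 1.
Hypothesis meta : finite_partition eta.
Let k0 : (0 < k)%N. Proof. by case: k eta => // eta'; case: (eta' (fun=> ord0)). Qed.
Let dl0 : 0 < dl. Proof. by case/andP: dl01. Qed.
Let dl1 : 0 < 1 - dl. Proof. by rewrite subr_gt0; case/andP: dl01. Qed.
Let kR : 0 < k%:R :> R. Proof. by rewrite ltr0n. Qed.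

Definition mismatch := [set x | eta x <> zeta (word N x)].

(** The transition weight of a channel from [b] to [a]. Every [a] keeps a positive
    weight, so that a disagreement has finite cost. *)
Definition noisy (a b : 'I_k) : R := if a == b then 1 - dl else dl / k%:R.

Lemma noisy_gt0 a b : 0 < noisy a b.
Proof. by rewrite /noisy; case: ifP => // _; rewrite divr_gt0. Qed.

Lemma noisy_sum b : \sum_a noisy a b <= 1.
Proof.
apply: (@le_trans _ _ (\sum_a ((a == b)%:R * (1 - dl) + dl / k%:R))).
  apply: ler_sum => a _; rewrite /noisy; case: eqP => _.
    by rewrite mul1r lerDl ltW// divr_gt0.
  by rewrite mul0r add0r.
rewrite big_split /= sumr_const card_ord -(mulr_natr (dl / _)) divfK ?gt_eqF//.
rewrite (bigD1 b) //= eqxx mul1r big1 => [|a /negbTE ->]; last by rewrite mul0r.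
by rewrite addr0 subrK.
Qed.

(** The measure of the [eta]-word [w] when [eta] is replaced by its
    approximation [zeta], seen through a memoryless noisy channel. *)
Definition channel_weight n (w : {ffun 'I_n -> 'I_k}) : R :=
  \sum_(u : (n + N).-tuple 'I_m.+1)
     pword u * \prod_(i < n) noisy (w i) (zeta (take N (drop i u))).

Lemma channel_weight_gt0 n (w : {ffun 'I_n -> 'I_k}) : 0 < channel_weight w.
Proof.
have t0 (u : (n + N).-tuple 'I_m.+1) :
    0 <= pword u * \prod_(i < n) noisy (w i) (zeta (take N (drop i u))).
  by rewrite mulr_ge0 ?pword_ge0// prodr_ge0// => i _; exact/ltW/noisy_gt0.
rewrite lt_neqAle eq_sym sumr_ge0 ?andbT//; apply/eqP => /eqP.
rewrite psumr_eq0// => /allP H.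
have := sum_pword mu (n + N); rewrite big1 => [/esym/eqP|u _]; first by rewrite oner_eq0.
have /implyP := H u (mem_index_enum _) => /(_ isT).
rewrite mulf_eq0 => /orP[/eqP //|].
by rewrite gt_eqF// prodr_gt0// => i _; exact: noisy_gt0.
Qed.

Lemma channel_weight_sum n : \sum_(w : {ffun 'I_n -> 'I_k}) channel_weight w <= 1.
Proof.
rewrite exchange_big /=.
apply: (@le_trans _ _ (\sum_(u : (n + N).-tuple 'I_m.+1) pword u)); last by rewrite sum_pword.
apply: ler_sum => u _.
rewrite -mulr_sumr ler_piMr ?pword_ge0//.
rewrite -(bigA_distr_bigA (fun (i : 'I_n) a => noisy a (zeta (take N (drop i u))))).
apply: prodr_ile1 => i _; rewrite noisy_sum andbT sumr_ge0// => a _.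
exact/ltW/noisy_gt0.
Qed.

Definition eta_word n (x : Shift m) : {ffun 'I_n -> 'I_k} :=
  [ffun i : 'I_n => eta (iter i (@left_shift m) x)].

Lemma eta_word_preimage n (w : {ffun 'I_n -> 'I_k}) :
  eta_word n @^-1` [set w] =
  [set x | forall i : 'I_n, eta (iter i (@left_shift m) x) = w i].
Proof.
apply/seteqP; split=> x /=; first by move=> <- i; rewrite ffunE.
by move=> H; apply/ffunP => i; rewrite ffunE.
Qed.

Lemma measurable_eta_word n (w : {ffun 'I_n -> 'I_k}) :
  measurable (eta_word n @^-1` [set w]).
Proof.
rewrite eta_word_preimage.
rewrite (_ : [set x | _] = \bigcap_(i in [set: 'I_n])
    (iter i (@left_shift m) @^-1` (eta @^-1` [set w i]))).
  apply: fin_bigcap_measurable => // i _.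
  by apply: measurable_preimage_iter => //; exact: meta.
by apply/seteqP; split=> x /= H i; [move=> _|]; exact: H.
Qed.

Lemma measurable_mismatch : measurable mismatch.
Proof. exact: (measurable_disagreement zeta N meta). Qed.

Lemma channel_weight_ge n (x : Shift m) : 0 < pword (word (n + N) x) ->
  - ln (channel_weight (eta_word n x)) <= info (word (n + N) x) +
    (- ln (1 - dl) * n%:R +
     - ln (dl / k%:R) * ergodic_sum (@left_shift m) \1_mismatch n x).
Proof.
move=> px.
have dk0 : 0 < dl / k%:R by rewrite divr_gt0.
pose P := \prod_(i < n) noisy (eta_word n x i) (zeta (word N (iter i (@left_shift m) x))).
have P0 : 0 < P by apply: prodr_gt0 => i _; exact: noisy_gt0.
have le1 : pword (word (n + N) x) * P <= channel_weight (eta_word n x).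
  rewrite /channel_weight (bigD1 (tuple_word (n + N) x)) //= -[leLHS]addr0.
  apply: lerD; last first.
    apply: sumr_ge0 => u _; rewrite mulr_ge0 ?pword_ge0// prodr_ge0// => i _.
    exact/ltW/noisy_gt0.
  rewrite le_eqVlt; apply/orP; left; apply/eqP; congr (_ * _).
  apply: eq_bigr => i _; congr (noisy _ (zeta _)).
  rewrite (_ : n + N = i + (n - i + N))%N; last by have := ltn_ord i; lia.
  rewrite wordD drop_size_cat ?size_word// take_word//; lia.
have lnP : - ln P <= - ln (1 - dl) * n%:R +
     - ln (dl / k%:R) * ergodic_sum (@left_shift m) \1_mismatch n x.
  rewrite /P /ergodic_sum mulr_sumr ln_prod => [|i]; last exact: noisy_gt0.
  have -> : - ln (1 - dl) * n%:R = \sum_(i < n) - ln (1 - dl).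
    by rewrite sumr_const card_ord mulr_natr.
  rewrite -big_split /= -sumrN; apply: ler_sum => i _.
  rewrite ffunE /noisy indicE; set y := iter i _ x.
  have [e|/eqP ne] := eqVneq (eta y) (zeta (word N y)).
    by rewrite (memNset (_ : ~ mismatch y)) ?mulr0 ?addr0//; apply; exact: e.
  rewrite (mem_set (_ : mismatch y))// mulr1 lerDr oppr_ge0 ln_le0//.
  by rewrite gerBl ltW.
have Pp : 0 < pword (word (n + N) x) * P by rewrite mulr_gt0.
apply: le_trans (lerD (lexx _) lnP).
rewrite /info gt_eqF// -opprD lerN2 -lnM ?posrE// ler_ln ?posrE//.
exact: channel_weight_gt0.
Qed.

(** By [gibbs] the entropy of the words of [eta] is at most their mean code length
    for the channel weights: the information of the underlying word of letters,
    plus a small cost per symbol, plus a cost for each disagreement between [eta]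
    and [zeta]. *)
Lemma join_entropy_le n :
  join_entropy (@left_shift m) mu eta n <= word_entropy mu (n + N) +
    (- ln (1 - dl) - ln (dl / k%:R) * fine (mu mismatch)) * n%:R.
Proof.
have mI : measurable_fun setT (\1_mismatch : Shift m -> R).
  by apply: measurable_indic; exact: measurable_mismatch.
have mS := measurable_ergodic_sum mf n mI.
have bS x : `|ergodic_sum (@left_shift m) \1_mismatch n x| <= 1 * n%:R :> R.
  by apply: ergodic_sum_bound; exact: indic_norm_le1.
have : join_entropy (@left_shift m) mu eta n <=
    \int[mu]_x - ln (channel_weight (eta_word n x)).
  rewrite (integral_label mu (@measurable_eta_word n) (fun w => - ln (channel_weight w))).
  rewrite /join_entropy.
  under eq_bigr do rewrite -eta_word_preimage.
  under [leRHS]eq_bigr do rewrite mulrC.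
  apply: (gibbs (p := fun w : {ffun 'I_n -> 'I_k} => fine (mu (eta_word n @^-1` [set w])))) => //.
  - by move=> w; exact: fine_ge0.
  - by move=> w; exact/ltW/channel_weight_gt0.
  - by move=> w _; exact: channel_weight_gt0.
  - rewrite -[RHS](@Rintegral_cst1 _ _ _ mu).
    rewrite (integral_label mu (@measurable_eta_word n) (fun=> 1)).
    by apply: eq_bigr => w _; rewrite mul1r.
  - exact: channel_weight_sum.
move=> /le_trans; apply.
set a := - ln (1 - dl); set b := - ln (dl / k%:R).
have [bi Hbi] := @word_bound m R (n + N) info.
have [bc Hbc] := label_bound (@eta_word n) (fun w => - ln (channel_weight w)).
have mc := measurable_label (@measurable_eta_word n) (fun w => - ln (channel_weight w)).
have mbS : measurable_fun setT (fun x => b * ergodic_sum (@left_shift m) \1_mismatch n x).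
  exact: measurable_funM.
have HbS x : `|b * ergodic_sum (@left_shift m) \1_mismatch n x| <= `|b| * (1 * n%:R).
  by rewrite normrM ler_wpM2l.
have mabS : measurable_fun setT
    (fun x => a * n%:R + b * ergodic_sum (@left_shift m) \1_mismatch n x).
  exact: measurable_funD.
have HabS x : `|a * n%:R + b * ergodic_sum (@left_shift m) \1_mismatch n x| <=
    `|a * n%:R| + `|b| * (1 * n%:R).
  by apply: le_trans (ler_normD _ _) _; rewrite lerD2l.
have minfo : measurable_fun setT (fun x : Shift m => info (word (n + N) x)).
  exact: measurable_word_fun.
apply: (@le_trans _ _ (\int[mu]_x (info (word (n + N) x) +
    (a * n%:R + b * ergodic_sum (@left_shift m) \1_mismatch n x)))).
  apply: (le_Rintegral_ae mc _ Hbc (D := bi + (`|a * n%:R| + `|b| * (1 * n%:R)))).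
  - exact: measurable_funD.
  - by move=> x; apply: le_trans (ler_normD _ _) _; exact: lerD.
  - have := ae_pword_gt0 mu; apply: filterS => x /(_ (n + N)%N).
    exact: channel_weight_ge.
rewrite RintegralD//; last 2 first.
- exact: bounded_integrable Hbi.
- exact: bounded_integrable HabS.
rewrite RintegralD//; last 2 first.
- by apply: (@bounded_integrable _ _ _ _ _ `|a * n%:R|) => //; exact: measurable_cst.
- exact: bounded_integrable HbS.
rewrite Rintegral_cst1 RintegralZl//; last exact: bounded_integrable bS.
rewrite integral_info (Rintegral_ergodic_sum mf inv n mI (@indic_norm_le1 _ _ _)).
rewrite Rintegral_indic; last exact: measurable_mismatch.
by rewrite le_eqVlt; apply/orP; left; apply/eqP; rewrite /a /b; ring.
Qed.

End coding.

(** The partition into letters has entropy [h]. For another partition, [dl] is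
    chosen first in [join_entropy_le], then the approximation [zeta] so fine that
    the disagreements cost little although their price depends on [dl]. *)
Theorem kolmogorov_sinai (h : R) :
  (fun n => n%:R^-1 * word_entropy mu n) @ \oo --> h ->
  entropy (@left_shift m) mu = h%:E.
Proof.
move=> Hh.
have W0 n : 0 <= word_entropy mu n.
  by rewrite -integral_info; apply: Rintegral_ge0 => x _; exact: info_ge0.
have h0 : 0 <= h.
  rewrite -(cvg_lim (@Rhausdorff R) Hh); apply: limr_ge; first exact: cvgP Hh.
  by apply: nearW => n; rewrite mulr_ge0.
apply/eqP; rewrite eq_le; apply/andP; split; last first.
  apply: ereal_sup_ubound; exists m.+1, (fun x => x 0%N : 'I_m.+1); split.
    exact: measurable_cylinder1.
  congr (_%:E); rewrite /partition_entropy; apply/esym/cvg_lim => //.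
  by under eq_fun do rewrite join_entropy_letters.
apply: ge_ereal_sup => _ [k [eta [meta ->]]]; rewrite lee_fin /partition_entropy.
set u := fun n : nat => _.
have [cu|/dvgP ->] := pselect (cvgn u); last by [].
apply/ler_addgt0Pr => e e0; apply: limr_le => //.
pose e1 := e / 4; have e10 : 0 < e1 by rewrite divr_gt0.
pose dl := 1 - expR (- e1).
have dl01 : 0 < dl < 1 by rewrite subr_gt0 expR_lt1 oppr_lt0 e10 ltrBlDr ltrDl expR_gt0.
pose b := - ln (dl / k%:R).
have b1 : 0 < `|b| + 1 by rewrite ltr_pwDr.
have [N [zeta Hz]] := partition_approx mu meta (divr_gt0 e10 b1).
have bz : b * fine (mu (mismatch eta N zeta)) <= e1.
  apply: (@le_trans _ _ ((`|b| + 1) * (e1 / (`|b| + 1)))); last by rewrite mulrC divfK// gt_eqF.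
  apply: (@le_trans _ _ ((`|b| + 1) * fine (mu (mismatch eta N zeta)))).
    by rewrite ler_wpM2r ?fine_ge0//; have := ler_norm b; lra.
  by rewrite ler_wpM2l// ltW.
have [N1 _ HN1] : \forall n \near \oo, word_entropy mu n <= (h + e1) * n%:R.
  move/cvgrPdist_le : Hh => /(_ e1 e10)[N1 _ H1]; exists N1.+1 => // n /= Nn.
  have := H1 n (ltnW Nn); rewrite ler_norml => /andP[+ _].
  have n0 : 0 < n%:R :> R by rewrite ltr0n (leq_trans _ Nn).
  by rewrite lerBrDl lerBlDr mulrC ler_pdivrMr.
have [N2 _ HN2] : \forall n \near \oo, (h + e1) * N%:R <= e1 * n%:R by exact: near_linear_ge.
exists (maxn N1 N2).+1 => // n /=; rewrite gtn_max => /andP[N1n N2n].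
have n0 : 0 < n%:R :> R by rewrite ltr0n (leq_trans _ N1n).
rewrite /u mulrC ler_pdivrMr//.
apply: le_trans (join_entropy_le N zeta dl01 meta n) _.
have H1 := HN1 (n + N)%N (leq_trans (ltnW N1n) (leq_addr _ _)).
have H2 := HN2 n (ltnW N2n).
apply: le_trans (lerD H1 (lexx _)) _.
have lnz : - ln (1 - dl) = e1 by rewrite /dl subKr expRK opprK.
have -> : e = 4 * e1 by rewrite /e1 mulrCA divff ?mulr1// pnatr_eq0.
rewrite lnz natrD; have := ler_wpM2r (ltW n0) bz; rewrite /b.
move: H2; lra.
Qed.

End kolmogorov_sinai.

(** * Plane linear algebra *)
Section plane.
Variable R : realType.
Implicit Types (A B : 'M[R]_2) (v w : 'cV[R]_2).

Lemma sum2 (V : zmodType) (F : 'I_2 -> V) : \sum_i F i = F 0 + F 1.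
Proof.
rewrite big_ord_recl big_ord1; congr (_ + F _); exact: val_inj.
Qed.

Lemma det2 A : \det A = A 0 0 * A 1 1 - A 0 1 * A 1 0.
Proof.
rewrite (expand_det_row _ 0) sum2 /cofactor !det_mx11 !mxE /=.
rewrite expr0 expr1 mul1r mulN1r mulrN.
congr (_ * A _ _ - _ * A _ _); exact: val_inj.
Qed.

Definition sqn v : R := v 0 0 ^+ 2 + v 1 0 ^+ 2.
Definition frob2 A : R := A 0 0 ^+ 2 + A 0 1 ^+ 2 + A 1 0 ^+ 2 + A 1 1 ^+ 2.

Lemma sqn_ge0 v : 0 <= sqn v.
Proof. by rewrite addr_ge0// sqr_ge0. Qed.

Lemma frob2_ge0 A : 0 <= frob2 A.
Proof. by rewrite !addr_ge0// sqr_ge0. Qed.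

Lemma enormE v : enorm v = Num.sqrt (sqn v).
Proof. by rewrite /enorm sum2. Qed.

Lemma enorm_ge0 v : 0 <= enorm v. Proof. exact: sqrtr_ge0. Qed.

Lemma sqr_enorm v : enorm v ^+ 2 = sqn v.
Proof. by rewrite enormE sqr_sqrtr// sqn_ge0. Qed.

Lemma mulmx2 A v i : (A *m v) i 0 = A i 0 * v 0 0 + A i 1 * v 1 0.
Proof. by rewrite mxE sum2. Qed.

Lemma enorm_eq0 v : (enorm v == 0) = (v == 0).
Proof.
apply/idP/eqP => [|->]; last by rewrite enormE /sqn !mxE expr0n addr0 sqrtr0.
rewrite enormE sqrtr_eq0 => v0.
have : sqn v == 0 by rewrite eq_le v0 sqn_ge0.
rewrite paddr_eq0 ?sqr_ge0// !sqrf_eq0 => /andP[/eqP e0 /eqP e1].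
apply/matrixP => i j; rewrite mxE (ord1 j).
have [-> //|] := eqVneq i 0; move=> i0.
have -> : i = 1 by apply: val_inj; case: i i0 => [[|[|]]].
by [].
Qed.

Lemma enorm_gt0 v : (0 < enorm v) = (v != 0).
Proof. by rewrite lt_def enorm_ge0 andbT enorm_eq0. Qed.

Lemma enormZ c v : enorm (c *: v) = `|c| * enorm v.
Proof.
rewrite !enormE -sqrtr_sqr -sqrtrM ?sqr_ge0//; congr Num.sqrt.
by rewrite /sqn !mxE; ring.
Qed.

Lemma cauchy_schwarz2 (a b c d : R) :
  (a * c + b * d) ^+ 2 <= (a ^+ 2 + b ^+ 2) * (c ^+ 2 + d ^+ 2).
Proof.
rewrite -subr_ge0.
have -> : (a ^+ 2 + b ^+ 2) * (c ^+ 2 + d ^+ 2) - (a * c + b * d) ^+ 2 =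
  (a * d - b * c) ^+ 2 by ring.
exact: sqr_ge0.
Qed.

Lemma enormD v w : enorm (v + w) <= enorm v + enorm w.
Proof.
rewrite -(ler_pXn2r (n := 2)) ?nnegrE ?addr_ge0 ?enorm_ge0// sqrrD !sqr_enorm.
have cs : v 0 0 * w 0 0 + v 1 0 * w 1 0 <= enorm v * enorm w.
  apply: le_trans (ler_norm _) _; rewrite -sqrtr_sqr !enormE -sqrtrM ?sqn_ge0//.
  by rewrite ler_wsqrtr// cauchy_schwarz2.
move: cs; rewrite /sqn !mxE; lra.
Qed.

Lemma enormN v : enorm (- v) = enorm v.
Proof. by rewrite -scaleN1r enormZ normrN1 mul1r. Qed.

Lemma sqn_mulmx A v : sqn (A *m v) <= frob2 A * sqn v.
Proof.
rewrite /sqn !mulmx2 /frob2.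
have := cauchy_schwarz2 (A 0 0) (A 0 1) (v 0 0) (v 1 0).
have := cauchy_schwarz2 (A 1 0) (A 1 1) (v 0 0) (v 1 0).
lra.
Qed.

Lemma enorm_mulmx A v : enorm (A *m v) <= Num.sqrt (frob2 A) * enorm v.
Proof.
by rewrite !enormE -sqrtrM ?frob2_ge0// ler_wsqrtr// sqn_mulmx.
Qed.

Lemma frob2M A B : frob2 (A *m B) <= frob2 A * frob2 B.
Proof.
rewrite {1}/frob2 !mxE !sum2 /frob2.
have := cauchy_schwarz2 (A 0 0) (A 0 1) (B 0 0) (B 1 0).
have := cauchy_schwarz2 (A 0 0) (A 0 1) (B 0 1) (B 1 1).
have := cauchy_schwarz2 (A 1 0) (A 1 1) (B 0 0) (B 1 0).
have := cauchy_schwarz2 (A 1 0) (A 1 1) (B 0 1) (B 1 1).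
lra.
Qed.

Lemma frob2_tr A : frob2 A^T = frob2 A.
Proof. by rewrite /frob2 !mxE; ring. Qed.

Lemma frob2_det A : 2 * `|\det A| <= frob2 A.
Proof.
rewrite det2 /frob2; case: ger0P => _.
  have := sqr_ge0 (A 0 0 - A 1 1); have := sqr_ge0 (A 0 1 + A 1 0).
  rewrite sqrrB sqrrD; lra.
have := sqr_ge0 (A 0 0 + A 1 1); have := sqr_ge0 (A 0 1 - A 1 0).
rewrite sqrrB sqrrD; lra.
Qed.

Lemma frob2_gt0 A : A \in unitmx -> 0 < frob2 A.
Proof.
rewrite unitmxE unitfE => A0; apply: lt_le_trans (frob2_det A).
by rewrite mulr_gt0// normr_gt0.
Qed.

(** ** Singular values *)

(** The eigenvalues of [A^T *m A] have sum [frob2 A] and product [\det A ^+ 2];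
    this is the discriminant of their quadratic equation. *)
Lemma frob2_disc A : 0 <= frob2 A ^+ 2 - 4 * \det A ^+ 2.
Proof.
have -> : frob2 A ^+ 2 - 4 * \det A ^+ 2 =
   (frob2 A - 2 * \det A) * (frob2 A + 2 * \det A) by ring.
have := frob2_det A; have := ler_norm (\det A); have := ler_norm (- \det A).
by rewrite normrN => *; apply: mulr_ge0; lra.
Qed.

Definition eigen_hi A : R := (frob2 A + Num.sqrt (frob2 A ^+ 2 - 4 * \det A ^+ 2)) / 2.
Definition eigen_lo A : R := (frob2 A - Num.sqrt (frob2 A ^+ 2 - 4 * \det A ^+ 2)) / 2.

Lemma eigen_loM A : eigen_hi A * eigen_lo A = \det A ^+ 2.
Proof.
rewrite /eigen_hi /eigen_lo; set d := Num.sqrt _.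
have : d ^+ 2 = frob2 A ^+ 2 - 4 * \det A ^+ 2 by rewrite sqr_sqrtr// frob2_disc.
set t := frob2 A; set D := \det A => H.
have -> : (t + d) / 2 * ((t - d) / 2) = (t ^+ 2 - d ^+ 2) / 4 by field.
by rewrite H; field.
Qed.

Lemma eigen_lo_hi A : 0 <= eigen_lo A <= eigen_hi A.
Proof.
rewrite /eigen_lo /eigen_hi; set d := Num.sqrt _.
have d0 : 0 <= d by exact: sqrtr_ge0.
have dt : d <= frob2 A.
  rewrite -[leRHS]ger0_norm ?frob2_ge0// -sqrtr_sqr ler_wsqrtr// gerBl.
  by rewrite mulr_ge0// sqr_ge0.
apply/andP; split; lra.
Qed.

Lemma eigenvalue_gram A l :
  eigenvalue (A^T *m A) l = (l == eigen_hi A) || (l == eigen_lo A).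
Proof.
rewrite /eigenvalue /eigenspace kermx_eq0 row_free_unit unitmxE unitfE negbK.
rewrite -!(subr_eq0 l) -mulf_eq0.
have -> : (l - eigen_hi A) * (l - eigen_lo A) =
   l ^+ 2 - (eigen_hi A + eigen_lo A) * l + eigen_hi A * eigen_lo A by ring.
rewrite eigen_loM; have -> : eigen_hi A + eigen_lo A = frob2 A.
  by rewrite /eigen_hi /eigen_lo; field.
congr (_ == 0); rewrite !det2 !mxE !sum2 !mxE /= /frob2; ring.
Qed.

Lemma sing_valsE A : sing_vals A = [set Num.sqrt (eigen_lo A); Num.sqrt (eigen_hi A)].
Proof.
apply/seteqP; split=> x /=.
  by move=> [l]; rewrite /= eigenvalue_gram => /orP[]/eqP-> <-; [right|left].
by case=> ->; [exists (eigen_lo A)|exists (eigen_hi A)] => //=;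
  rewrite eigenvalue_gram eqxx ?orbT.
Qed.

Lemma alpha1E A : alpha1 A = Num.sqrt (eigen_hi A).
Proof.
have /andP[_ lh] := eigen_lo_hi A.
have ub : ubound (sing_vals A) (Num.sqrt (eigen_hi A)).
  by rewrite sing_valsE => x [->|->] //; exact: ler_wsqrtr.
have mem : sing_vals A (Num.sqrt (eigen_hi A)) by rewrite sing_valsE; right.
apply/eqP; rewrite eq_le; apply/andP; split.
  by apply: ge_sup => //; exists (Num.sqrt (eigen_hi A)).
by apply: ub_le_sup => //; exists (Num.sqrt (eigen_hi A)).
Qed.

Lemma alpha2E A : alpha2 A = Num.sqrt (eigen_lo A).
Proof.
have /andP[_ lh] := eigen_lo_hi A.
have lb : lbound (sing_vals A) (Num.sqrt (eigen_lo A)).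
  by rewrite sing_valsE => x [->|->] //; exact: ler_wsqrtr.
have mem : sing_vals A (Num.sqrt (eigen_lo A)) by rewrite sing_valsE; left.
apply/eqP; rewrite eq_le; apply/andP; split.
  by apply: ge_inf => //; exists (Num.sqrt (eigen_lo A)).
by apply: lb_le_inf => //; exists (Num.sqrt (eigen_lo A)).
Qed.

Lemma alpha12 A : alpha1 A * alpha2 A = `|\det A|.
Proof.
have /andP[l0 lh] := eigen_lo_hi A.
rewrite alpha1E alpha2E -sqrtrM ?(le_trans l0)// eigen_loM.
by rewrite sqrtr_sqr.
Qed.

Lemma alpha1_sqr_bounds A : frob2 A / 2 <= alpha1 A ^+ 2 <= frob2 A.
Proof.
have /andP[l0 lh] := eigen_lo_hi A.
rewrite alpha1E sqr_sqrtr ?(le_trans l0)//.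
have : eigen_hi A + eigen_lo A = frob2 A.
  by rewrite /eigen_hi /eigen_lo; field.
by move=> H; apply/andP; split; lra.
Qed.

Lemma alpha1_singular A : \det A = 0 -> alpha1 A = Num.sqrt (frob2 A) /\ alpha2 A = 0.
Proof.
move=> A0; rewrite alpha1E alpha2E /eigen_hi /eigen_lo A0 expr0n /= mulr0 subr0.
rewrite sqrtr_sqr ger0_norm ?frob2_ge0// subrr mul0r sqrtr0; split=> //.
by congr Num.sqrt; field.
Qed.

Lemma opnorm_ge A v : enorm (A *m v) <= opnorm A * enorm v.
Proof.
have [->|v0] := eqVneq v 0.
  by rewrite mulmx0 !enormE /sqn !mxE expr0n addr0 sqrtr0 mulr0.
have nv0 : 0 < enorm v by rewrite enorm_gt0.
rewrite -ler_pdivrMr//.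
have -> : enorm (A *m v) / enorm v = enorm (A *m ((enorm v)^-1 *: v)).
  by rewrite -scalemxAr enormZ ger0_norm ?invr_ge0 ?ltW// mulrC.
apply: ub_le_sup.
  exists (Num.sqrt (frob2 A)) => _ [u /= u1 <-].
  by apply: le_trans (enorm_mulmx A u) _; rewrite ler_piMr// sqrtr_ge0.
exists ((enorm v)^-1 *: v) => //=.
rewrite enormZ ger0_norm; last by rewrite invr_ge0 ltW.
by rewrite mulVf// gt_eqF.
Qed.

(** A matrix and its transpose have the same norm:
    [|A^T v|^2 = <v, A A^T v> <= |v| |A (A^T v)|]. *)
Lemma enorm_tr_mulmx A v : enorm (A^T *m v) <= opnorm A * enorm v.
Proof.
have [->|] := eqVneq (A^T *m v) 0.
  rewrite [X in X <= _](_ : _ = 0); last by apply/eqP; rewrite enorm_eq0.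
  have := opnorm_ge A v; apply: le_trans; exact: enorm_ge0.
rewrite -enorm_gt0 => n0.
rewrite -(ler_pM2l n0) -expr2 sqr_enorm.
apply: (@le_trans _ _ (enorm v * enorm (A *m (A^T *m v)))).
  have -> : sqn (A^T *m v) =
      v 0 0 * (A *m (A^T *m v)) 0 0 + v 1 0 * (A *m (A^T *m v)) 1 0.
    by rewrite !mulmx2 /sqn !mulmx2 !mxE; ring.
  apply: le_trans (ler_norm _) _; rewrite -sqrtr_sqr !enormE -sqrtrM ?sqn_ge0//.
  by rewrite ler_wsqrtr// cauchy_schwarz2.
rewrite mulrCA mulrC mulrA; apply: (@le_trans _ _ (opnorm A * enorm (A^T *m v) * enorm v)).
  by rewrite ler_wpM2r ?enorm_ge0// opnorm_ge.
by rewrite le_eqVlt; apply/orP; left; apply/eqP; ring.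
Qed.

End plane.

(** * Linear growth of sequences *)
Section linear_growth.
Variable R : realType.
Implicit Types (u v : nat -> R).

Lemma cvg_linear_near u (L e : R) : (fun n => n%:R^-1 * u n) @ \oo --> L -> 0 < e ->
  \forall n \near \oo, (L - e) * n%:R <= u n <= (L + e) * n%:R.
Proof.
move=> /cvgrPdist_le H e0; have [N _ HN] := H e e0.
exists N.+1 => // n /= Nn; have := HN n (ltnW Nn).
have n0 : 0 < n%:R :> R by rewrite ltr0n (leq_trans _ Nn).
rewrite ler_norml lerBlDr lerBrDl => /andP[lo hi].
apply/andP; split.
  by rewrite -ler_pdivlMr// mulrC lerBlDl.
by rewrite -ler_pdivrMr// mulrC -lerBlDr.
Qed.

Lemma near_linear_cvg u (L : R) :
  (forall e, 0 < e -> \forall n \near \oo, (L - e) * n%:R <= u n <= (L + e) * n%:R) ->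
  (fun n => n%:R^-1 * u n) @ \oo --> L.
Proof.
move=> H; apply: cvg_linear_bounds => k;
  have := H k.+1%:R^-1 (ltac:(by rewrite invr_gt0));
  by apply: filterS => n /andP[].
Qed.

Lemma cvg_linear_perturb u v (C L : R) :
  (\forall n \near \oo, `|u n - v n| <= C) ->
  (fun n => n%:R^-1 * v n) @ \oo --> L -> (fun n => n%:R^-1 * u n) @ \oo --> L.
Proof.
move=> uv vL; apply: near_linear_cvg => e e0.
have e20 : 0 < e / 2 by rewrite divr_gt0.
apply: filterS3 uv (cvg_linear_near vL e20) (near_linear_ge C e20) => n.
by rewrite ler_norml => /andP[? ?] /andP[? ?] ?; apply/andP; split; lra.
Qed.

End linear_growth.

(** * Growth of vectors under products of plane matrices *)

Section dichotomy.
Variable R : realType.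
Implicit Types (A B : 'M[R]_2) (x y v w : 'cV[R]_2).

(** The determinant of the pair [x, y], i.e. the area that it spans. *)
Definition cross x y : R := x 0 0 * y 1 0 - x 1 0 * y 0 0.

Lemma cross_sqr x y :
  cross x y ^+ 2 = sqn x * sqn y - (x 0 0 * y 0 0 + x 1 0 * y 1 0) ^+ 2.
Proof. by rewrite /cross /sqn; ring. Qed.

Lemma cross_le x y : `|cross x y| <= enorm x * enorm y.
Proof.
rewrite -sqrtr_sqr !enormE -sqrtrM ?sqn_ge0// ler_wsqrtr// cross_sqr gerBl.
exact: sqr_ge0.
Qed.

Lemma cross_mulmx A x y : cross (A *m x) (A *m y) = \det A * cross x y.
Proof. by rewrite /cross !mulmx2 det2; ring. Qed.

(** On almost parallel vectors [x] and [y] the map [A] scales by almost the same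
    factor: after both are rescaled to the same length, and [y] replaced by [- y]
    if the angle is obtuse, their difference is of the order of the sine of the
    angle. *)
Lemma enorm_ratio_step A x y :
  `|enorm (A *m x) * enorm y - enorm (A *m y) * enorm x| <=
  Num.sqrt (frob2 A * 2) * `|cross x y|.
Proof.
pose dot := x 0 0 * y 0 0 + x 1 0 * y 1 0.
have dot_le : `|dot| <= enorm x * enorm y.
  rewrite -sqrtr_sqr !enormE -sqrtrM ?sqn_ge0// ler_wsqrtr//.
  exact: cauchy_schwarz2.
have aux (s : R) : s ^+ 2 = 1 -> 0 <= s * dot ->
    `|enorm (A *m x) * enorm y - enorm (A *m y) * enorm x| <=
    Num.sqrt (frob2 A * 2) * `|cross x y|.
  move=> s2 sd.
  (* [s] is the sign of the scalar product. *)
  pose x' := enorm y *: x; pose y' := (s * enorm x) *: y.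
  have s1 : `|s| = 1.
    by apply/eqP; rewrite -(eqrXn2 (n := 2))// -normrX s2 normr1 expr1n.
  have -> : enorm (A *m x) * enorm y = enorm (A *m x').
    by rewrite /x' -scalemxAr enormZ ger0_norm ?enorm_ge0// mulrC.
  have -> : enorm (A *m y) * enorm x = enorm (A *m y').
    rewrite /y' -scalemxAr enormZ normrM s1 mul1r.
    by rewrite ger0_norm ?enorm_ge0// mulrC.
  have tri : `|enorm (A *m x') - enorm (A *m y')| <= enorm (A *m (x' - y')).
    have := enormD (A *m (x' - y')) (A *m y'); have := enormD (A *m (y' - x')) (A *m x').
    rewrite -!mulmxDr !subrK -opprB mulmxN enormN => *.
    by rewrite ler_norml; apply/andP; split; lra.
  apply: le_trans tri _; apply: le_trans (enorm_mulmx _ _) _.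
  rewrite sqrtrM ?frob2_ge0// -mulrA ler_wpM2l ?sqrtr_ge0//.
  rewrite -sqrtr_sqr -sqrtrM// enormE ler_wsqrtr//.
  have -> : sqn (x' - y') = 2 * (enorm x ^+ 2 * enorm y ^+ 2 - (enorm x * enorm y) * (s * dot)).
    have -> : sqn (x' - y') = enorm y ^+ 2 * sqn x + s ^+ 2 * enorm x ^+ 2 * sqn y
        - 2 * (s * (enorm x * enorm y) * dot).
      by rewrite /x' /y' /sqn /dot !mxE; ring.
    by rewrite s2 !sqr_enorm; ring.
  rewrite ler_pM2l// cross_sqr -!sqr_enorm -/dot.
  have sde : s * dot <= enorm x * enorm y.
    by apply: le_trans (ler_norm _) _; rewrite normrM s1 mul1r.
  have -> : dot ^+ 2 = (s * dot) * (s * dot) by rewrite -expr2 exprMn s2 mul1r.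
  by have := ler_wpM2r sd sde; lra.
have [d0|d0] := leP 0 dot.
  by apply: (aux 1); rewrite ?expr1n ?mul1r.
by apply: (aux (- 1)); rewrite ?sqrrN ?expr1n// mulN1r oppr_ge0 ltW.
Qed.

(** The Frobenius norm of the matrix with columns [x] and [y]. *)
Definition pair_norm x y : R := Num.sqrt (sqn x + sqn y).

Lemma pair_norm_ge x y : enorm x <= pair_norm x y /\ enorm y <= pair_norm x y.
Proof.
by rewrite !enormE /pair_norm; split; rewrite ler_wsqrtr// (lerDl, lerDr) sqn_ge0.
Qed.

Lemma pair_norm_ratio A x y :
  `|enorm (A *m x) * pair_norm x y - enorm x * pair_norm (A *m x) (A *m y)| <=
  Num.sqrt (frob2 A * 2) * `|cross x y|.
Proof.
apply: le_trans (enorm_ratio_step A x y).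
set a := enorm x; set b := enorm y; set a' := enorm (A *m x); set b' := enorm (A *m y).
set M := pair_norm x y; set M' := pair_norm _ _.
have [aM bM] := pair_norm_ge x y; have [aM' bM'] := pair_norm_ge (A *m x) (A *m y).
have a0 : 0 <= a by exact: enorm_ge0.
have a0' : 0 <= a' by exact: enorm_ge0.
have M0 : 0 <= M by exact: sqrtr_ge0.
have M0' : 0 <= M' by exact: sqrtr_ge0.
have E : (a' * M - a * M') * (a' * M + a * M') = (a' * b - b' * a) * (a' * b + b' * a).
  have M2 : M ^+ 2 = a ^+ 2 + b ^+ 2.
    by rewrite /a /b !sqr_enorm /M /pair_norm sqr_sqrtr// addr_ge0// sqn_ge0.
  have M2' : M' ^+ 2 = a' ^+ 2 + b' ^+ 2.
    by rewrite /a' /b' !sqr_enorm /M' /pair_norm sqr_sqrtr// addr_ge0// sqn_ge0.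
  have -> : (a' * M - a * M') * (a' * M + a * M') = a' ^+ 2 * M ^+ 2 - a ^+ 2 * M' ^+ 2 by ring.
  by rewrite M2 M2'; ring.
have S0 : 0 <= a' * M + a * M' by rewrite addr_ge0// mulr_ge0.
have [S|] := eqVneq (a' * M + a * M') 0.
  have : a' * M == 0 /\ a * M' == 0.
    by apply/andP; rewrite -paddr_eq0 ?mulr_ge0// S.
  by move=> [/eqP-> /eqP->]; rewrite subrr normr0.
move=> Sn; have Sp : 0 < a' * M + a * M' by rewrite lt_def Sn.
rewrite -(ler_pM2r Sp) -[X in _ * X <= _]ger0_norm// -normrM E normrM.
rewrite ler_wpM2l// ger0_norm; last by rewrite addr_ge0// mulr_ge0// enorm_ge0.
by rewrite (mulrC b'); apply: lerD; exact: ler_wpM2l.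
Qed.

Lemma pair_norm_gt0 x y : cross x y != 0 -> 0 < enorm x /\ 0 < pair_norm x y.
Proof.
rewrite -normr_gt0 => xy0.
have x0 : 0 < enorm x.
  rewrite lt_def enorm_ge0 andbT; apply/negP => /eqP xn0.
  by have := cross_le x y; rewrite xn0 mul0r leNgt xy0.
by split=> //; apply: lt_le_trans x0 (pair_norm_ge _ _).1.
Qed.

Lemma ln_enorm_bounds x y : cross x y != 0 ->
  ln `|cross x y| - ln (pair_norm x y) <= ln (enorm x) <= ln (pair_norm x y).
Proof.
move=> xy0; have [x0 M0] := pair_norm_gt0 xy0.
have [xM yM] := pair_norm_ge x y.
apply/andP; split; last by rewrite ler_ln ?posrE.
rewrite lerBlDr -lnM ?posrE// ler_ln ?posrE ?mulr_gt0 ?normr_gt0//.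
by apply: le_trans (cross_le _ _) _; rewrite ler_wpM2l ?enorm_ge0.
Qed.

(** Here the area grows as fast as the square of the norm allows, so neither of
    the two vectors can lag behind. *)
Lemma growth_equal (x y : nat -> 'cV[R]_2) (L : R) :
  (forall n, cross (x n) (y n) != 0) ->
  (fun n => n%:R^-1 * ln (pair_norm (x n) (y n))) @ \oo --> L ->
  (fun n => n%:R^-1 * ln `|cross (x n) (y n)|) @ \oo --> L + L ->
  (fun n => n%:R^-1 * ln (enorm (x n))) @ \oo --> L.
Proof.
move=> xy0 ML XL; apply: near_linear_cvg => e e0.
have e20 : 0 < e / 2 by rewrite divr_gt0.
apply: filterS2 (cvg_linear_near ML e20) (cvg_linear_near XL e20) => n.
move=> /andP[_ Mhi] /andP[Xlo _]; have /andP[lo hi] := ln_enorm_bounds (xy0 n).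
have : 0 <= e * n%:R by rewrite mulr_ge0 ?(ltW e0).
by move=> en; apply/andP; split; lra.
Qed.

(** By [pair_norm_ratio] the proportion [enorm (x n) / pair_norm (x n) (y n)]
    changes at step [n] by an amount of the order of [expR ((d - (L + L)) * n)]. So
    it converges. If the limit is positive, [x n] grows at the rate [L] of the
    matrices. If the limit is zero, then the proportion is bounded by the tail of
    a geometric series, so [x n] grows at most at the rate [d - L]; it cannot grow
    more slowly because the area does not exceed the product of the two norms. *)
Lemma growth_dichotomy (A : nat -> 'M[R]_2) (x y : nat -> 'cV[R]_2) (c L d : R) :
  (forall n, x n.+1 = A n *m x n) -> (forall n, y n.+1 = A n *m y n) ->
  (forall n, frob2 (A n) <= c) -> (forall n, cross (x n) (y n) != 0) ->
  (fun n => n%:R^-1 * ln (pair_norm (x n) (y n))) @ \oo --> L ->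
  (fun n => n%:R^-1 * ln `|cross (x n) (y n)|) @ \oo --> d ->
  d < L + L ->
  (fun n => n%:R^-1 * ln (enorm (x n))) @ \oo --> L \/
  (fun n => n%:R^-1 * ln (enorm (x n))) @ \oo --> d - L.
Proof.
move=> xS yS Ac xy0 ML Xd dL.
have c0 : 0 <= c by apply: le_trans (Ac 0%N); exact: frob2_ge0.
pose M n := pair_norm (x n) (y n).
pose X n := `|cross (x n) (y n)|.
pose t n := enorm (x n) / M n.
have X0 n : 0 < X n by rewrite normr_gt0.
have x0 n : 0 < enorm (x n) by have [] := pair_norm_gt0 (xy0 n).
have M0 n : 0 < M n by have [] := pair_norm_gt0 (xy0 n).
have t0 n : 0 < t n by rewrite divr_gt0.
have t1 n : t n <= 1 by rewrite ler_pdivrMr// mul1r (pair_norm_ge _ _).1.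
have tS n : `|t n.+1 - t n| <= Num.sqrt (c * 2) * X n / (M n * M n.+1).
  have -> : t n.+1 - t n = (enorm (x n.+1) * M n - enorm (x n) * M n.+1) / (M n * M n.+1).
    by rewrite /t; field; rewrite !gt_eqF.
  rewrite normrM [X in _ * X <= _]ger0_norm; last by rewrite invr_ge0 mulr_ge0 ?ltW.
  rewrite ler_wpM2r ?invr_ge0 ?mulr_ge0 ?(ltW (M0 _))//.
  rewrite /M xS yS; apply: le_trans (pair_norm_ratio _ _ _) _.
  by rewrite ler_wpM2r// ler_wsqrtr// ler_wpM2r.
have lnx n : ln (enorm (x n)) = ln (t n) + ln (M n).
  by rewrite -lnM ?posrE// /t divfK// gt_eqF.
have xlo e : 0 < e -> \forall n \near \oo, (d - L - e) * n%:R <= ln (enorm (x n)).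
  move=> e0; have e20 : 0 < e / 2 by rewrite divr_gt0.
  apply: filterS2 (cvg_linear_near ML e20) (cvg_linear_near Xd e20) => n.
  move=> /andP[_ Mhi] /andP[Xlo _].
  by have /andP[lo _] := ln_enorm_bounds (xy0 n); lra.
(* The tails [T n] of the geometric series decide between the two cases: once
   [t n] exceeds [T n], it stays bounded away from zero. *)
have alt e : 0 < e -> d - (L + L) + 3 * e < 0 ->
    (exists2 eta, 0 < eta & \forall n \near \oo, eta <= t n) \/
    (exists K, \forall n \near \oo, ln (t n) <= K + (d - (L + L) + 3 * e) * n%:R).
  move=> e0 ez; set r := d - (L + L) + 3 * e in ez *.
  pose z := expR r; have z0 : 0 < z by exact: expR_gt0.
  have z1 : z < 1 by rewrite expR_lt1.
  pose K0 := Num.sqrt (c * 2) * expR (e - L).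
  have K00 : 0 <= K0 by rewrite mulr_ge0 ?sqrtr_ge0// expR_ge0.
  have [N1 _ H1] := cvg_linear_near ML e0; have [N2 _ H2] := cvg_linear_near Xd e0.
  pose N := maxn N1 N2.
  have step n : (N <= n)%N -> `|t n.+1 - t n| <= K0 * z ^+ n.
    rewrite geq_max => /andP[n1 n2]; apply: le_trans (tS n) _.
    rewrite -!mulrA ler_wpM2l ?sqrtr_ge0// -expRM_natr -expRD.
    rewrite ler_pdivrMr ?mulr_gt0// -ler_ln ?posrE ?mulr_gt0 ?expR_gt0//.
    rewrite !lnM ?posrE ?mulr_gt0 ?expR_gt0// expRK.
    have /andP[M1 _] := H1 n n1; have /andP[M2 _] := H1 n.+1 (leqW n1).
    have /andP[_ X2] := H2 n n2; move: M1 M2 X2; rewrite /= -natr1 -/(M n) -/(M n.+1) -/(X n) /r.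
    lra.
  pose T n := K0 * z ^+ n / (1 - z).
  have z1' : 0 < 1 - z by rewrite subr_gt0.
  have TS n : T n.+1 = T n - K0 * z ^+ n.
    by rewrite /T exprS; field; rewrite gt_eqF.
  have T0 n : 0 <= T n by rewrite divr_ge0 ?mulr_ge0 ?exprn_ge0// ltW.
  have tT n k : (N <= n)%N -> t n - T n + T (n + k)%N <= t (n + k)%N.
    move=> Nn; elim: k => [|k IH]; first by rewrite addn0 subrK.
    have := step (n + k)%N (leq_trans Nn (leq_addr _ _)).
    rewrite addnS TS ler_norml => /andP[lo _]; move: IH lo; lra.
  have [[n Nn tn]|H] := pselect (exists2 n, (N <= n)%N & T n < t n).
    left; exists (t n - T n); first by rewrite subr_gt0.
    exists n => // k /= nk; have := tT n (k - n)%N Nn; rewrite subnKC//.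
    by have := T0 k; lra.
  right; exists (ln ((K0 + 1) / (1 - z))); exists N => // n /= Nn.
  have tn : t n <= T n by rewrite leNgt; apply/negP => tn; apply: H; exists n.
  have K1 : 0 < K0 + 1 by rewrite ltr_wpDl.
  rewrite -[r * _]expRK expRM_natr -/z -lnM ?posrE ?divr_gt0 ?exprn_gt0//.
  rewrite ler_ln ?posrE//; last by rewrite mulr_gt0 ?divr_gt0 ?exprn_gt0.
  apply: le_trans tn _; rewrite /T mulrAC; apply: ler_wpM2r.
    by rewrite exprn_ge0// ltW.
  by rewrite ler_pM2r ?invr_gt0// lerDl.
have [[eta eta0 teta]|nA] :=
    pselect (exists2 eta, 0 < eta & \forall n \near \oo, eta <= t n).
  left; apply: (cvg_linear_perturb (C := `|ln eta|) (v := fun n => ln (M n))) => //.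
  apply: filterS teta => n etan; rewrite lnx addrK.
  have h1 : ln eta <= ln (t n) by rewrite ler_ln ?posrE// (lt_le_trans eta0).
  have h2 : ln (t n) <= 0 by rewrite ln_le0.
  by rewrite !ler0_norm ?lerN2// (le_trans h1).
right; apply: near_linear_cvg => e e0.
pose e1 := Num.min (e / 8) ((L + L - d) / 8).
have e10 : 0 < e1 by rewrite lt_min !divr_gt0// subr_gt0.
have e1e : e1 <= e / 8 by rewrite ge_min lexx.
have e1d : e1 <= (L + L - d) / 8 by rewrite ge_min lexx orbT.
have neg : d - (L + L) + 3 * e1 < 0 by move: e1d dL; lra.
have [//|[K HK]] := alt _ e10 neg.
apply: filterS3 HK (filterI (xlo e e0) (cvg_linear_near ML e10)) (near_linear_ge K e10) => n.
move=> tn [-> /andP[_ Mhi]] Kn; rewrite lnx /=.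
have en : e1 * n%:R <= e / 8 * n%:R by rewrite ler_wpM2r.
have en0 : 0 <= e * n%:R by rewrite mulr_ge0 ?(ltW e0).
by move: tn Mhi Kn en; rewrite -/(M n); lra.
Qed.

End dichotomy.

(** * Matrix cocycles *)
Lemma Rintegral_dist d (X : measurableType d) (R : realType)
    (mu : probability X R) (f g : X -> R) (C : R) :
  mu.-integrable setT (EFin \o f) -> mu.-integrable setT (EFin \o g) ->
  (forall x, `|f x - g x| <= C) -> `|\int[mu]_x f x - \int[mu]_x g x| <= C.
Proof.
move=> If Ig fg.
have Ic : mu.-integrable setT (EFin \o (fun=> C)).
  by apply: (@bounded_integrable _ _ _ _ _ `|C|) => //; exact: measurable_cst.
have IgC : mu.-integrable setT (EFin \o (fun x => g x + C)) by exact: (integrableD measurableT Ig Ic).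
have IfC : mu.-integrable setT (EFin \o (fun x => f x + C)) by exact: (integrableD measurableT If Ic).
rewrite ler_norml; apply/andP; split.
  have : \int[mu]_x g x <= \int[mu]_x (f x + C).
    apply: le_Rintegral => // x _; have := fg x; rewrite ler_norml => /andP[]; lra.
  by rewrite RintegralD// Rintegral_cst1; lra.
have : \int[mu]_x f x <= \int[mu]_x (g x + C).
  apply: le_Rintegral => // x _; have := fg x; rewrite ler_norml => /andP[]; lra.
by rewrite RintegralD// Rintegral_cst1; lra.
Qed.

Section cocycle.
Variables (R : realType) (m : nat) (T : 'I_m.+1 -> 'M[R]_2).
Hypothesis T_inv : forall i, T i \in unitmx.
Implicit Types (x : Shift m) (u w : seq 'I_m.+1) (v : 'cV[R]_2).
Local Notation shift := (@left_shift m).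

Definition word_mx w : 'M[R]_2 := \prod_(a <- w) T a.

Lemma mxwordE x n : mxword T x n = word_mx (word n x).
Proof.
rewrite /mxword /word_mx /word /mkseq big_map -(big_mkord xpredT (fun i => T (x i))).
by rewrite /index_iota subn0.
Qed.

Lemma word_mx_unit w : word_mx w \in unitmx.
Proof.
rewrite /word_mx; elim: w => [|a w IH]; first by rewrite big_nil unitmx1.
by rewrite big_cons -mulmxE unitmx_mul T_inv.
Qed.

Lemma mxword_unit x n : mxword T x n \in unitmx.
Proof. by rewrite mxwordE word_mx_unit. Qed.

Lemma det_mxword_neq0 x n : \det (mxword T x n) != 0.
Proof. by have := mxword_unit x n; rewrite unitmxE unitfE. Qed.

Lemma mxword_recr x n : mxword T x n.+1 = mxword T x n *m T (x n).
Proof. by rewrite /mxword big_ord_recr. Qed.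

Lemma mxwordD x l n : mxword T x (l + n) = mxword T x l *m mxword T (iter l shift x) n.
Proof. by rewrite !mxwordE wordD /word_mx big_cat. Qed.

Lemma mxword_recl x n : mxword T x n.+1 = T (x 0%N) *m mxword T (shift x) n.
Proof. by rewrite !mxwordE wordS /word_mx big_cons. Qed.

Lemma mxword_tr_recr x n v :
  (mxword T x n.+1)^T *m v = (T (x n))^T *m ((mxword T x n)^T *m v).
Proof. by rewrite mxword_recr trmx_mul mulmxA. Qed.

Lemma mxword_tr_recl x n v :
  (mxword T x n.+1)^T *m v = (mxword T (shift x) n)^T *m ((T (x 0%N))^T *m v).
Proof. by rewrite mxword_recl trmx_mul mulmxA. Qed.

(** The Frobenius norm is comparable with [alpha1] and submultiplicative, and its
    square is a polynomial. *)
Definition ln_frob n x : R := ln (frob2 (mxword T x n)) / 2.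

Lemma ln_frob_subadd l n x :
  ln_frob (l + n) x <= ln_frob l x + ln_frob n (iter l shift x).
Proof.
rewrite /ln_frob -mulrDl ler_pM2r ?invr_gt0// mxwordD.
have p1 := frob2_gt0 (mxword_unit x l).
have p2 := frob2_gt0 (mxword_unit (iter l shift x) n).
rewrite -lnM ?posrE// ler_ln ?posrE ?mulr_gt0 ?frob2M//.
by apply: frob2_gt0; rewrite unitmx_mul !mxword_unit.
Qed.

Definition ln_det x : R := ln `|\det (T (x 0%N))|.

Lemma ln_det_mxword n x : ln `|\det (mxword T x n)| = ergodic_sum shift ln_det n x.
Proof.
elim: n x => [|n IH] x.
  by rewrite /mxword /ergodic_sum !big_ord0 det1 normr1 ln1.
rewrite ergodic_sumS mxword_recl det_mulmx normrM lnM ?posrE ?normr_gt0 ?det_mxword_neq0//.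
  by rewrite IH.
by have := T_inv (x 0%N); rewrite unitmxE unitfE.
Qed.

Lemma ln_frob_ge n x : ergodic_sum shift ln_det n x / 2 <= ln_frob n x.
Proof.
rewrite -ln_det_mxword /ln_frob ler_pM2r ?invr_gt0//.
have d0 : 0 < `|\det (mxword T x n)| by rewrite normr_gt0 det_mxword_neq0.
rewrite ler_ln ?posrE ?frob2_gt0 ?mxword_unit//.
by have := frob2_det (mxword T x n); lra.
Qed.

Lemma letter_fun_word (phi : 'I_m.+1 -> R) :
  (fun x => phi (x 0%N)) = (fun x => phi (nth ord0 (word 1 x) 0)).
Proof. by apply/funext => x. Qed.

Lemma measurable_letter (phi : 'I_m.+1 -> R) :
  measurable_fun setT (fun x => phi (x 0%N)).
Proof.
by rewrite letter_fun_word; exact: (measurable_word_fun 1 (fun w => phi (nth ord0 w 0))).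
Qed.

Lemma letter_bound (phi : 'I_m.+1 -> R) x : `|phi (x 0%N)| <= \sum_a `|phi a|.
Proof. by rewrite (bigD1 (x 0%N : 'I_m.+1)) //= lerDl sumr_ge0. Qed.

Variable mu : probability (Shift m) R.
Hypothesis erg : ergodic_measure shift mu.
Let mf := measurable_left_shift (m := m).
Let inv : invariant_measure shift mu := erg.1.
Local Notation Lyap1 := (Lyap1 mu T).
Local Notation Lyap2 := (Lyap2 mu T).

Lemma integral_letter (phi : 'I_m.+1 -> R) :
  \int[mu]_x phi (x 0%N) = \sum_a phi a * fine (mu (cylinder1 a)).
Proof.
exact: (integral_label mu (@measurable_cylinder1 m) phi).
Qed.

Lemma birkhoff_letter (phi : 'I_m.+1 -> R) :
  \forall x \ae mu, (fun n => n%:R^-1 * ergodic_sum shift (fun x => phi (x 0%N)) n x) @ \oo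
    --> \sum_a phi a * fine (mu (cylinder1 a)).
Proof.
rewrite -integral_letter.
exact: (birkhoff mf erg (measurable_letter phi) (letter_bound phi)).
Qed.

Lemma integrable_word n (phi : seq 'I_m.+1 -> R) :
  mu.-integrable setT (EFin \o (fun x => phi (word n x))).
Proof.
have [b Hb] := word_bound n phi.
exact: bounded_integrable (measurable_word_fun n phi) Hb.
Qed.

Lemma mxword_fun n (phi : 'M[R]_2 -> R) :
  (fun x => phi (mxword T x n)) = (fun x => phi (word_mx (word n x))).
Proof. by apply/funext => x; rewrite mxwordE. Qed.

Lemma integrable_mxword n (phi : 'M[R]_2 -> R) :
  mu.-integrable setT (EFin \o (fun x => phi (mxword T x n))).
Proof. by rewrite mxword_fun; exact: (integrable_word n (fun w => phi (word_mx w))). Qed.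

Lemma measurable_mxword n (phi : 'M[R]_2 -> R) :
  measurable_fun setT (fun x => phi (mxword T x n)).
Proof. by rewrite mxword_fun; exact: (measurable_word_fun n (fun w => phi (word_mx w))). Qed.

Definition det_exponent : R := \sum_a ln `|\det (T a)| * fine (mu (cylinder1 a)).

Lemma integral_ln_det n :
  \int[mu]_x ln `|\det (mxword T x n)| = n%:R * det_exponent.
Proof.
under eq_Rintegral do rewrite ln_det_mxword.
pose phi a := ln `|\det (T a)|.
have E := Rintegral_ergodic_sum mf inv n (measurable_letter phi) (letter_bound phi).
by rewrite [LHS]E (integral_letter phi).
Qed.

(** The lower bound that Kingman's theorem asks for comes from the determinant,
    since the letters are finitely many invertible matrices. *)
Lemma ln_frob_kingman : exists L : R,
  (\forall x \ae mu, (fun n => n%:R^-1 * ln_frob n x) @ \oo --> L) /\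
  (fun n => n%:R^-1 * \int[mu]_x ln_frob n x) @ \oo --> L.
Proof.
pose C := \sum_a (`|ln (frob2 (T a))| + `|ln `|\det (T a)| |) + `|ln 2|.
apply: (kingman mf erg (C := C)).
- by move=> n; exact: (measurable_mxword n (fun A => ln (frob2 A) / 2)).
- move=> n x; apply/andP; split.
    apply: le_trans (ln_frob_ge n x).
    have := @ergodic_sum_bound _ _ _ shift ln_det _ n x (letter_bound (fun a => ln `|\det (T a)|)).
    set s := ergodic_sum _ _ _ _; set D := \sum_a _ => Hs.
    have DC : D <= C.
      rewrite /C big_split /= -addrA addrCA lerDl addr_ge0// sumr_ge0//.
    have D0 : 0 <= D by exact: sumr_ge0.
    have := ler_norm (- s); rewrite normrN => sn.
    have := ler_wpM2r (ler0n R n) DC.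
    have : 0 <= D * n%:R by rewrite mulr_ge0.
    lra.
  elim: n x => [|n IH] x.
    rewrite mulr0 add0r /ln_frob /mxword big_ord0 /frob2 !mxE /=.
    rewrite expr0n expr1n /= addr0 addr0 -(natrD _ 1 1).
    have : 0 <= \sum_a (`|ln (frob2 (T a))| + `|ln `|\det (T a)| |).
      by apply: sumr_ge0 => a _; exact: addr_ge0.
    have := ler_norm (ln (2 : R)); have : 0 <= `|ln (2 : R)| by [].
    by rewrite /C; lra.
  apply: le_trans (ln_frob_subadd 1 n x) _.
  have : ln_frob 1 x <= C.
    rewrite /ln_frob /mxword big_ord1 /C (bigD1 (x 0%N : 'I_m.+1)) //=.
    have : 0 <= \sum_(i | i != x 0%N) (`|ln (frob2 (T i))| + `|ln `|\det (T i)| |).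
      by apply: sumr_ge0 => a _; exact: addr_ge0.
    have := ler_norm (ln (frob2 (T (x 0%N)))); have := normr_ge0 (ln (frob2 (T (x 0%N)))).
    have := normr_ge0 (ln `|\det (T (x 0%N))|); have := normr_ge0 (ln (2 : R)).
    lra.
  by have := IH (shift x); rewrite -natr1 /=; lra.
- exact: ln_frob_subadd.
Qed.

Lemma alpha_gt0 x n : 0 < alpha1 (mxword T x n) /\ 0 < alpha2 (mxword T x n).
Proof.
have : 0 < alpha1 (mxword T x n) * alpha2 (mxword T x n).
  by rewrite alpha12 normr_gt0 det_mxword_neq0.
rewrite alpha1E alpha2E; move: (sqrtr_ge0 (eigen_hi (mxword T x n))) (sqrtr_ge0 (eigen_lo (mxword T x n))).
set a := Num.sqrt _; set b := Num.sqrt _ => a0 b0 ab; rewrite !lt_def a0 b0.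
by split; rewrite andbT; apply/eqP => e; rewrite e ?mulr0 ?mul0r ltxx in ab.
Qed.

Lemma ln_alpha1_frob x n : `|ln (alpha1 (mxword T x n)) - ln_frob n x| <= ln 2.
Proof.
have [a1 _] := alpha_gt0 x n.
have f0 := frob2_gt0 (mxword_unit x n).
have /andP[lo hi] := alpha1_sqr_bounds (mxword T x n).
have l20 : 0 <= ln (2 : R) by apply: ln_ge0; lra.
have e1 : 2 * ln (alpha1 (mxword T x n)) <= ln (frob2 (mxword T x n)).
  by rewrite mulr_natl -lnXn// ler_ln ?posrE ?exprn_gt0.
have e2 : ln (frob2 (mxword T x n)) - ln 2 <= 2 * ln (alpha1 (mxword T x n)).
  by rewrite mulr_natl -lnXn// -ln_div ?posrE// ler_ln ?posrE ?divr_gt0 ?exprn_gt0.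
rewrite /ln_frob ler_norml; apply/andP; split; lra.
Qed.

Lemma ln_alpha2 x n : ln (alpha2 (mxword T x n)) =
  ln `|\det (mxword T x n)| - ln (alpha1 (mxword T x n)).
Proof.
by have [a1 a2] := alpha_gt0 x n; rewrite -alpha12 lnM ?posrE// addrC addKr.
Qed.

Lemma integral_alpha1_cvg :
  (fun n => n%:R^-1 * \int[mu]_x ln (alpha1 (mxword T x n))) @ \oo --> Lyap1.
Proof.
have [L [_ HL]] := ln_frob_kingman.
have H : (fun n => n%:R^-1 * \int[mu]_x ln (alpha1 (mxword T x n))) @ \oo --> L.
  apply: (cvg_linear_perturb (C := ln 2) _ HL); apply: nearW => n.
  apply: Rintegral_dist => [||x]; last exact: ln_alpha1_frob.
    exact: (integrable_mxword n (fun A => ln (alpha1 A))).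
  exact: (integrable_mxword n (fun A => ln (frob2 A) / 2)).
suff -> : Lyap1 = L by [].
exact: cvg_lim H.
Qed.

Lemma ae_ln_frob :
  \forall x \ae mu, (fun n => n%:R^-1 * ln_frob n x) @ \oo --> Lyap1.
Proof.
have [L [aeL HL]] := ln_frob_kingman.
suff -> : Lyap1 = L by [].
apply: cvg_lim => //; apply: (cvg_linear_perturb (C := ln 2) _ HL); apply: nearW => n.
apply: Rintegral_dist => [||x]; last exact: ln_alpha1_frob.
  exact: (integrable_mxword n (fun A => ln (alpha1 A))).
exact: (integrable_mxword n (fun A => ln (frob2 A) / 2)).
Qed.

Lemma integral_det_cvg :
  (fun n => n%:R^-1 * \int[mu]_x ln `|\det (mxword T x n)|) @ \oo --> det_exponent.
Proof.
apply: near_linear_cvg => e e0; apply: nearW => n; rewrite integral_ln_det.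
have : 0 <= e * n%:R by rewrite mulr_ge0 ?(ltW e0).
by move=> en; apply/andP; split; lra.
Qed.

Lemma integral_alpha2_cvg :
  (fun n => n%:R^-1 * \int[mu]_x ln (alpha2 (mxword T x n))) @ \oo --> Lyap2.
Proof.
have H : (fun n => n%:R^-1 * \int[mu]_x ln (alpha2 (mxword T x n))) @ \oo
    --> det_exponent - Lyap1.
  rewrite (_ : (fun n => _) = (fun n => n%:R^-1 * \int[mu]_x ln `|\det (mxword T x n)|) -
      (fun n => n%:R^-1 * \int[mu]_x ln (alpha1 (mxword T x n)))).
    exact: cvgB integral_det_cvg integral_alpha1_cvg.
  apply/funext => n; rewrite !fctE -mulrBr -RintegralB//.
  - by congr (_ * _); apply: eq_Rintegral => x _; rewrite ln_alpha2.
  - exact: (integrable_mxword n (fun A => ln `|\det A|)).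
  - exact: (integrable_mxword n (fun A => ln (alpha1 A))).
suff -> : Lyap2 = det_exponent - Lyap1 by [].
exact: cvg_lim H.
Qed.

Lemma Lyap_sum : Lyap1 + Lyap2 = det_exponent.
Proof.
apply: (cvg_unique (@Rhausdorff R) _ integral_det_cvg).
rewrite (_ : (fun n => _) = (fun n => n%:R^-1 * \int[mu]_x ln (alpha1 (mxword T x n))) +
    (fun n => n%:R^-1 * \int[mu]_x ln (alpha2 (mxword T x n)))).
  exact: cvgD integral_alpha1_cvg integral_alpha2_cvg.
apply/funext => n; rewrite !fctE -mulrDr -RintegralD//.
- by congr (_ * _); apply: eq_Rintegral => x _; rewrite ln_alpha2 subrKC.
- exact: (integrable_mxword n (fun A => ln (alpha1 A))).
- exact: (integrable_mxword n (fun A => ln (alpha2 A))).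
Qed.

Lemma ae_ln_det : \forall x \ae mu,
  (fun n => n%:R^-1 * ln `|\det (mxword T x n)|) @ \oo --> Lyap1 + Lyap2.
Proof.
rewrite Lyap_sum; apply: filterS (birkhoff_letter (fun a => ln `|\det (T a)|)) => x H.
by under eq_fun do rewrite ln_det_mxword.
Qed.

Lemma Lyap2_le1 : Lyap2 <= Lyap1.
Proof.
apply: ler_cvg_to integral_alpha2_cvg integral_alpha1_cvg _.
apply: nearW => n; rewrite ler_wpM2l ?invr_ge0//.
apply: le_Rintegral => // [||x _].
- exact: (integrable_mxword n (fun A => ln (alpha2 A))).
- exact: (integrable_mxword n (fun A => ln (alpha1 A))).
have [a1 a2] := alpha_gt0 x n; rewrite ler_ln ?posrE//.
rewrite alpha1E alpha2E ler_wsqrtr//.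
by have /andP[] := eigen_lo_hi (mxword T x n).
Qed.

(** The three regimes reduce to [ln alpha1], [ln alpha2] and
    [ln |det| = ln alpha1 + ln alpha2], of which the mean rates are known. *)
Lemma growth_svf (s : R) : growth mu T (svf s) =
  if s < 1 then s * Lyap1 else if s < 2 then Lyap1 + (s - 1) * Lyap2
  else s / 2 * (Lyap1 + Lyap2).
Proof.
apply: cvg_lim => //; case: ifP => [s1|s1].
  rewrite (_ : (fun n => _) =
      (fun n => s * (n%:R^-1 * \int[mu]_x ln (alpha1 (mxword T x n))))).
    by apply: cvgM; [exact: cvg_cst|exact: integral_alpha1_cvg].
  apply/funext => n; rewrite mulrCA; congr (_ * _); rewrite -RintegralZl//.
    by apply: eq_Rintegral => x _; rewrite /svf s1 ln_powR.
  exact: (integrable_mxword n (fun A => ln (alpha1 A))).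
case: ifP => [s2|s2].
  rewrite (_ : (fun n => _) =
      (fun n => n%:R^-1 * \int[mu]_x ln (alpha1 (mxword T x n))) +
      (fun n => (s - 1) * (n%:R^-1 * \int[mu]_x ln (alpha2 (mxword T x n))))).
    apply: cvgD; first exact: integral_alpha1_cvg.
    by apply: cvgM; [exact: cvg_cst|exact: integral_alpha2_cvg].
  apply/funext => n; rewrite !fctE mulrCA -mulrDr; congr (_ * _).
  rewrite -RintegralZl//; last exact: (integrable_mxword n (fun A => ln (alpha2 A))).
  rewrite -RintegralD//.
  - apply: eq_Rintegral => x _; rewrite /svf s1 s2.
    have [a1 a2] := alpha_gt0 x n.
    by rewrite lnM ?posrE ?powR_gt0// ln_powR.
  - exact: (integrable_mxword n (fun A => ln (alpha1 A))).
  - exact: (integrable_mxword n (fun A => (s - 1) * ln (alpha2 A))).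
rewrite (_ : (fun n => _) =
    (fun n => s / 2 * (n%:R^-1 * \int[mu]_x ln `|\det (mxword T x n)|))).
  rewrite Lyap_sum; by apply: cvgM; [exact: cvg_cst|exact: integral_det_cvg].
apply/funext => n; rewrite mulrCA; congr (_ * _); rewrite -RintegralZl//.
  by apply: eq_Rintegral => x _; rewrite /svf s1 s2 ln_powR.
exact: (integrable_mxword n (fun A => ln `|\det A|)).
Qed.

(** * Growth of the vectors *)

Definition vec n x v : 'cV[R]_2 := (mxword T x n)^T *m v.

Lemma vec0 x v : vec 0 x v = v.
Proof. by rewrite /vec /mxword big_ord0 trmx1 mul1mx. Qed.

Lemma vecS n x v : vec n.+1 x v = (T (x n))^T *m vec n x v.
Proof. exact: mxword_tr_recr. Qed.

Lemma vec_shift n x v : vec n.+1 x v = vec n (shift x) ((T (x 0%N))^T *m v).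
Proof. exact: mxword_tr_recl. Qed.

Lemma vec_neq0 n x v : v != 0 -> vec n x v != 0.
Proof.
apply: contraNneq => /(congr1 (mulmx (invmx (mxword T x n)^T))).
by rewrite /vec mulKmx ?unitmx_tr ?mxword_unit// mulmx0 => ->.
Qed.

(** [v] turned by a right angle, which completes [v] to an orthogonal basis. Then
    [pair_norm] of the images of [v] and [orth v] is the Frobenius norm of the
    matrix up to a constant ([sqn_vec_orth]). *)
Definition orth v : 'cV[R]_2 := \col_i (if i == 0 then - v 1 0 else v 0 0).

Lemma cross_orth v : cross v (orth v) = sqn v.
Proof. by rewrite /cross /orth /sqn !mxE /=; ring. Qed.

Lemma cross_vec n x v (w : 'cV[R]_2) :
  cross (vec n x v) (vec n x w) = \det (mxword T x n) * cross v w.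
Proof. by rewrite cross_mulmx det_tr. Qed.

Lemma sqn_vec_orth n x v :
  sqn (vec n x v) + sqn (vec n x (orth v)) = frob2 (mxword T x n) * sqn v.
Proof. by rewrite /sqn /vec !mulmx2 /orth /frob2 !mxE /=; ring. Qed.

Lemma sqn_gt0 v : v != 0 -> 0 < sqn v.
Proof. by rewrite -enorm_gt0 -sqr_enorm => v0; rewrite exprn_gt0. Qed.

(** The dichotomy of Oseledets' theorem, from [growth_dichotomy] for the images of
    [v] and [orth v]; their area is [|det|] times a constant, with rate
    [Lyap1 + Lyap2]. *)
Lemma ae_vec_growth : \forall x \ae mu, forall v, v != 0 ->
  (fun n => n%:R^-1 * ln (enorm (vec n x v))) @ \oo --> Lyap1 \/
  (fun n => n%:R^-1 * ln (enorm (vec n x v))) @ \oo --> Lyap2.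
Proof.
apply: filterS2 ae_ln_frob ae_ln_det => x HF HD v v0.
have sv0 := sqn_gt0 v0.
have det0 n : 0 < `|\det (mxword T x n)| by rewrite normr_gt0 det_mxword_neq0.
have f0 n : 0 < frob2 (mxword T x n) by rewrite frob2_gt0 ?mxword_unit.
have HM : (fun n => n%:R^-1 * ln (pair_norm (vec n x v) (vec n x (orth v)))) @ \oo --> Lyap1.
  apply: (cvg_linear_perturb (C := `|ln (sqn v) / 2|) _ HF); apply: nearW => n.
  rewrite /pair_norm sqn_vec_orth -powR12_sqrt; last by rewrite ltW ?mulr_gt0.
  rewrite ln_powR lnM ?posrE// /ln_frob.
  by rewrite (_ : _ - _ = ln (sqn v) / 2)//; ring.
have HX : (fun n => n%:R^-1 * ln `|cross (vec n x v) (vec n x (orth v))|) @ \oo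
    --> Lyap1 + Lyap2.
  apply: (cvg_linear_perturb (C := `|ln (sqn v)|) _ HD); apply: nearW => n.
  rewrite cross_vec cross_orth normrM (ger0_norm (ltW sv0)) lnM ?posrE//.
  by rewrite addrC addKr.
have X0 n : cross (vec n x v) (vec n x (orth v)) != 0.
  by rewrite cross_vec cross_orth mulf_neq0 ?det_mxword_neq0// gt_eqF.
have [e|L21] := eqVneq Lyap2 Lyap1.
  by left; apply: growth_equal X0 HM _; rewrite -[X in _ + X]e.
have {}L21 : Lyap1 + Lyap2 < Lyap1 + Lyap1.
  by rewrite ltrD2l lt_neqAle L21 Lyap2_le1.
have -> : Lyap2 = Lyap1 + Lyap2 - Lyap1 by rewrite addrC addKr.
apply: (@growth_dichotomy _ (fun n => (T (x n))^T) _ _ (\sum_a frob2 (T a)) _ _ _ _ _ X0 HM HX L21).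
- by move=> n; exact: vecS.
- by move=> n; exact: vecS.
- move=> n; rewrite frob2_tr (bigD1 (x n : 'I_m.+1)) //= lerDl sumr_ge0// => a _.
  exact: frob2_ge0.
Qed.

(** For a fixed [x] this is a condition stable under linear combinations, whereas
    growing at the rate [Lyap2] exactly is not. *)
Definition slow x v := forall e, 0 < e ->
  \forall n \near \oo, enorm (vec n x v) <= expR ((Lyap2 + e) * n%:R).

Lemma slowD x v (w : 'cV[R]_2) : slow x v -> slow x w -> slow x (v + w).
Proof.
move=> sv sw e e0; have e20 : 0 < e / 2 by rewrite divr_gt0.
apply: filterS3 (sv _ e20) (sw _ e20) (near_linear_ge (ln 2) e20) => n Hv Hw H2.
rewrite /vec mulmxDr; apply: le_trans (enormD _ _) _; apply: le_trans (lerD Hv Hw) _.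
rewrite -mulr2n -(mulr_natl (expR _)) -[X in X * _ <= _](@lnK R) ?posrE// -expRD ler_expR.
move: H2; lra.
Qed.

Lemma slowZ x (a : R) v : slow x v -> slow x (a *: v).
Proof.
move=> sv e e0; have e20 : 0 < e / 2 by rewrite divr_gt0.
apply: filterS2 (sv _ e20) (near_linear_ge (ln (`|a| + 1)) e20) => n Hv H2.
have a1 : 0 < `|a| + 1 by rewrite ltr_wpDl.
rewrite /vec -scalemxAr enormZ.
apply: (@le_trans _ _ ((`|a| + 1) * expR ((Lyap2 + e / 2) * n%:R))).
  by apply: ler_pM; rewrite ?enorm_ge0// lerDl.
rewrite -[X in X * _ <= _](@lnK R) ?posrE// -expRD ler_expR.
move: H2; lra.
Qed.

Lemma slow_cvg x v : v != 0 ->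
  (fun n => n%:R^-1 * ln (enorm (vec n x v))) @ \oo --> Lyap2 -> slow x v.
Proof.
move=> v0 H e e0; apply: filterS (cvg_linear_near H e0) => n /andP[_].
rewrite -ler_expR lnK ?posrE//; by rewrite enorm_gt0 vec_neq0.
Qed.

(** Two independent slow vectors would make all vectors slow, hence bound the
    growth of the matrices. *)
Lemma slow_parallel x v (w : 'cV[R]_2) : Lyap2 < Lyap1 ->
  (fun n => n%:R^-1 * ln_frob n x) @ \oo --> Lyap1 ->
  slow x v -> slow x w -> cross v w = 0.
Proof.
move=> L21 HF sv sw; apply/eqP/negPn/negP => vw.
have all (u : 'cV[R]_2) : slow x u.
  have -> : u = (cross u w / cross v w) *: v + (cross v u / cross v w) *: w.
    have E : cross v w *: u = cross u w *: v + cross v u *: w.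
      apply/matrixP => i j; rewrite (ord1 j) !mxE /cross.
      have [->|i1] : i = 0 \/ i = 1.
        by case: i => [[|[|]]] // p; [left|right]; apply: val_inj.
      - by ring.
      - by rewrite i1; ring.
    rewrite ![_ / _]mulrC -!scalerA -scalerDr -E scalerA mulVf// scale1r.
    by [].
  by apply: slowD; exact: slowZ.
pose e := (Lyap1 - Lyap2) / 4; have e0 : 0 < e by rewrite divr_gt0// subr_gt0.
pose v0 : 'cV[R]_2 := \col_i (i == 0)%:R.
have [N1 _ H1] := cvg_linear_near HF e0.
have [N2 _ H2] := all v0 e e0; have [N3 _ H3] := all (orth v0) e e0.
have [N4 _ H4] := near_linear_ge (ln 2 / 2) e0.
pose n := (maxn (maxn N1 N2) (maxn N3 N4)).+1.
have /andP[h1 _] := H1 n (leqW (leq_trans (leq_maxl _ _) (leq_maxl _ _))).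
have h2 := H2 n (leqW (leq_trans (leq_maxr _ _) (leq_maxl _ _))).
have h3 := H3 n (leqW (leq_trans (leq_maxl _ _) (leq_maxr _ _))).
have h4 := H4 n (leqW (leq_trans (leq_maxr _ _) (leq_maxr _ _))).
have : frob2 (mxword T x n) <= 2 * expR ((Lyap2 + e) * n%:R) ^+ 2.
  have <- : sqn (vec n x v0) + sqn (vec n x (orth v0)) = frob2 (mxword T x n).
    by rewrite sqn_vec_orth /sqn !mxE /= expr1n expr0n addr0 mulr1.
  rewrite mulr_natl mulr2n -!sqr_enorm.
  by apply: lerD; rewrite ler_pXn2r ?nnegrE ?enorm_ge0 ?expR_ge0.
rewrite -ler_ln ?posrE ?mulr_gt0 ?exprn_gt0 ?expR_gt0 ?frob2_gt0 ?mxword_unit//.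
rewrite lnM ?posrE ?exprn_gt0 ?expR_gt0// lnXn ?expR_gt0// expRK -(mulr_natl ((Lyap2 + e) * _)).
move: h1 h4; rewrite /ln_frob => h1 h4 h5.
have h6 : (Lyap1 - e) * n%:R <= (Lyap2 + e + e) * n%:R by move: h1 h4 h5; rewrite /=; lra.
by move: h6; rewrite ler_pM2r ?ltr0n//; move: L21; rewrite /e; lra.
Qed.

End cocycle.

(** * Lines *)

Section lines.
Variable R : realType.
Implicit Types (A : 'M[R]_2) (v w : 'cV[R]_2) (V W : {vspace 'cV[R]_2}).

Lemma line_vpick W : \dim W = 1%N -> W = <[vpick W]>%VS /\ vpick W != 0.
Proof.
move=> W1; have w0 : vpick W != 0.
  by rewrite vpick0; apply/eqP => W0; rewrite W0 dimv0 in W1.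
split=> //; apply/esym/eqP; rewrite eqEdim -memvE memv_pick W1.
by rewrite dim_vline w0.
Qed.

Lemma cross_line v w : w != 0 -> (cross v w == 0) = (v \in <[w]>%VS).
Proof.
move=> w0; apply/eqP/vlineP => [vw|[k ->]]; last by rewrite /cross !mxE; ring.
have sw := sqn_gt0 w0.
exists ((v 0 0 * w 0 0 + v 1 0 * w 1 0) / sqn w).
apply: (scalerI (_ : sqn w != 0)); first by rewrite gt_eqF.
rewrite scalerA mulrC divfK ?gt_eqF//.
apply/matrixP => i j; rewrite (ord1 j) !mxE /sqn; move: vw; rewrite /cross => vw.
have [->|->] : i = 0 \/ i = 1.
  by case: i => [[|[|]]] // p; [left|right]; apply: val_inj.
- by have := congr1 (fun z => z * w 1 0) vw; rewrite mul0r; lra.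
- by have := congr1 (fun z => z * w 0 0) vw; rewrite mul0r; lra.
Qed.

Lemma mximg_line A W : A \in unitmx -> \dim W = 1%N ->
  mximg A W = W <-> exists k, A *m vpick W = k *: vpick W.
Proof.
move=> A_inv W1; have [WE w0] := line_vpick W1.
rewrite {1}WE /mximg limg_line lfunE /=.
split=> [H|[k Hk]].
  apply/vlineP; rewrite -WE; have := memv_line (A *m vpick W).
  by rewrite {1}H.
apply/eqP; rewrite eqEdim W1 dim_vline -memvE Hk memvZ ?memv_pick//=.
suff -> : k *: vpick W != 0 by [].
rewrite -Hk; apply: contraNneq w0 => /(congr1 (mulmx (invmx A))).
by rewrite mulKmx// mulmx0 => ->.
Qed.

(** A line is the range of the projection onto it. *)
Lemma line_proj_inj V W : \dim V = 1%N -> \dim W = 1%N ->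
  line_proj V = line_proj W -> V = W.
Proof.
move=> V1 W1 VW; have [VE v0] := line_vpick V1; have [WE w0] := line_vpick W1.
have projE (U : {vspace 'cV[R]_2}) : U != 0%VS -> line_proj U *m vpick U = vpick U.
  rewrite -vpick0 => u0; rewrite /line_proj -scalemxAl -mulmxA.
  have -> : (vpick U)^T *m vpick U = (sqn (vpick U))%:M.
    by apply/matrixP => i j; rewrite !ord1 !mxE sum2 /sqn !mxE !expr2.
  by rewrite mul_mx_scalar sqr_enorm scalerA mulVf ?scale1r// gt_eqF// sqn_gt0.
have W0 : W != 0%VS by rewrite -vpick0.
apply/esym/eqP; rewrite eqEdim W1 V1 leqnn andbT [X in (X <= _)%VS]WE -memvE.
rewrite -(projE W W0) -VW /line_proj -scalemxAl -mulmxA [_^T *m _]mx11_scalar mul_mx_scalar.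
by rewrite !memvZ// memv_pick.
Qed.

(** [line_proj W *m A] has rank one, so its larger singular value is its
    Frobenius norm and the smaller one is zero; the latter contributes the factor
    [0 `^ 0 = 1] when [s = 1]. *)
Lemma svf_line_proj W A (s : R) : \dim W = 1%N -> 0 <= s <= 1 ->
  svf s (line_proj W *m A) = (enorm (A^T *m vpick W) / enorm (vpick W)) `^ s.
Proof.
move=> W1 /andP[s0 s1]; have [WE w0] := line_vpick W1.
set w := vpick W in w0 *.
have sw := sqn_gt0 w0.
have [a1 a2] : alpha1 (line_proj W *m A) = Num.sqrt (frob2 (line_proj W *m A)) /\
    alpha2 (line_proj W *m A) = 0.
  apply: alpha1_singular; rewrite det_mulmx.
  have -> : \det (line_proj W) = 0.
    by rewrite det2 /line_proj !mxE !big_ord1 !mxE; ring.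
  by rewrite mul0r.
have f2 : frob2 (line_proj W *m A) = sqn (A^T *m w) / sqn w.
  rewrite /line_proj -/w -scalemxAl sqr_enorm /frob2 !mxE !sum2 !mxE !big_ord1 !mxE.
  rewrite /sqn !mulmx2 !mxE; field.
  by rewrite -/(sqn w) gt_eqF.
have E : alpha1 (line_proj W *m A) = enorm (A^T *m w) / enorm w.
  rewrite a1 f2 !enormE sqrtrM ?sqn_ge0// sqrtrV//; exact: ltW.
rewrite /svf E a2; case: ltP => // s1'.
have -> : s = 1 by apply/eqP; rewrite eq_le s1 s1'.
by rewrite ltr1n subrr powRr0 mulr1 powRr1// divr_ge0// enorm_ge0.
Qed.

End lines.

(** * Dimension exponents *)
Lemma sup_exponents (R : realType) (p a : R) : 0 < p <= 1 -> 0 < a < 1 ->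
  sup [set s : R | 0 <= s <= 1 /\ p <= a `^ s] = Num.min 1 (- ln p / - ln a).
Proof.
move=> /andP[p0 p1] /andP[a0 a1].
have la : ln a < 0 by rewrite -ln1 ltr_ln ?posrE.
have lp : ln p <= 0 by exact: ln_le0.
have M0 : 0 <= Num.min 1 (- ln p / - ln a).
  by rewrite le_min ler01 divr_ge0 ?oppr_ge0// ltW.
rewrite -[RHS](sup_itvcc M0); congr sup; apply/seteqP; split=> s /=.
  move=> [/andP[s0 s1]]; rewrite -ler_ln ?posrE ?powR_gt0// ln_powR => ps.
  rewrite in_itv /= s0 le_min s1 ler_pdivlMr ?oppr_gt0//.
  by rewrite mulrN lerN2.
rewrite in_itv /= le_min => /and3P[s0 s1 ps]; rewrite s0 s1; split=> //.
rewrite -ler_ln ?posrE ?powR_gt0// ln_powR.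
by move: ps; rewrite ler_pdivlMr ?oppr_gt0// mulrN lerN2.
Qed.

Lemma cvg_min1 (R : realType) (u : nat -> R) (l : R) :
  u @ \oo --> l -> (fun n => Num.min 1 (u n)) @ \oo --> Num.min 1 l.
Proof.
move=> /cvgrPdist_le H; apply/cvgrPdist_le => e e0.
apply: filterS (H e e0) => n; apply: le_trans.
rewrite !ler_norml; case: (leP 1 l) => hl; case: (leP 1 (u n)) => hu; rewrite ?subrr.
- by rewrite oppr_le0 normr_ge0.
- have := ler_norm (l - u n); have := normr_ge0 (l - u n).
  by move=> *; apply/andP; split; lra.
- have := ler_norm (- (l - u n)); rewrite normrN; have := normr_ge0 (l - u n).
  by move=> *; apply/andP; split; lra.
- by rewrite -ler_norml.
Qed.

(** [g] decreases strictly on nonnegative numbers, with slope [L1] up to [1]. So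
    the root of [h + g s = 0] is [h / - L1] if [h < - L1] and is at least [1]
    otherwise. The hypothesis on [D] has the form that [xget] provides; the proof
    exhibits a root in each regime. *)
Lemma min1_root (R : realType) (h L1 L2 : R) (g : R -> R) (D : R) :
  0 <= h -> L1 < 0 -> L2 <= L1 ->
  (forall s, g s = if s < 1 then s * L1 else if s < 2 then L1 + (s - 1) * L2
   else s / 2 * (L1 + L2)) ->
  ((exists s, 0 <= s /\ h + g s = 0) -> 0 <= D /\ h + g D = 0) ->
  Num.min 1 D = Num.min 1 (h / - L1).
Proof.
move=> h0 L10 L21 gE HD.
have L20 : L2 < 0 by exact: le_lt_trans L10.
have [hL|hL] := ltP h (- L1).
  have hd : h / - L1 < 1 by rewrite ltr_pdivrMr ?oppr_gt0// mul1r.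
  have [D0] : 0 <= D /\ h + g D = 0.
    apply: HD; exists (h / - L1); split.
      by rewrite divr_ge0// oppr_ge0 ltW.
    by rewrite gE hd; field; rewrite lt_eqF.
  rewrite gE; case: ltP => D1.
    move=> e; rewrite (min_idPr (ltW hd)).
    apply: (mulIf (_ : - L1 != 0)); first by rewrite oppr_eq0 lt_eqF.
    by rewrite divfK ?oppr_eq0 ?lt_eqF//; lra.
  case: ltP => D2 e; exfalso.
    have : (D - 1) * L2 <= 0 by rewrite mulr_ge0_le0 ?subr_ge0// ltW.
    by move: e hL; lra.
  have : (D / 2 - 1) * (L1 + L2) <= 0.
    by rewrite mulr_ge0_le0//; move: L10 L20 D2; lra.
  by move: e hL L20; lra.
have hd : 1 <= h / - L1 by rewrite ler_pdivlMr ?oppr_gt0// mul1r.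
rewrite (min_idPl hd); apply/min_idPl.
have [D0] : 0 <= D /\ h + g D = 0.
  apply: HD.
  have [h2|h2] := ltP h (- L1 - L2).
    exists (1 + (h + L1) / - L2).
    have q0 : 0 <= (h + L1) / - L2 by rewrite divr_ge0//; lra.
    have q1 : (h + L1) / - L2 < 1 by rewrite ltr_pdivrMr; lra.
    split; first by lra.
    rewrite gE ltNge lerDl q0 /= (_ : 1 + _ < 2); last by lra.
    by field; rewrite lt_eqF.
  exists (h / - (L1 + L2) * 2).
  have LL : 0 < - (L1 + L2) by lra.
  have q1 : 1 <= h / - (L1 + L2) by rewrite ler_pdivlMr// mul1r; lra.
  split; first by lra.
  rewrite gE ltNge (_ : 1 <= _)/=; last by lra.
  rewrite ltNge (_ : 2 <= _)/=; last by lra.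
  by field; rewrite lt_eqF//; lra.
rewrite gE leNgt; case: ltP => // D1 e; exfalso.
have : 0 < (D - 1) * L1 by rewrite nmulr_lgt0// subr_lt0.
by move: e hL; lra.
Qed.

(** * Projections of ergodic measures *)
Section projections.
Variables (R : realType) (m : nat) (T : 'I_m.+1 -> 'M[R]_2).
Hypothesis T_inv : forall i, T i \in unitmx.
Hypothesis T_lt1 : forall i, opnorm (T i) < 1.
Variable mu : probability (Shift m) R.
Hypothesis erg : ergodic_measure (@left_shift m) mu.
Local Notation shift := (@left_shift m).
Local Notation L1 := (Lyap1 mu T).
Local Notation L2 := (Lyap2 mu T).
Local Notation vec := (@vec R m T).
Implicit Types (x : Shift m) (W : {vspace 'cV[R]_2}).
Let mf := measurable_left_shift (m := m).
Let inv : invariant_measure shift mu := erg.1.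

(** The largest norm of the letters is a contraction factor; [2^-1] makes it
    positive. *)
Lemma contraction : exists2 k : R, 0 < k < 1 &
  forall x n (v : 'cV[R]_2), enorm (vec n x v) <= k ^+ n * enorm v.
Proof.
pose k : R := \big[Order.max/2^-1]_a opnorm (T a).
have k0 : 0 < k by apply: (@lt_le_trans _ _ 2^-1); [rewrite invr_gt0|exact: bigmax_ge_id].
have k1 : k < 1 by apply: bigmax_lt => [|i _ //]; rewrite invf_lt1// ltr1n.
exists k; first by rewrite k0.
move=> x n v; elim: n => [|n IH]; first by rewrite vec0 expr0 mul1r.
rewrite vecS; apply: le_trans (enorm_tr_mulmx _ _) _.
rewrite exprS -mulrA; apply: ler_pM => //; last first.
- exact: le_bigmax.
- exact: enorm_ge0.
apply: le_trans (enorm_ge0 (T (x n) *m delta_mx 0 0)) _.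
apply: le_trans (opnorm_ge _ _) _.
rewrite (_ : enorm _ = 1) ?mulr1//.
by rewrite enormE /sqn !mxE /= expr1n expr0n addr0 sqrtr1.
Qed.

(** The Frobenius norm is read off from the images of an orthonormal basis, which
    decay exponentially by [contraction]. *)
Lemma Lyap1_lt0 : L1 < 0.
Proof.
have [k /andP[k0 k1] Hk] := contraction.
have lk : ln k < 0 by rewrite -ln1 ltr_ln ?posrE.
have [x HF] := ae_ex (ae_ln_frob T_inv erg).
apply: (@le_lt_trans _ _ (ln k / 2)); last by lra.
pose v : 'cV[R]_2 := \col_i (i == 0)%:R.
have sv : sqn v = 1 by rewrite /sqn !mxE /= expr1n expr0n addr0.
have so : sqn (orth v) = 1 by rewrite /sqn /orth !mxE /= expr1n oppr0 expr0n add0r.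
have bound n : ln_frob T n x <= ln 2 / 2 + ln k * n%:R.
  have : frob2 (mxword T x n) <= 2 * (k ^+ n) ^+ 2.
    rewrite -[leLHS]mulr1 -[X in _ * X <= _]sv -(sqn_vec_orth T n x v) mulr_natl mulr2n.
    apply: lerD; rewrite -sqr_enorm ler_pXn2r ?nnegrE ?enorm_ge0 ?exprn_ge0 ?(ltW k0)//;
      apply: le_trans (Hk _ _ _) _; rewrite enormE ?sv ?so sqrtr1 mulr1//.
  rewrite -ler_ln ?posrE ?mulr_gt0 ?exprn_gt0 ?frob2_gt0 ?mxword_unit//.
  rewrite lnM ?posrE ?exprn_gt0// !lnXn ?exprn_gt0// /ln_frob.
  by rewrite -(mulr_natr (ln k)) -(mulr_natr (ln k * _)); lra.
have e0 : 0 < - ln k / 4 by rewrite divr_gt0// oppr_gt0.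
have [N1 _ H1] := cvg_linear_near HF e0.
have [N2 _ H2] := near_linear_ge (ln 2 / 2) e0.
pose n := (maxn N1 N2).+1.
have /andP[h1 _] := H1 n (leqW (leq_maxl _ _)).
have h2 := H2 n (leqW (leq_maxr _ _)).
have n0 : 0 < n%:R :> R by rewrite ltr0n.
rewrite -(ler_pM2r n0); move: h1 h2 (bound n); rewrite /=; lra.
Qed.

Section dimension.
Variable h : R.
Hypothesis h0 : 0 <= h.

(** The dimension of the projected measure when the vectors of the line grow at
    the rate [l]. *)
Definition dim_at (l : R) : R := Num.min 1 (h / - l).

Lemma dim_at_le (l l' : R) : l <= l' -> l' < 0 -> dim_at l <= dim_at l'.
Proof.
move=> ll l'0; have l0 : l < 0 by exact: le_lt_trans l'0.
rewrite le_min ge_min lexx /= ge_min; apply/orP; right.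
by rewrite ler_wpM2l// lef_pV2 ?posrE ?oppr_gt0// lerN2.
Qed.

(** Both values are [0] if [h = 0], and both are [1] if [h + l >= 0]; otherwise
    the minimum defining [dim_at l] is the quotient, which is strictly monotone. *)
Lemma dim_at_lt (l l' : R) : l <= l' -> l' < 0 ->
  dim_at l < dim_at l' <-> [/\ l < l', 0 < h & h + l < 0].
Proof.
move=> ll l'0; have l0 : l < 0 by exact: le_lt_trans l'0.
split=> [H|[ll' hp hl]].
  have ll' : l < l'.
    by rewrite lt_neqAle ll andbT; apply/eqP => e; rewrite e ltxx in H.
  split=> //.
    rewrite lt_def h0 andbT; apply/eqP => e.
    by move: H; rewrite /dim_at e !mul0r ltxx.
  rewrite ltNge; apply/negP => hl; move: H; rewrite /dim_at ltNge => /negP; apply.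
  have -> : Num.min 1 (h / - l) = 1.
    by apply/min_idPl; rewrite ler_pdivlMr ?oppr_gt0// mul1r; lra.
  by rewrite ge_min lexx.
have h1 : h / - l < 1 by rewrite ltr_pdivrMr ?oppr_gt0// mul1r; lra.
rewrite /dim_at (min_idPr (ltW h1)) lt_min h1 /=.
by rewrite ltr_pM2l// ltf_pV2 ?posrE ?oppr_gt0// ltrN2.
Qed.

Hypothesis hE : entropy shift mu = h%:E.

Lemma min_dim_LY : Num.min 1 (dim_LY mu T) = dim_at L1.
Proof.
apply: (@min1_root _ h L1 L2 (fun s => growth mu T (svf s))).
- exact: h0.
- exact: Lyap1_lt0.
- exact: Lyap2_le1.
- by move=> s; exact: growth_svf.
move=> [s [s0 e]]; have : exists s : R, 0 <= s /\
    (entropy shift mu + (growth mu T (svf s))%:E = 0)%E.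
  by exists s; rewrite hE -EFinD e.
by move=> /(xgetPex 0)[d0]; rewrite -/(dim_LY mu T) hE -EFinD => -[].
Qed.

End dimension.

Lemma S_nE W n x : \dim W = 1%N -> (0 < n)%N -> 0 < pword mu (word n x) ->
  S_n mu T W n x =
  Num.min 1 (info mu (word n x) / - (ln (enorm (vec n x (vpick W))) - ln (enorm (vpick W)))).
Proof.
move=> W1 n0 p0; have [_ w0] := line_vpick W1; set w := vpick W in w0 *.
have nw : 0 < enorm w by rewrite enorm_gt0.
have nv : 0 < enorm (vec n x w) by rewrite enorm_gt0 vec_neq0.
rewrite -ln_div ?posrE// /info gt_eqF// -sup_exponents; last 2 first.
- by rewrite p0 pword_le1.
- rewrite divr_gt0//= ltr_pdivrMr// mul1r.
  have [k /andP[k0 k1] Hk] := contraction.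
  apply: le_lt_trans (Hk x n w) _; rewrite gtr_pMl//.
  by rewrite exprn_ilt1 ?(ltW k0)// -lt0n.
rewrite /S_n; congr sup; apply: eq_set => s; apply/propext.
have muE : mu (cylinder x n) = (pword mu (word n x))%:E.
  by rewrite cylinder_word_cyl /pword fineK// fin_num_measure//; exact: measurable_word_cyl.
by split=> -[s01]; rewrite muE lee_fin svf_line_proj.
Qed.

Lemma S_limE W x (h l : R) : \dim W = 1%N -> l < 0 ->
  (forall n, 0 < pword mu (word n x)) ->
  (fun n => n%:R^-1 * info mu (word n x)) @ \oo --> h ->
  (fun n => n%:R^-1 * ln (enorm (vec n x (vpick W)))) @ \oo --> l ->
  S_lim mu T W x = dim_at h l.
Proof.
move=> W1 l0 p0 Hh Hl; apply: cvg_lim => //.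
have Hl' : (fun n => n%:R^-1 * (ln (enorm (vec n x (vpick W))) - ln (enorm (vpick W)))) @ \oo --> l.
  apply: (cvg_linear_perturb (C := `|ln (enorm (vpick W))|) _ Hl); apply: nearW => n.
  by rewrite addrC addKr normrN.
have Q : (fun n => (n%:R^-1 * info mu (word n x)) *
    (- (n%:R^-1 * (ln (enorm (vec n x (vpick W))) - ln (enorm (vpick W)))))^-1) @ \oo --> h / - l.
  apply: cvgM; first exact: Hh.
  by apply: cvgV; [rewrite oppr_eq0 lt_eqF|exact: cvgN].
apply: cvg_trans (cvg_min1 Q); apply: near_eq_cvg; exists 1%N => // n /= n0.
rewrite S_nE//; congr (Num.min 1 _).
have n0' : n%:R != 0 :> R by rewrite pnatr_eq0 -lt0n.
by rewrite -mulrN invfM invrK mulrACA mulVf// mul1r.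
Qed.

Lemma ae_shift (P : Shift m -> Prop) :
  (\forall x \ae mu, P x) -> \forall x \ae mu, P (shift x).
Proof.
move=> [N [mN N0 sN]]; exists (shift @^-1` N); split.
- by rewrite -[X in measurable X]setTI; exact: mf.
- by rewrite -N0; exact: inv.
- by move=> x /= nP; exact: sN.
Qed.

Lemma ae_letter_gt0 : \forall x \ae mu, forall n, (0 < mu (cylinder1 (x n : 'I_m.+1)))%E.
Proof.
apply: filterS (ae_pword_gt0 mu) => x px n.
have suffix u w : pword mu (u ++ w) <= pword mu w.
  elim: u => //= a u IH; apply: le_trans IH; exact: pword_cons.
have := lt_le_trans (px n.+1) _; move=> /(_ (pword mu [:: (x n : 'I_m.+1)])).
have -> : word n.+1 x = word n x ++ [:: (x n : 'I_m.+1)].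
  by rewrite cats1; exact: mkseqS.
move=> /(_ (suffix _ _)) p.
have -> : cylinder1 (x n : 'I_m.+1) = word_cyl [:: (x n : 'I_m.+1)].
  apply/seteqP; split=> y; rewrite /cylinder1 /word_cyl /=; first by move=> <-.
  by case.
by move: p; rewrite /pword; case: (mu _) (measure_ge0 mu (word_cyl [:: (x n : 'I_m.+1)])) => [r| |]//=;
  rewrite ?ltxx // lte_fin.
Qed.

(** [vec n x w] is [w] scaled by the product of the eigenvalues along [x]. *)
Lemma eigen_growth (a : 'I_m.+1 -> R) (w : 'cV[R]_2) : w != 0 ->
  (forall i, (0 < mu (cylinder1 i))%E -> (T i)^T *m w = a i *: w) ->
  \forall x \ae mu, (fun n => n%:R^-1 * ln (enorm (vec n x w))) @ \oo -->
    \sum_(i | (0 < mu (cylinder1 i))%E) fine (mu (cylinder1 i)) * ln `|a i|.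
Proof.
move=> w0 aE.
have -> : \sum_(i | (0 < mu (cylinder1 i))%E) fine (mu (cylinder1 i)) * ln `|a i| =
    \sum_i ln `|a i| * fine (mu (cylinder1 i)).
  rewrite big_mkcond /=; apply: eq_bigr => i _; case: ltP => [_|]; first by rewrite mulrC.
  rewrite le_eqVlt ltNge measure_ge0 orbF => /eqP ->.
  by rewrite mulr0.
apply: filterS2 (birkhoff_letter erg (fun i => ln `|a i|)) ae_letter_gt0 => x Hx xA.
apply: (cvg_linear_perturb (C := `|ln (enorm w)|) _ Hx); apply: nearW => n.
suff [c [cE ->]] : exists c, vec n x w = c *: w /\ ln (enorm (vec n x w)) =
    ergodic_sum shift (fun x => ln `|a (x 0%N)|) n x + ln (enorm w).
  by rewrite addrC addKr.
elim: n => [|n [c [cE IH]]].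
  by exists 1; rewrite vec0 scale1r /ergodic_sum big_ord0 add0r.
have E : vec n.+1 x w = a (x n) *: vec n x w.
  by rewrite vecS cE -scalemxAr aE// !scalerA mulrC.
exists (a (x n) * c); split; first by rewrite E cE scalerA.
have := vec_neq0 T_inv n.+1 x w0; rewrite E scaler_eq0 negb_or => /andP[an0 vn0].
rewrite enormZ lnM ?posrE ?normr_gt0 ?enorm_gt0// IH addrCA addrA.
rewrite /ergodic_sum big_ord_recr /=; congr (_ + ln `|a _| + _).
by rewrite iter_left_shift addn0.
Qed.

(** Dropping the first letter delays the growth by one step, which only changes
    [e]. *)
Lemma slow_shift x v : slow T mu x v -> slow T mu (shift x) ((T (x 0%N))^T *m v).
Proof.
have aux (l r s : R) : l + s / 2 <= s / 2 * r -> (l + s / 2) * (r + 1) <= (l + s) * r.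
  by lra.
move=> sv e e0; have e20 : 0 < e / 2 by rewrite divr_gt0.
have [N1 _ H1] := sv _ e20; have [N2 _ H2] := near_linear_ge (L2 + e / 2) e20.
exists (maxn N1 N2) => // n /=; rewrite geq_max => /andP[n1 n2].
rewrite -vec_shift; apply: le_trans (H1 n.+1 (leqW n1)) _.
by rewrite ler_expR -(natr1 n); apply: aux; exact: (H2 n n2).
Qed.

Local Notation rate x v l := ((fun n => n%:R^-1 * ln (enorm (vec n x v))) @ \oo --> (l : R)).

(** Along the shift of a typical point that starts with [i], the vector
    [vpick W] is slow because almost every point has this property, and so is its
    image under [(T i)^T], by [slow_shift]. Hence they are parallel. *)
Lemma line_invariant W : \dim W = 1%N -> L2 < L1 ->
  (\forall x \ae mu, rate x (vpick W) L2) ->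
  forall i, (0 < mu (cylinder1 i))%E -> mximg (T i)^T W = W.
Proof.
move=> W1 L21 H i mi; have [WE w0] := line_vpick W1; set w := vpick W in H w0 *.
apply/(mximg_line _ W1); first by rewrite unitmx_tr.
apply: contrapT => nk.
suff : mu (cylinder1 i) = 0%E by move=> e; rewrite e ltxx in mi.
apply: measure_negligible; first exact: measurable_cylinder1.
apply: negligibleS (filterI H (ae_shift (filterI H (ae_ln_frob T_inv erg)))) => x xi.
move=> [Hx [Hs HF]]; apply: nk; apply/vlineP; rewrite -cross_line//.
apply/eqP; apply: (slow_parallel T_inv L21 HF).
  have <- : x 0%N = i := xi.
  exact: slow_shift (slow_cvg T_inv w0 Hx).
exact: (slow_cvg T_inv w0 Hs).
Qed.

Lemma sum_ln_det_div (a : 'I_m.+1 -> R) :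
  (forall i, (0 < mu (cylinder1 i))%E -> a i != 0) ->
  \sum_(i | (0 < mu (cylinder1 i))%E) fine (mu (cylinder1 i)) * ln `|\det (T i) / a i| =
  L1 + L2 - \sum_(i | (0 < mu (cylinder1 i))%E) fine (mu (cylinder1 i)) * ln `|a i|.
Proof.
move=> a0; rewrite Lyap_sum// /det_exponent.
have -> : \sum_i ln `|\det (T i)| * fine (mu (cylinder1 i)) =
    \sum_(i | (0 < mu (cylinder1 i))%E) fine (mu (cylinder1 i)) * ln `|\det (T i)|.
  rewrite [RHS]big_mkcond /=; apply: eq_bigr => i _; case: ltP => [_|]; first by rewrite mulrC.
  rewrite le_eqVlt ltNge measure_ge0 orbF => /eqP ->.
  by rewrite mulr0.
rewrite -sumrB; apply: eq_bigr => i /a0 ai; rewrite -mulrBr -ln_div ?posrE ?normr_gt0//.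
  by rewrite normrM normfV.
by have := T_inv i; rewrite unitmxE unitfE.
Qed.

Section almost_sure_dimension.
Variables (h : R) (W : {vspace 'cV[R]_2}).
Hypothesis W1 : \dim W = 1%N.
Hypothesis h0 : 0 <= h.
Hypothesis aeh : \forall x \ae mu, (fun n => n%:R^-1 * info mu (word n x)) @ \oo --> h.
Let w := vpick W.

Lemma Lyap2_lt0 : L2 < 0.
Proof. exact: le_lt_trans (Lyap2_le1 T_inv erg) Lyap1_lt0. Qed.

Lemma ae_S_lim l : l < 0 ->
  \forall x \ae mu, rate x w l -> S_lim mu T W x = dim_at h l.
Proof.
move=> l0; apply: filterS2 aeh (ae_pword_gt0 mu) => x Hx px Hl.
exact: S_limE.
Qed.

Lemma ae_dichotomy : \forall x \ae mu,
  rate x w L1 /\ S_lim mu T W x = dim_at h L1 \/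
  rate x w L2 /\ S_lim mu T W x = dim_at h L2.
Proof.
have [_ w0] := line_vpick W1.
apply: filterS3 (ae_vec_growth T_inv erg) (ae_S_lim Lyap1_lt0) (ae_S_lim Lyap2_lt0).
move=> x /(_ _ w0)[r|r] S1 S2; [left|right]; split=> //; [exact: S1|exact: S2].
Qed.

Let muT : (0 < mu setT)%E. Proof. by rewrite probability_setT. Qed.

Lemma S_up_cst c : (\forall x \ae mu, S_lim mu T W x = c) -> S_up mu T W = c%:E.
Proof.
move=> H; apply: (ess_sup_ae_cst c%:E muT).
by apply: filterS H => x ->.
Qed.

Lemma S_low_cst c : (\forall x \ae mu, S_lim mu T W x = c) -> S_low mu T W = c%:E.
Proof.
move=> H; apply: (ess_inf_ae_cst c%:E muT).
by apply: filterS H => x ->.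
Qed.

Lemma S_up_low_cst c : (\forall x \ae mu, S_lim mu T W x = c) ->
  S_up mu T W = S_low mu T W.
Proof. by move=> H; rewrite (S_up_cst H) (S_low_cst H). Qed.

(** By [ae_dichotomy], [S_lim] can only be below [dim_at h L1] where the rate is
    [L2]. *)
Lemma S_up_lt : (S_up mu T W < (dim_at h L1)%:E)%E <->
  (\forall x \ae mu, rate x w L2) /\ dim_at h L2 < dim_at h L1.
Proof.
split=> [H|[H d]]; last first.
  rewrite (@S_up_cst (dim_at h L2)) ?lte_fin//.
  by apply: filterS2 H (ae_S_lim Lyap2_lt0) => x r ->.
have aeS : \forall x \ae mu, S_lim mu T W x < dim_at h L1.
  apply: filterS (ess_sup_ge mu (fun x => (S_lim mu T W x)%:E)) => x Sx.
  by rewrite -lte_fin; exact: le_lt_trans Sx H.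
have E : \forall x \ae mu, rate x w L2 /\ dim_at h L2 < dim_at h L1.
  apply: filterS2 aeS ae_dichotomy => x Sx [[_ e]|[r e]]; first by rewrite e ltxx in Sx.
  by rewrite -e.
split; first by apply: filterS E => x [].
by have [x []] := ae_ex E.
Qed.

Section splitting.
Variables (D : set (Shift m)) (E2 : Shift m -> {vspace 'cV[R]_2}).
Hypothesis L21 : L2 < L1.
Hypotheses (mD : measurable D) (D1 : mu D = 1%E).
Hypothesis mE2 : measurable_lines D E2.
Hypothesis gE2 : forall x, D x -> growth_on T x (E2 x) L2.
Let Z : set (Shift m) := [set x | D x /\ E2 x = W].

(** A line is determined by the entries of its projection. *)
Lemma measurable_line_eq : measurable Z.
Proof.
have -> : Z = \big[setI/setT]_(i < 2) \big[setI/setT]_(j < 2)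
    (D `&` (fun x => line_proj (E2 x) i j) @^-1` [set line_proj W i j]).
  apply/seteqP; split=> x.
    by move=> [Dx Ex]; rewrite !big_ord_recr !big_ord0 /= !Ex.
  rewrite !big_ord_recr !big_ord0 /=.
  move=> [[_ [[_ [Dx e00]] [_ e01]]] [[_ [_ e10]] [_ e11]]]; split=> //.
  apply: line_proj_inj => //; first exact: mE2.1.
  apply/matrixP => i j; case: i j => [[|[|//]] p] [[|[|//]] q].
  - by move: e00; congr (_ = _); congr (line_proj _ _ _); exact: val_inj.
  - by move: e01; congr (_ = _); congr (line_proj _ _ _); exact: val_inj.
  - by move: e10; congr (_ = _); congr (line_proj _ _ _); exact: val_inj.
  - by move: e11; congr (_ = _); congr (line_proj _ _ _); exact: val_inj.
apply: bigsetI_measurable => i _; apply: bigsetI_measurable => j _.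
exact: mE2.2.
Qed.

(** If [vpick W] grows at the rate [L2], it is slow, hence parallel to the vectors
    of [E2 x], so that [E2 x] is [W]. *)
Lemma ae_S_lim_splitting : \forall x \ae mu,
  (Z x -> S_lim mu T W x = dim_at h L2) /\ (~ Z x -> S_lim mu T W x = dim_at h L1).
Proof.
have [WE w0] := line_vpick W1.
have aeD : \forall x \ae mu, D x by apply/ae_pr1.
apply: filterS3 (filterI aeD (ae_ln_frob T_inv erg)) (ae_S_lim Lyap2_lt0) ae_dichotomy.
move=> x [Dx HF] S2 dic; split=> [[_ EW]|nZ].
  by apply: S2; apply: gE2 => //; rewrite EW memv_pick.
case: dic => [[_ e]|[r _]]; first exact: e.
case: nZ; split; first exact: Dx.
have [EE v0] := line_vpick (mE2.1 x Dx).
have rv : rate x (vpick (E2 x)) L2 by apply: (gE2 Dx) => //; exact: memv_pick.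
have := slow_parallel T_inv L21 HF (slow_cvg T_inv w0 r) (slow_cvg T_inv v0 rv).
move/eqP; rewrite cross_line// -EE memvE -WE => sub.
by apply/esym/eqP; rewrite eqEdim sub W1 (mE2.1 x Dx).
Qed.

Lemma S_up_neq_low : S_up mu T W <> S_low mu T W <->
  ((0 < mu Z)%E /\ (mu Z < 1)%E) /\ dim_at h L2 < dim_at h L1.
Proof.
have mZ := measurable_line_eq; have aeS := ae_S_lim_splitting.
have dle : dim_at h L2 <= dim_at h L1.
  exact: (dim_at_le h0 (ltW L21) Lyap1_lt0).
split=> [H|[[Z0 Z1] dlt] E].
  have [d|d] := ltP (dim_at h L2) (dim_at h L1); last first.
    have dE := le_anti (introT andP (conj dle d)).
    exfalso; apply: H; apply: (@S_up_low_cst (dim_at h L1)).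
    apply: filterS aeS => x [S2 S1]; have [zx|zx] := pselect (Z x); last exact: S1.
    by rewrite -dE; exact: S2.
  split=> //; split.
    rewrite lt_neqAle measure_ge0 andbT; apply/eqP => /esym /(ae_not_pr0 mZ) aeZ.
    apply: H; apply: (@S_up_low_cst (dim_at h L1)).
    by apply: filterS2 aeS aeZ => x [_ S1] zx; exact: S1.
  rewrite lt_neqAle probability_le1// andbT; apply/eqP => /(ae_pr1 _ mZ) aeZ.
  apply: H; apply: (@S_up_low_cst (dim_at h L2)).
  by apply: filterS2 aeS aeZ => x [S2 _] zx; exact: S2.
(* If the essential bounds agree, their common value differs from one of
   [dim_at h L1] and [dim_at h L2], and the set where that value is taken must be
   null. *)
have Sup : \forall x \ae mu, ((S_lim mu T W x)%:E <= S_up mu T W)%E.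
  exact: ess_sup_ge.
have Slow : \forall x \ae mu, (S_low mu T W <= (S_lim mu T W x)%:E)%E.
  exact: ess_inf_le.
have [l1|l1] := leP (dim_at h L1)%:E (S_low mu T W).
  move: Z0; rewrite (measure_negligible mZ) ?ltxx//.
  apply: negligibleS (filterI aeS Slow) => x Zx [[S2 _]]; rewrite S2// => /(le_trans l1).
  by rewrite lee_fin leNgt dlt.
move: Z1; rewrite (_ : mu Z = 1%E) ?ltxx//; apply/ae_pr1 => //.
apply: filterS2 aeS Sup => x [_ S1] S; apply: contrapT => /S1 e.
by move: S; rewrite e E leNgt l1.
Qed.

End splitting.
End almost_sure_dimension.
End projections.

Theorem proposition7p2 (R : realType) (m : nat) (T : 'I_m.+1 -> 'M[R]_2)
    (T_inv : forall i, T i \in unitmx)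
    (T_lt1 : forall i, opnorm (T i) < 1)
    (W : {vspace 'cV[R]_2}) (W_line : \dim W = 1%N)
    (mu : probability (Shift m) R)
    (mu_erg : ergodic_measure (@left_shift m) mu) :
  let h := entropy (@left_shift m) mu in
  let L1 := Lyap1 mu T in
  let L2 := Lyap2 mu T in
  ((S_up mu T W < (Num.min 1 (dim_LY mu T))%:E)%E
   <->
   [/\ (forall i, (0 < mu (cylinder1 i))%E -> mximg (T i)^T W = W),
       (exists a : 'I_m.+1 -> R,
         (forall i, (0 < mu (cylinder1 i))%E ->
            forall w : 'cV[R]_2, w \in W -> (T i)^T *m w = a i *: w) /\
         [/\ L2 = \sum_(i | (0 < mu (cylinder1 i))%E)
                    fine (mu (cylinder1 i)) * ln `|a i|,
             L2 < L1 &
             L1 = \sum_(i | (0 < mu (cylinder1 i))%E)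
                    fine (mu (cylinder1 i)) * ln `|\det (T i) / a i|]) &
       (0 < h)%E /\ (h + L2%:E < 0)%E])
  /\
  (forall (D : set (Shift m)) (E1 E2 : Shift m -> {vspace 'cV[R]_2}),
   (L2 < L1 -> oseledets_splitting mu T D E1 E2) ->
   (S_up mu T W <> S_low mu T W
    <->
    [/\ L2 < L1,
        (0 < mu [set x | D x /\ E2 x = W])%E /\
        (mu [set x | D x /\ E2 x = W] < 1)%E &
        (0 < h)%E /\ (h + L2%:E < 0)%E])).
Proof.
have [h [aeh int_h]] := shannon_mcmillan_breiman mu_erg.
have hE := kolmogorov_sinai mu_erg int_h.
have h0 : 0 <= h.
  have [x Hx] := ae_ex aeh; rewrite -(cvg_lim (@Rhausdorff R) Hx).
  apply: limr_ge; first exact: cvgP Hx.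
  by apply: nearW => n; rewrite mulr_ge0// info_ge0.
have L10 := Lyap1_lt0 T_inv T_lt1 mu_erg.
have L21 := Lyap2_le1 T_inv mu_erg.
have [WE w0] := line_vpick W_line.
move=> hh L1 L2; rewrite /hh hE -EFinD !lte_fin.
have dlt : dim_at h L2 < dim_at h L1 <-> [/\ L2 < L1, 0 < h & h + L2 < 0].
  exact: dim_at_lt.
split.
  rewrite (min_dim_LY T_inv T_lt1 mu_erg h0 hE).
  rewrite (S_up_lt T_inv T_lt1 mu_erg W_line aeh) dlt; split.
    move=> [aer [lt21 hp hl]].
    have invW := line_invariant T_inv mu_erg W_line lt21 aer.
    have [i|a aE] := @choice _ _ (fun i k => (0 < mu (cylinder1 i))%E ->
        (T i)^T *m vpick W = k *: vpick W).
      have [mi|mi] := pselect (0 < mu (cylinder1 i))%E; last by exists 0.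
      have Ti : (T i)^T \in unitmx by rewrite unitmx_tr.
      by have [k Hk] := (mximg_line Ti W_line).1 (invW i mi); exists k.
    have a0 i : (0 < mu (cylinder1 i))%E -> a i != 0.
      move=> mi; apply: contraNneq w0 => ai.
      have /(congr1 (mulmx (invmx (T i)^T))) := aE i mi.
      by rewrite ai scale0r mulmx0 mulKmx ?unitmx_tr// => ->.
    have L2E : L2 = \sum_(i | (0 < mu (cylinder1 i))%E) fine (mu (cylinder1 i)) * ln `|a i|.
      have [x [r1 r2]] := ae_ex (filterI aer (eigen_growth T_inv mu_erg w0 aE)).
      exact: (cvg_unique (@Rhausdorff R) r1 r2).
    split=> //; exists a; split.
      by move=> i mi w; rewrite WE => /vlineP[k ->]; rewrite -scalemxAr aE// !scalerA mulrC.
    split=> //; rewrite (sum_ln_det_div T_inv mu_erg a0) -L2E.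
    by rewrite addrK.
  move=> [_ [a [aE [L2E lt21 _]]] [hp hl]]; split=> //.
  rewrite -/L2 L2E; apply: (eigen_growth T_inv mu_erg w0) => i mi.
  by apply: aE => //; exact: memv_pick.
(* If [L1 = L2] then [S_lim] is almost surely constant. *)
move=> D E1 E2 H; have [lt21|ge21] := ltP L2 L1.
  have [[mD _ D1] [_ mE2 gE]] := H lt21.
  have gE2 x : D x -> growth_on T x (E2 x) L2 by move=> /gE[].
  rewrite (S_up_neq_low T_inv T_lt1 mu_erg W_line h0 aeh lt21 mD D1 mE2 gE2) dlt.
  by split=> [[? [? ? ?]]|[? ? [? ?]]].
have L12 : L1 = L2 by apply/eqP; rewrite eq_le ge21 L21.
split=> [neq|[]//]; exfalso; apply: neq; apply: (@S_up_low_cst _ _ _ _ _ (dim_at h L1)).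
apply: filterS (ae_dichotomy T_inv T_lt1 mu_erg W_line aeh) => x [[_ e]|[_ e]].
  exact: e.
by rewrite L12; exact: e.
Qed.
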